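(* For every $\phi\in Z^0(\Omega)$, $|z|^{1/2}\partial_z\phi\in L^2((-1,1);H^{1/2}(x_0,x_1))$ and $\big\||z|^{1/2}\partial_z\phi\big\|_{L^2_z(H^{1/2}_x)}\le C\|\phi\|_{Z^0}$ with $C$ depending only on $x_0,x_1$.
   Context: Fix $x_0<x_1$, $\Omega=(x_0,x_1)\times(-1,1)$ with coordinates $(x,z)$. $Z^0(\Omega)$ is the space of $\phi$ with $\phi,\partial_z\phi,\partial_{zz}\phi,z\partial_x\phi\in L^2(\Omega)$, normed by $\|z\partial_x\phi\|_{L^2}+\|\partial_{zz}\phi\|_{L^2}+\|\partial_z\phi\|_{L^2}+\|\phi\|_{L^2}$. *)

(* Defs.v *)
From HB Require Import structures.
From mathcomp Require Import all_boot all_order all_algebra.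
From mathcomp Require Import all_classical all_reals all_analysis.
From mathcomp Require Import measurable_realfun.
Set Implicit Arguments. Unset Strict Implicit. Unset Printing Implicit Defensive.
Import Order.TTheory GRing.Theory Num.Theory.
Import numFieldNormedType.Exports.
Local Open Scope classical_set_scope.
Local Open Scope ring_scope.

Section Defs.
Variable R : realType.

Definition leb : {measure set (measurableTypeR R) -> \bar R} := lebesgue_measure.
Definition leb2 := (@lebesgue_measure R \x @lebesgue_measure R)%E.

Definition Omega (x0 x1 : R) : set (R * R) :=
  [set p | x0 < p.1 < x1 /\ -1 < p.2 < 1].

Definition zI : set R := `]-1, 1[.

Definition dx (f : R * R -> R) : R * R -> R :=
  fun p => derive1 (fun t => f (t, p.2)) p.1.
Definition dz (f : R * R -> R) : R * R -> R :=
  fun p => derive1 (fun t => f (p.1, t)) p.2.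

Fixpoint Ck (k : nat) (f : R * R -> R) : Prop :=
  continuous f /\
  match k with
  | 0%N => True
  | k'.+1 => (forall p : R * R, derivable (fun t => f (t, p.2)) p.1 1 /\
                               derivable (fun t => f (p.1, t)) p.2 1)
             /\ Ck k' (dx f) /\ Ck k' (dz f)
  end.

(* test functions C_c^oo(Omega): smooth, with support in a compact subset of
   Omega (equivalently in some closed sub-rectangle) *)
Definition test_fun (x0 x1 : R) (psi : R * R -> R) : Prop :=
  (forall k, Ck k psi) /\
  exists d : R, 0 < d /\ forall p : R * R,
    ~ (x0 + d <= p.1 <= x1 - d /\ -1 + d <= p.2 <= 1 - d) -> psi p = 0.

Local Open Scope ereal_scope.

Definition L2_on (D : set (R * R)) (f : R * R -> R) : Prop :=
  measurable_fun D f /\ \int[leb2]_(p in D) ((f p ^+ 2)%R)%:E < +oo.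

Definition L2norm (D : set (R * R)) (f : R * R -> R) : \bar R :=
  Lnorm leb2 2%:E (EFin \o (f \_ D)).

Definition weak_dz (x0 x1 : R) (phi g : R * R -> R) : Prop :=
  forall psi, test_fun x0 x1 psi ->
    \int[leb2]_(p in Omega x0 x1) (phi p * dz psi p)%:E =
    - \int[leb2]_(p in Omega x0 x1) (g p * psi p)%:E.

Definition weak_dzz (x0 x1 : R) (phi h : R * R -> R) : Prop :=
  forall psi, test_fun x0 x1 psi ->
    \int[leb2]_(p in Omega x0 x1) (phi p * dz (dz psi) p)%:E =
    \int[leb2]_(p in Omega x0 x1) (h p * psi p)%:E.

(* k = z * d_x phi in the sense of distributions:
   <z d_x phi, psi> = <d_x phi, z psi> = - <phi, z d_x psi> *)
Definition weak_z_dx (x0 x1 : R) (phi k : R * R -> R) : Prop :=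
  forall psi, test_fun x0 x1 psi ->
    \int[leb2]_(p in Omega x0 x1) (phi p * (p.2 * dx psi p))%:E =
    - \int[leb2]_(p in Omega x0 x1) (k p * psi p)%:E.

Definition inZ0 (x0 x1 : R) (phi g h k : R * R -> R) : Prop :=
  [/\ L2_on (Omega x0 x1) phi, L2_on (Omega x0 x1) g,
      L2_on (Omega x0 x1) h, L2_on (Omega x0 x1) k &
      [/\ weak_dz x0 x1 phi g, weak_dzz x0 x1 phi h & weak_z_dx x0 x1 phi k]].

Definition Z0norm (x0 x1 : R) (phi g h k : R * R -> R) : \bar R :=
  L2norm (Omega x0 x1) k + L2norm (Omega x0 x1) h +
  L2norm (Omega x0 x1) g + L2norm (Omega x0 x1) phi.

(* squared H^{1/2}(a,b) norm (Sobolev--Slobodeckij):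
   ||f||_{L^2}^2 + int int |f x - f y|^2 / |x - y|^2 dx dy *)
Definition H12norm2 (a b : R) (f : R -> R) : \bar R :=
  \int[leb]_(x in `]a, b[) ((f x ^+ 2)%R)%:E +
  \int[leb]_(x in `]a, b[) \int[leb]_(y in `]a, b[)
     (((f x - f y) ^+ 2) / ((x - y) ^+ 2))%:E.

Definition inH12 (a b : R) (f : R -> R) : Prop :=
  measurable_fun `]a, b[ f /\ H12norm2 a b f < +oo.

End Defs.

(* Main.v *)
(* Expand in the cosine basis [ecos n] of L^2(x0, x1).  The coefficients
   [u_n], [g_n], [h_n] of phi, d_z phi, d_zz phi satisfy [u_n' = g_n] and
   [g_n' = h_n], and the coefficient of z d_x phi against [esin n] is
   [- n freq z u_n], because the sine vanishes at both end points.  The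
   one-dimensional inequality
     n \int |z| g_n^2 <= C (n^2 \int z^2 u_n^2 + \int h_n^2)
   is summed over n with Bessel's inequality.  It holds because on a cell of
   length (n |z|)^(-1/2) the ordinary interpolation inequality between u_n and
   h_n scales correctly.  The resulting bound on \sum n |z| g_n^2 controls the
   Slobodeckij seminorm by Parseval's identity for the Poisson kernel, which
   dominates 1 / (x - y)^2 in the limit r -> 1. *)
Require Import Defs.
From HB Require Import structures.
From mathcomp Require Import all_boot all_order all_algebra.
From mathcomp Require Import all_classical all_reals all_analysis.
From mathcomp Require Import measurable_realfun.
From mathcomp Require Import zify ring lra.
Import Order.TTheory GRing.Theory Num.Theory.
Import numFieldNormedType.Exports.
Local Open Scope classical_set_scope.
Local Open Scope ring_scope.
Set Implicit Arguments.
Unset Strict Implicit.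
Unset Printing Implicit Defensive.

(** Nothing is known of phi at [x0] and [x1], and test functions vanish near these points, so
    coefficients are reached only through cutoffs in x. The derivative of a cutoff blows up like
    1/eps, and only the sine, which vanishes linearly at the end points, can absorb it. This is why
    phi is paired with cosines and z d_x phi with sines. In one dimension the obstacle is the weight
    z^2, which vanishes at 0. Cells of length (n |z|)^(-1/2) mean that |z|^(3/2) advances by steps
    of order n^(-1/2), hence nodes (j / N)^(2/3) with N close to the square root of n. Next to 0 the
    scale is n^(-1/3); there u_n is sampled only on the outer part of the cell, and h_n carries the
    bound inwards. The relations between u_n, g_n and h_n are weak, so the pointwise argument is run
    at Lebesgue points. Parseval's identity, that is, completeness of the cosines, comes from the
    same Poisson kernel by Korovkin's argument. The kernel is truncated and a constant is added to
    keep it nonnegative, so that every quadratic form is a finite sum. *)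

Lemma ler_norm_sqr (R : realDomainType) (a b : R) :
  (a ^+ 2 <= b ^+ 2) = (`|a| <= `|b|).
Proof. by rewrite -[a ^+ 2]real_normK ?num_real// -[b ^+ 2]real_normK ?num_real//
  ler_sqr ?nnegrE. Qed.

(** * Real-valued integrable and square-integrable functions *)

Section SquareIntegrable.
Context {d : measure_display} {T : measurableType d} {R : realType}.
Variable mu : {measure set T -> \bar R}.
Variable D : set T.
Hypothesis mD : measurable D.
Implicit Types f g e : T -> R.

(** [Rintegral] applies [fine], which reads an infinite integral as 0; this predicate guards the
    identities between real integrals. *)
Definition Rintegrable f := mu.-integrable D (EFin \o f).

Lemma RintegrableP f : measurable_fun D f ->
  (\int[mu]_(x in D) (`|f x|)%:E < +oo)%E -> Rintegrable f.
Proof.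
by move=> mf fi; apply/integrableP; split; [exact/measurable_EFinP|exact: fi].
Qed.

Lemma measurable_Rintegrable f : Rintegrable f -> measurable_fun D f.
Proof. by move=> /measurable_int/measurable_EFinP. Qed.

Lemma le_Rintegrable f g : measurable_fun D f -> Rintegrable g ->
  (forall x, D x -> `|f x| <= g x) -> Rintegrable f.
Proof.
move=> mf ig fg; apply: le_integrable ig => //; first exact/measurable_EFinP.
by move=> x Dx /=; rewrite lee_fin (le_trans (fg x Dx))// ler_norm.
Qed.

Lemma RintegrableMb (M : R) f e : Rintegrable f -> measurable_fun D e ->
  (forall x, D x -> `|e x| <= M) -> Rintegrable (fun x => f x * e x).
Proof.
move=> fi me eM; have fM : Rintegrable (fun x => M * `|f x|).
  exact: (integrableZl mD M (integrable_norm fi)).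
apply: le_Rintegrable fM _.
  by apply: measurable_funM => //; exact: measurable_Rintegrable.
by move=> x Dx; rewrite normrM mulrC ler_wpM2r// eM.
Qed.

Lemma Rintegral_indicM (A : set T) f : A `<=` D ->
  \int[mu]_(x in D) (f x * \1_A x) = \int[mu]_(x in A) f x.
Proof.
move=> AD; rewrite -[in RHS](setIidr AD) Rintegral_mkcondr.
apply: eq_Rintegral => x _; rewrite patchE indicE.
by case: (x \in A); rewrite ?mulr1 ?mulr0.
Qed.

(** Replacing [g] by the maximum of [f] and [g] changes it only on a null set and makes the
    inequality hold everywhere. *)
Lemma ae_le_Rintegral f g : Rintegrable f -> Rintegrable g ->
  {ae mu, forall x, D x -> f x <= g x} ->
  \int[mu]_(x in D) f x <= \int[mu]_(x in D) g x.
Proof.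
move=> fi gi fg; pose m x := Num.max (f x) (g x).
have mm : measurable_fun D m.
  by apply: measurable_maxr; exact: measurable_Rintegrable.
have im : Rintegrable m.
  have s : Rintegrable (fun x => `|f x| + `|g x|).
    by apply: (integrableD mD (integrable_norm fi) (integrable_norm gi)).
  apply: le_Rintegrable s _ => // x _; rewrite /m.
  by case: (leP (f x) (g x)) => _; rewrite ?lerDl ?lerDr.
have -> : \int[mu]_(x in D) g x = \int[mu]_(x in D) m x.
  congr fine; apply: ae_eq_integral => //.
  - exact: measurable_int gi.
  - exact/measurable_EFinP.
  - apply: filterS fg => x fg Dx /=; congr EFin.
    by rewrite /m; apply/esym/max_idPr; exact: fg.
apply: le_Rintegral => // x _; rewrite /m le_max lexx//.
Qed.

Lemma RintegrableD f g : Rintegrable f -> Rintegrable g ->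
  Rintegrable (fun x => f x + g x).
Proof. by move=> intf intg; exact: (integrableD mD intf intg). Qed.

Lemma RintegrableB f g : Rintegrable f -> Rintegrable g ->
  Rintegrable (fun x => f x - g x).
Proof. by move=> intf intg; exact: (integrableB mD intf intg). Qed.

Lemma RintegrableZ c f : Rintegrable f -> Rintegrable (fun x => c * f x).
Proof. by move=> intf; exact: (integrableZl mD c intf). Qed.

Lemma eq_Rintegrable f g : (forall x, D x -> f x = g x) -> Rintegrable f ->
  Rintegrable g.
Proof. by move=> fg; apply: eq_integrable => // x /set_mem/fg /= ->. Qed.

Lemma Rintegrable_sum (I : Type) (s : seq I) (F : I -> T -> R) :
  (forall i, Rintegrable (F i)) -> Rintegrable (fun x => \sum_(i <- s) F i x).
Proof.
move=> iF; elim: s => [|i s IH].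
  apply: (@eq_Rintegrable (cst 0)); first by move=> x _; rewrite big_nil.
  exact: integrable0.
apply: (@eq_Rintegrable (fun x => F i x + \sum_(j <- s) F j x)).
  by move=> x _; rewrite big_cons.
exact: RintegrableD.
Qed.

Lemma Rintegral_sum (I : Type) (s : seq I) (F : I -> T -> R) :
  (forall i, Rintegrable (F i)) ->
  \int[mu]_(x in D) (\sum_(i <- s) F i x) =
  \sum_(i <- s) \int[mu]_(x in D) F i x.
Proof.
move=> iF; elim: s => [|i s IH].
  rewrite big_nil (@eq_Rintegral _ _ _ mu D (cst 0)); last by move=> x _; rewrite big_nil.
  by rewrite Rintegral_cst// mul0r.
rewrite big_cons -IH -RintegralD//; [|exact: iF|exact: Rintegrable_sum].
by apply: eq_Rintegral => x _; rewrite big_cons.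
Qed.

Lemma Rintegrable_fineK f : Rintegrable f ->
  (\int[mu]_(x in D) (f x)%:E)%E = (\int[mu]_(x in D) f x)%:E.
Proof. by move=> intf; rewrite fineK// integrable_fin_num. Qed.

Definition L2 f := measurable_fun D f /\ Rintegrable (fun x => f x ^+ 2).

Lemma L2P f : measurable_fun D f ->
  (\int[mu]_(x in D) (f x ^+ 2)%:E < +oo)%E -> L2 f.
Proof.
move=> mf fi; split=> //; apply: RintegrableP; first exact: measurable_funX.
by under eq_integral do rewrite ger0_norm ?sqr_ge0//.
Qed.

Lemma L2_lty f : L2 f -> (\int[mu]_(x in D) (f x ^+ 2)%:E < +oo)%E.
Proof. by move=> [_ /integrable_lty]; exact. Qed.

Lemma L2_le f g : measurable_fun D f -> L2 g ->
  (forall x, D x -> `|f x| <= `|g x|) -> L2 f.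
Proof.
move=> mf [mg ig] fg; split=> //; apply: le_Rintegrable ig _.
  exact: measurable_funX.
by move=> x Dx; rewrite ger0_norm ?sqr_ge0// ler_norm_sqr fg.
Qed.

Lemma L2M f g : L2 f -> L2 g -> Rintegrable (fun x => f x * g x).
Proof.
move=> [mf if2] [mg ig2].
apply: (@le_Rintegrable _ (fun x => f x ^+ 2 + g x ^+ 2)).
- exact: measurable_funM.
- exact: RintegrableD.
by move=> x _; rewrite ler_norml; apply/andP; split; nra.
Qed.

Lemma L2Z c f : L2 f -> L2 (fun x => c * f x).
Proof.
move=> [mf if2]; split; first exact: measurable_funM.
apply: (@eq_Rintegrable (fun x => c ^+ 2 * f x ^+ 2)).
  by move=> x _; rewrite exprMn.
exact: RintegrableZ.
Qed.

Lemma L2D f g : L2 f -> L2 g -> L2 (fun x => f x + g x).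
Proof.
move=> [mf if2] [mg ig2]; split; first exact: measurable_funD.
apply: (@le_Rintegrable _ (fun x => 2 * (f x ^+ 2 + g x ^+ 2))).
- by apply: measurable_funX; exact: measurable_funD.
- exact/RintegrableZ/RintegrableD.
move=> x _; rewrite ger0_norm ?sqr_ge0// -subr_ge0.
by rewrite (_ : _ - _ = (f x - g x) ^+ 2) ?sqr_ge0//; ring.
Qed.

Lemma L2B f g : L2 f -> L2 g -> L2 (fun x => f x - g x).
Proof.
move=> lf lg; rewrite (_ : (fun x => _) = fun x => f x + -1 * g x).
  by apply: L2D => //; exact: L2Z.
by apply/funext => x; rewrite mulN1r.
Qed.

(* discriminant of [t |-> \int (t f + g)^2] *)
Lemma Cauchy_Schwarz f g : L2 f -> L2 g ->
  (\int[mu]_(x in D) (f x * g x)) ^+ 2 <=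
  (\int[mu]_(x in D) (f x ^+ 2)) * (\int[mu]_(x in D) (g x ^+ 2)).
Proof.
move=> lf lg; set B := \int[mu]_(x in D) _; set A := \int[mu]_(x in D) _.
set C := \int[mu]_(x in D) _.
have A0 : 0 <= A by apply: Rintegral_ge0 => x _; exact: sqr_ge0.
have quad t : 0 <= t ^+ 2 * A + (2 * t) * B + C.
  have if2 := lf.2; have ig2 := lg.2; have ifg := L2M lf lg.
  have i1 := RintegrableZ (t ^+ 2) if2; have i2 := RintegrableZ (2 * t) ifg.
  rewrite -(RintegralZl _ mD if2) -(RintegralZl _ mD ifg) -(RintegralD mD i1 i2).
  rewrite -(RintegralD mD (RintegrableD i1 i2) ig2).
  apply: Rintegral_ge0 => x _.
  by rewrite (_ : _ + _ = (t * f x + g x) ^+ 2) ?sqr_ge0//; ring.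
(* When [A = 0] the polynomial is affine; if its slope were nonzero it would take the value -1 at
   [- (C + 1) / (2 * B)]. *)
have [A00|AN0] := eqVneq A 0.
  have [->|BN0] := eqVneq B 0; first by rewrite expr0n /= A00 mul0r.
  have := quad (- (C + 1) / (2 * B)).
  rewrite A00 mulr0 add0r (_ : 2 * _ * B = - (C + 1)); last by field.
  lra.
have {}A0 : 0 < A by rewrite lt_neqAle eq_sym AN0.
have := quad (- B / A).
rewrite (_ : _ + _ = (A * C - B ^+ 2) / A); last by field.
by rewrite pmulr_lge0 ?invr_gt0// subr_ge0.
Qed.

Hypothesis finD : (mu D < +oo)%E.

Lemma L2_bounded (M : R) e : measurable_fun D e ->
  (forall x, D x -> `|e x| <= M) -> L2 e.
Proof.
move=> me eM; split=> //.
apply: (@le_Rintegrable _ (cst (M ^+ 2))); first exact: measurable_funX.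
  apply: measurable_bounded_integrable => //.
  exists `|M ^+ 2|; split=> [|y /ltW ? x _]; first exact: num_real.
  exact: le_trans.
move=> x Dx; rewrite ger0_norm ?sqr_ge0// ler_norm_sqr (le_trans (eM x Dx))//.
exact: ler_norm.
Qed.

Lemma L2_cst c : L2 (cst c).
Proof. exact: (@L2_bounded `|c|). Qed.

Lemma L2_Rintegrable f : L2 f -> Rintegrable f.
Proof.
move=> lf; apply: (@eq_Rintegrable (fun x => f x * cst 1 x)).
  by move=> x _; rewrite mulr1.
by apply: L2M => //; exact: L2_cst.
Qed.

Lemma Rintegrable_bounded (M : R) e : measurable_fun D e ->
  (forall x, D x -> `|e x| <= M) -> Rintegrable e.
Proof. by move=> me eM; apply: L2_Rintegrable; exact: L2_bounded eM. Qed.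

End SquareIntegrable.
#[global] Arguments Rintegrable {d T R} mu D f.
#[global] Arguments L2 {d T R} mu D f.

Section SquareIntegrableSubset.
Context {d : measure_display} {T : measurableType d} {R : realType}.
Variable mu : {measure set T -> \bar R}.
Variables (A B : set T).
Hypotheses (mA : measurable A) (mB : measurable B) (AB : A `<=` B).
Implicit Types f : T -> R.

Lemma RintegrableS f : Rintegrable mu B f -> Rintegrable mu A f.
Proof. exact: integrableS. Qed.

Lemma L2S f : L2 mu B f -> L2 mu A f.
Proof.
move=> [mf fi]; split; last exact: RintegrableS.
exact: measurable_funS mf.
Qed.

Lemma subset_Rintegral f : (forall x, B x -> 0 <= f x) -> Rintegrable mu B f ->
  \int[mu]_(x in A) f x <= \int[mu]_(x in B) f x.
Proof.
move=> f0 fi; rewrite -lee_fin -!Rintegrable_fineK//; last exact: RintegrableS.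
apply: ge0_subset_integral => //.
exact: measurable_int fi.
Qed.

End SquareIntegrableSubset.

Section DominatedConvergence.
Context {d : measure_display} {T : measurableType d} {R : realType}.
Variable mu : {measure set T -> \bar R}.
Variable D : set T.
Hypothesis mD : measurable D.

Lemma dominated_cvg_Rintegral (f_ : nat -> T -> R) (f G : T -> R) :
  (forall n, measurable_fun D (f_ n)) -> Rintegrable mu D G ->
  (forall x, D x -> f_ n x @[n --> \oo] --> f x) ->
  (forall n x, D x -> `|f_ n x| <= G x) ->
  \int[mu]_(x in D) f_ n x @[n --> \oo] --> \int[mu]_(x in D) f x.
Proof.
move=> mf_ iG f_f f_G.
have mf : measurable_fun D f by exact: (measurable_fun_cvg mf_).
have f_Gi n : Rintegrable mu D (f_ n) by apply: le_Rintegrable iG _ => //; exact: f_G.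
have fi : Rintegrable mu D f.
  apply: le_Rintegrable iG _ => // x Dx.
  apply: (@closed_cvg _ _ \oo eventually_filter (fun n => `|f_ n x|) [set y | y <= G x]).
  - exact: closed_le.
  - by apply: nearW => n; exact: f_G.
  - by apply: cvg_norm; exact: f_f.
have [] := @dominated_convergence _ _ _ mu D mD (fun n => EFin \o f_ n)
  (EFin \o f) (EFin \o G) _ _ _ iG _.
- by move=> n; exact/measurable_EFinP.
- exact/measurable_EFinP.
- by apply: aeW => x Dx; apply: cvg_EFin; [exact: nearW|exact: f_f].
- by apply: aeW => x n Dx; rewrite lee_fin f_G.
move=> _ _; rewrite /= Rintegrable_fineK// => /fine_cvg.
by rewrite /Rintegral.
Qed.

End DominatedConvergence.

(** * Smooth functions of one variable: flat functions, ramps and plateaus *)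

Section SmoothOneVariable.
Variable R : realType.
Implicit Types (f g : R -> R) (x : R).

Fixpoint Ck1 (k : nat) f : Prop :=
  match k with
  | 0%N => continuous f
  | k'.+1 => (forall x, derivable f x 1) /\ Ck1 k' (derive1 f)
  end.

Definition smooth f := forall k, Ck1 k f.

Lemma derivable_continuous f : (forall x, derivable f x 1) -> continuous f.
Proof. by move=> df x; exact/differentiable_continuous/derivable1_diffP/df. Qed.

Lemma is_derive_Ck1 k f (df : R -> R) : (forall x, is_derive x 1 f (df x)) ->
  Ck1 k df -> Ck1 k.+1 f.
Proof.
move=> fdf dfk; split; first by move=> x; have [] := fdf x.
by rewrite (_ : derive1 f = df)//; apply/funext => x; rewrite derive1E derive_val.
Qed.

Lemma Ck1_is_derive k f : Ck1 k.+1 f -> forall x, is_derive x 1 f (derive1 f x).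
Proof. by move=> [df _] x; rewrite derive1E; exact/derivableP. Qed.

Lemma Ck1W k f : Ck1 k.+1 f -> Ck1 k f.
Proof.
elim: k f => [|k IH] f [df fk]; first exact: derivable_continuous.
by split=> //; exact: IH.
Qed.

Lemma Ck1D k f g : Ck1 k f -> Ck1 k g -> Ck1 k (fun x => f x + g x).
Proof.
elim: k f g => [|k IH] f g.
  by move=> cf cg x; apply: continuousD; [exact: cf|exact: cg].
move=> fk gk; apply: (@is_derive_Ck1 _ _ (fun x => derive1 f x + derive1 g x)).
  move=> x; have ? := Ck1_is_derive fk x; have ? := Ck1_is_derive gk x.
  exact: is_deriveD.
by apply: IH; [case: fk|case: gk].
Qed.

Lemma Ck1M k f g : Ck1 k f -> Ck1 k g -> Ck1 k (fun x => f x * g x).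
Proof.
elim: k f g => [|k IH] f g.
  by move=> cf cg x; apply: continuousM; [exact: cf|exact: cg].
move=> fk gk.
apply: (@is_derive_Ck1 _ _ (fun x => f x * derive1 g x + g x * derive1 f x)).
  move=> x; have ? := Ck1_is_derive fk x; have ? := Ck1_is_derive gk x.
  exact: is_deriveM.
by apply: Ck1D; apply: IH; [exact: Ck1W|case: gk|exact: Ck1W|case: fk].
Qed.

Lemma Ck1_cst k (c : R) : Ck1 k (cst c).
Proof.
elim: k c => [|k IH] c; first by move=> x; exact: cst_continuous.
by apply: (@is_derive_Ck1 _ _ (cst 0)).
Qed.

Lemma Ck1_affine k f (a b : R) : Ck1 k f -> Ck1 k (fun x => f (a * x + b)).
Proof.
have daff x : is_derive x 1 (fun x => a * x + b : R) a.
  rewrite -[X in is_derive _ _ _ X]addr0; apply: is_deriveD.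
  by rewrite -[X in is_derive _ _ _ X]mulr1; exact: is_deriveZ.
elim: k f => [|k IH] f.
  move=> cf x; apply: (@continuous_comp _ _ _ (fun x => a * x + b) f).
    apply: differentiable_continuous; apply/derivable1_diffP.
    by have [] := daff x.
  exact: cf.
move=> fk; apply: (@is_derive_Ck1 _ _ (fun x => derive1 f (a * x + b) * a)).
  move=> x; have ? := Ck1_is_derive fk (a * x + b).
  exact: (@is_derive1_comp _ f (fun x => a * x + b)).
by apply: Ck1M; [apply: IH; case: fk|exact: Ck1_cst].
Qed.

Lemma Ck1V k f : (forall x, f x != 0) -> Ck1 k f -> Ck1 k (fun x => (f x)^-1).
Proof.
move=> f0; elim: k => [|k IH].
  by move=> cf x; apply: continuousV => //; exact: cf.
move=> fk.
apply: (@is_derive_Ck1 _ _ (fun x => -1 * derive1 f x * ((f x)^-1 * (f x)^-1))).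
  move=> x; have := is_deriveV (f0 x) (Ck1_is_derive fk x).
  move=> /is_derive_eq; apply.
  by rewrite /GRing.scale /= mulN1r -exprVn expr2 mulNr mulrC mulrN.
have fk' := Ck1W fk.
do 2 (apply: Ck1M; last by [exact: IH|case: fk|apply: Ck1M; exact: IH]).
exact: Ck1_cst.
Qed.

Lemma smooth_deriv f : smooth f -> smooth (derive1 f).
Proof. by move=> sf k; have [] := sf k.+1. Qed.

Lemma smooth_derivable f x : smooth f -> derivable f x 1.
Proof. by move=> /(_ 1%N)[+ _]; exact. Qed.

Lemma smooth_is_derive f x : smooth f -> is_derive x 1 f (derive1 f x).
Proof. by move=> sf; exact: Ck1_is_derive (sf 1%N) x. Qed.

Lemma smooth_continuous f : smooth f -> continuous f.
Proof. by move=> /(_ 0%N). Qed.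

Lemma smoothD f g : smooth f -> smooth g -> smooth (fun x => f x + g x).
Proof. by move=> sf sg k; exact: Ck1D. Qed.

Lemma smoothM f g : smooth f -> smooth g -> smooth (fun x => f x * g x).
Proof. by move=> sf sg k; exact: Ck1M. Qed.

Lemma smoothZ f (c : R) : smooth f -> smooth (fun x => c * f x).
Proof. by move=> sf; apply: (@smoothM (cst c)) => // k; exact: Ck1_cst. Qed.

Lemma smoothB f g : smooth f -> smooth g -> smooth (fun x => f x - g x).
Proof.
move=> sf sg; rewrite (_ : (fun x => _) = (fun x => f x + -1 * g x)).
  by apply: smoothD => //; exact: smoothZ.
by apply/funext => x; rewrite mulN1r.
Qed.

Lemma smooth_affine f (a b : R) : smooth f -> smooth (fun x => f (a * x + b)).
Proof. by move=> sf k; exact: Ck1_affine. Qed.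

(** The induction on the order runs over the whole family at once. It serves for the span of [sin]
    and [cos] and for the functions [flat p]. *)
Lemma smooth_stable (S : (R -> R) -> Prop) :
  (forall f, S f -> exists2 df, S df & forall x, is_derive x 1 f (df x)) ->
  forall f, S f -> smooth f.
Proof.
move=> SS f Sf k; elim: k f Sf => [|k IH] f Sf.
  have [df _ dfP] := SS _ Sf.
  by apply: derivable_continuous => x; have [] := dfP x.
by have [df /IH ? dfP] := SS _ Sf; exact: is_derive_Ck1 dfP _.
Qed.

Lemma smooth_sin_cos : smooth (@sin R) /\ smooth (@cos R).
Proof.
pose S f := exists a b : R, f = (fun x => a * sin x + b * cos x).
have Ssm f : S f -> smooth f.
  apply: (@smooth_stable S) => {f} _ [a [b ->]].
  exists (fun x => - b * sin x + a * cos x); first by exists (- b), a.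
  move=> x.
  have := is_deriveD (@is_deriveZ _ _ _ _ a _ _ _ (is_derive_sin x))
                     (@is_deriveZ _ _ _ _ b _ _ _ (is_derive_cos x)).
  by move=> /is_derive_eq; apply; rewrite /GRing.scale /= mulrN mulNr addrC.
split; apply: Ssm.
  by exists 1, 0; apply/funext => x; rewrite mul1r mul0r addr0.
by exists 0, 1; apply/funext => x; rewrite mul1r mul0r add0r.
Qed.

(* the functions [p(1/t) exp(-1/t)] on [t > 0] extended by [0]; the family is
   stable under derivation *)
Definition flat (p : {poly R}) (t : R) : R :=
  if 0 < t then p.[t^-1] * expR (- t^-1) else 0.

Lemma expRN_pow_bound (n : nat) (s : R) : 0 <= s ->
  s ^+ n * expR (- s) <= n`!%:R.
Proof.
move=> s0; rewrite expRN ler_pdivrMr ?expR_gt0//.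
case: n => [|n].
  by rewrite expr0 fact0 mul1r (le_trans _ (expR_ge1Dx s))// lerDl.
rewrite mulrC -ler_pdivrMr ?ltr0n ?fact_gt0//.
by apply: le_trans (expR_ge1Dxn n s0); rewrite lerDr ler01.
Qed.

(** With s = 1/t, the bound s^(i+2) exp(-s) <= (i+2)! controls each monomial by t^2. A quadratic
    bound makes the difference quotient at 0 vanish in the limit for every [p]. *)
Lemma flat_quadratic p : exists2 C : R, 0 <= C &
  forall t, `|flat p t| <= C * t ^+ 2.
Proof.
exists (\sum_(i < size p) `|p`_i| * (i.+2)`!%:R).
  by apply: sumr_ge0 => i _; rewrite mulr_ge0.
move=> t; rewrite /flat; case: ifPn => t0; last first.
  rewrite normr0 mulr_ge0 ?sqr_ge0//.
  by apply: sumr_ge0 => i _; rewrite mulr_ge0.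
rewrite horner_coef mulr_suml mulr_suml.
apply: le_trans (ler_norm_sum _ _ _) _; apply: ler_sum => i _.
rewrite !normrM -!mulrA ler_wpM2l//.
rewrite -ler_pdivrMr ?exprn_gt0// ger0_norm ?exprn_ge0 ?invr_ge0 ?(ltW t0)//.
rewrite ger0_norm ?expR_ge0// -mulrA [_ / _]mulrC mulrA -exprVn -exprD addn2.
by apply: expRN_pow_bound; rewrite invr_ge0 ltW.
Qed.

Lemma is_derive_flat p (x : R) :
  is_derive x 1 (flat p) (flat ('X^2 * (p - p^`())) x).
Proof.
have [x0|x0|->] := ltgtP x 0.
- apply: (@near_eq_is_derive _ _ _ (cst 0)).
    near=> t; rewrite /flat ltNge ltW//=.
    by near: t; exact: lt_nbhsl.
  by rewrite /flat ltNge ltW//=; exact: is_derive_cst.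
- pose F (t : R) : R := p.[t^-1] * expR (- t^-1).
  apply: (@near_eq_is_derive _ _ _ F).
    near=> t; rewrite /flat ifT//.
    by near: t; exact: lt_nbhsr.
  have xN0 : x != 0 by rewrite gt_eqF.
  have dV : is_derive x 1 (fun t : R => t^-1) (- x ^- 2).
    have := @is_deriveV _ id x _ _ xN0 (is_derive_id x 1).
    by move=> /is_derive_eq; apply; rewrite /GRing.scale/= mulr1.
  have d1 := @is_derive1_comp _ (horner p) _ _ _ _ (is_derive_poly p x^-1) dV.
  have d2 := @is_derive1_comp _ expR _ _ _ _ (is_derive_expR _) (is_deriveN dV).
  have := is_deriveM d1 d2.
  move=> /is_derive_eq; apply; rewrite /flat x0 hornerM hornerXn hornerD hornerN.
  rewrite opprK -[(- _) x]/(- x^-1) /GRing.scale /=.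
  by rewrite exprVn; ring.
- rewrite {2}/flat ltxx; have [C C0 fC] := flat_quadratic p.
  have C10 : 0 < C + 1 by rewrite ltr_wpDl.
  have flat0 : flat p 0 = 0 by rewrite /flat ltxx.
  have cv : h^-1 *: ((flat p \o shift 0) (h *: 1) - flat p 0) @[h --> 0^'] -->
      (0 : R).
    rewrite flat0; apply/cvgr0Pnorm_le => e e0.
    near=> h; rewrite /= subr0 /GRing.scale/= mulr1 addr0 normrM normfV.
    have h0 : 0 < `|h| by rewrite normr_gt0; near: h; exact: nbhs_dnbhs_neq.
    rewrite mulrC ler_pdivrMr//; apply: le_trans (fC h) _.
    rewrite -real_normK ?num_real// expr2 mulrA ler_wpM2r//.
    apply: (@le_trans _ _ ((C + 1) * `|h|)); first by rewrite ler_wpM2r ?lerDl.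
    rewrite -ler_pdivlMl// mulrC.
    by near: h; apply: dnbhs0_le; rewrite divr_gt0.
  apply: DeriveDef; first by apply/cvg_ex; exists 0.
  exact: (cvg_lim _ cv).
Unshelve. all: by end_near. Qed.

Lemma smooth_flat p : smooth (flat p).
Proof.
apply: (@smooth_stable (fun f => exists p, f = flat p)); last by exists p.
move=> _ [q ->]; exists (flat ('X^2 * (q - deriv q))); first by eexists.
by move=> x; exact: is_derive_flat.
Qed.

(** The argument 1 - t is spelled [-1 * t + 1] so that [Ck1_affine] applies as is; [ramp] has its
    affine form for the same reason. *)
Definition smooth_step (t : R) : R :=
  flat 1 t / (flat 1 t + flat 1 (-1 * t + 1)).

Lemma flat1_ge0 t : 0 <= flat 1 t.
Proof.
by rewrite /flat; case: ifP => // _; rewrite hornerE mul1r expR_ge0.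
Qed.

Lemma flat1_gt0 t : 0 < t -> 0 < flat 1 t.
Proof. by move=> t0; rewrite /flat t0 hornerE mul1r expR_gt0. Qed.

Lemma flat_le0 p t : t <= 0 -> flat p t = 0.
Proof. by move=> t0; rewrite /flat ltNge t0. Qed.

Lemma smooth_step_denom_gt0 t : 0 < flat 1 t + flat 1 (-1 * t + 1).
Proof.
have [t0|t0] := ltP 0 t; first by rewrite ltr_pwDl ?flat1_gt0 ?flat1_ge0.
by rewrite ltr_wpDl ?flat1_ge0// flat1_gt0// mulN1r; lra.
Qed.

Lemma smooth_smooth_step : smooth smooth_step.
Proof.
move=> k; apply: Ck1M; first exact: smooth_flat.
apply: Ck1V => [x|]; first by rewrite gt_eqF// smooth_step_denom_gt0.
by apply: Ck1D; [exact: smooth_flat|apply: Ck1_affine; exact: smooth_flat].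
Qed.

Lemma smooth_step_le0 t : t <= 0 -> smooth_step t = 0.
Proof. by move=> t0; rewrite /smooth_step flat_le0// mul0r. Qed.

Lemma smooth_step_ge1 t : 1 <= t -> smooth_step t = 1.
Proof.
move=> t1; rewrite /smooth_step [X in _ + X]flat_le0 ?addr0; last by lra.
by rewrite divff// gt_eqF// flat1_gt0//; lra.
Qed.

Lemma smooth_step_itv t : 0 <= smooth_step t <= 1.
Proof.
have := smooth_step_denom_gt0 t; have := flat1_ge0 t.
have := flat1_ge0 (-1 * t + 1); rewrite /smooth_step => b a ab.
by rewrite divr_ge0 ?addr_ge0//= ler_pdivrMr// mul1r lerDl.
Qed.

Lemma derive1_eq0_near (f : R -> R) (c x : R) :
  (\forall t \near x, f t = c) -> derive1 f x = 0.
Proof.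
move=> fc; rewrite derive1E.
rewrite -(@near_eq_derive _ _ _ (cst c)) ?derive_val//.
by near=> t; apply/esym; near: t.
Unshelve. all: by end_near. Qed.

Lemma derive_smooth_step_out t : ~~ (0 <= t <= 1) -> derive1 smooth_step t = 0.
Proof.
rewrite negb_and -!ltNge => /orP[t0|t1].
  apply: (@derive1_eq0_near _ 0); near=> s; apply: smooth_step_le0.
  by apply: ltW; near: s; exact: lt_nbhsl.
apply: (@derive1_eq0_near _ 1); near=> s; apply: smooth_step_ge1.
by apply: ltW; near: s; exact: lt_nbhsr.
Unshelve. all: by end_near. Qed.

(** The derivative is continuous and vanishes outside [[0, 1]], so its maximum there is a global
    bound. *)
Lemma derive_smooth_step_bounded : exists2 M : R, 0 < M &
  forall t, `|derive1 smooth_step t| <= M.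
Proof.
have cd : {within `[0, 1], continuous (fun t => `|derive1 smooth_step t|)}.
  apply: continuous_subspaceT => x; apply: continuous_comp.
    exact/smooth_continuous/smooth_deriv/smooth_smooth_step.
  exact: norm_continuous.
have [c _ cmax] := @EVT_max R _ 0 1 ler01 cd.
exists (`|derive1 smooth_step c| + 1); first by rewrite ltr_wpDl.
move=> t; have [t01|t01] := boolP (0 <= t <= 1); last first.
  by rewrite derive_smooth_step_out// normr0 addr_ge0.
by rewrite (le_trans (cmax t _))// ?lerDl// in_itv.
Qed.

(* [ramp p e] rises from 0 to 1 on [p, p + e] *)
Definition ramp (p e t : R) : R := smooth_step (e^-1 * t + - (e^-1 * p)).

Lemma smooth_ramp p e : smooth (ramp p e).
Proof. exact/smooth_affine/smooth_smooth_step. Qed.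

Lemma ramp_itv p e t : 0 <= ramp p e t <= 1.
Proof. exact: smooth_step_itv. Qed.

Lemma ramp_le p e t : 0 < e -> t <= p -> ramp p e t = 0.
Proof.
move=> e0 tp; apply: smooth_step_le0.
by rewrite -mulrN -mulrDr pmulr_rle0 ?invr_gt0// subr_le0.
Qed.

Lemma ramp_ge p e t : 0 < e -> p + e <= t -> ramp p e t = 1.
Proof.
move=> e0 tp; apply: smooth_step_ge1.
by rewrite -mulrN -mulrDr mulrC ler_pdivlMr// mul1r lerBrDl.
Qed.

Lemma derive_rampE p e t :
  derive1 (ramp p e) t = e^-1 * derive1 smooth_step (e^-1 * t + - (e^-1 * p)).
Proof.
have daff : is_derive t 1 (fun x : R => e^-1 * x + - (e^-1 * p)) e^-1.
  rewrite -[X in is_derive _ _ _ X]addr0; apply: is_deriveD.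
  by rewrite -[X in is_derive _ _ _ X]mulr1; exact: is_deriveZ.
have d1 := smooth_is_derive (e^-1 * t + - (e^-1 * p)) smooth_smooth_step.
have := @is_derive1_comp _ smooth_step (fun x => e^-1 * x + - (e^-1 * p)) _ _ _
  d1 daff.
by move=> h; rewrite derive1E (@derive_val _ _ _ _ _ _ _ h) mulrC.
Qed.

Lemma derive_ramp_out p e t : 0 < e -> ~~ (p <= t <= p + e) ->
  derive1 (ramp p e) t = 0.
Proof.
move=> e0 tp; rewrite derive_rampE derive_smooth_step_out ?mulr0//.
apply: contra tp => /andP[]; rewrite -mulrN -mulrDr pmulr_rge0 ?invr_gt0//.
by rewrite subr_ge0 mulrC ler_pdivrMr// mul1r lerBlDl => -> ->.
Qed.

(** By scaling, one constant serves all positions and widths. The rate 1/e is matched by averaging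
    over intervals of length e in [derive_ramp_cvg], and by the smallness of the sine in
    [derive_cutoff_esin_bounded]. *)
Lemma derive_ramp_bounded : exists2 M : R, 0 < M &
  forall p e t, 0 < e -> `|derive1 (ramp p e) t| <= M / e.
Proof.
have [M M0 HM] := derive_smooth_step_bounded; exists M => // p e t e0.
rewrite derive_rampE normrM ger0_norm ?invr_ge0 ?(ltW e0)// mulrC.
by rewrite ler_wpM2r ?invr_ge0 ?(ltW e0).
Qed.

(** A difference of two ramps, rising on [p, p + e] and falling on [q, q + e], so that its
    derivative is an approximate evaluation at [p] minus one at [q]. *)
Definition plateau (p q e t : R) : R := ramp p e t - ramp q e t.

Lemma smooth_plateau p q e : smooth (plateau p q e).
Proof. by apply: smoothB; exact: smooth_ramp. Qed.

Lemma plateau_bounded p q e t : `|plateau p q e t| <= 1.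
Proof.
have := ramp_itv p e t; have := ramp_itv q e t; rewrite /plateau.
by move=> /andP[? ?] /andP[? ?]; rewrite ler_norml; lra.
Qed.

Lemma plateau_out p q e t : 0 < e -> p <= q -> ~~ (p <= t <= q + e) ->
  plateau p q e t = 0.
Proof.
move=> e0 pq; rewrite negb_and -!ltNge => /orP[tp|tq]; rewrite /plateau.
  by rewrite !ramp_le ?subrr//; lra.
by rewrite !ramp_ge ?subrr//; lra.
Qed.

Lemma plateau_in p q e t : 0 < e -> p + e <= t <= q -> plateau p q e t = 1.
Proof.
by move=> e0 /andP[pt tq]; rewrite /plateau ramp_ge// ramp_le// subr0.
Qed.

Lemma derive_plateauE p q e t :
  derive1 (plateau p q e) t = derive1 (ramp p e) t - derive1 (ramp q e) t.
Proof.
have := is_deriveB (smooth_is_derive t (smooth_ramp p e))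
  (smooth_is_derive t (smooth_ramp q e)).
by move=> h; rewrite derive1E (@derive_val _ _ _ _ _ _ _ h).
Qed.

End SmoothOneVariable.

(** * Products of one-variable functions as test functions on the rectangle *)

Section TensorTest.
Variable R : realType.
Implicit Types a b : R -> R.

Lemma derive1Zr a (c t : R) : derivable a t 1 ->
  derive1 (fun s => a s * c) t = derive1 a t * c.
Proof.
move=> da; rewrite derive1E -[RHS]mulrC.
have /derivableP da' := da.
have := @is_deriveZ _ _ _ _ c _ _ _ da'; rewrite (_ : c \*: a = fun s => a s * c).
  by move=> h; rewrite (@derive_val _ _ _ _ _ _ _ h) derive1E.
by apply/funext => s; rewrite /= /GRing.scale/= mulrC.
Qed.

Lemma dx_tensor a b : smooth a -> dx (fun p : R * R => a p.1 * b p.2) =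
  (fun p : R * R => derive1 a p.1 * b p.2).
Proof.
move=> sa; apply/funext => p; rewrite /dx/=; apply: derive1Zr.
exact: smooth_derivable.
Qed.

Lemma dz_tensor a b : smooth b -> dz (fun p : R * R => a p.1 * b p.2) =
  (fun p : R * R => a p.1 * derive1 b p.2).
Proof.
move=> sb; apply/funext => p; rewrite /dz/=.
under eq_fun do rewrite mulrC.
by rewrite derive1Zr 1?mulrC//; exact: smooth_derivable.
Qed.

Lemma derivableZr a (c t : R) : derivable a t 1 ->
  derivable (fun s => a s * c) t 1.
Proof.
move=> da; rewrite (_ : (fun s => _) = c \*: a); first exact: derivableZ.
by apply/funext => s; rewrite /= /GRing.scale/= mulrC.
Qed.

Lemma Ck_tensor k a b : smooth a -> smooth b ->
  Ck k (fun p : R * R => a p.1 * b p.2).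
Proof.
elim: k a b => [|k IH] a b sa sb.
all: have cab : continuous (fun p : R * R => a p.1 * b p.2).
1,3: move=> p; apply: (@continuousM _ _ (a \o fst) (b \o snd));
  [apply: continuous_comp; [exact: cvg_fst|exact: smooth_continuous]
  |apply: continuous_comp; [exact: cvg_snd|exact: smooth_continuous]].
  by [].
split=> //; split; last first.
  rewrite dx_tensor// dz_tensor//.
  by split; apply: IH => //; exact: smooth_deriv.
move=> p /=; split; first by apply: derivableZr; exact: smooth_derivable.
under eq_fun do rewrite mulrC.
by apply: derivableZr; exact: smooth_derivable.
Qed.

Lemma test_fun_tensor (x0 x1 d : R) a b : 0 < d -> smooth a -> smooth b ->
  (forall x, ~~ (x0 + d <= x <= x1 - d) -> a x = 0) ->
  (forall z, ~~ (-1 + d <= z <= 1 - d) -> b z = 0) ->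
  test_fun x0 x1 (fun p : R * R => a p.1 * b p.2).
Proof.
move=> d0 sa sb aout bout; split; first by move=> k; exact: Ck_tensor.
exists d; split=> // p /=.
have [px|px] := boolP (x0 + d <= p.1 <= x1 - d); last by rewrite aout ?mul0r.
have [pz|pz] := boolP (-1 + d <= p.2 <= 1 - d); last by rewrite bout ?mulr0.
by move=> /not_andP[].
Qed.

End TensorTest.

(** * Weak derivatives on (-1, 1) and their increments between Lebesgue points *)

Section WeakDerivativeOneVariable.
Variable R : realType.
Notation mu := (@lebesgue_measure R).
Notation I := (`]-1, 1[%classic : set R).
Implicit Types (f g b : R -> R) (p q e : R).

Definition test1 b := smooth b /\
  exists2 d : R, 0 < d & forall z, ~~ (-1 + d <= z <= 1 - d) -> b z = 0.

Definition weak_deriv f g := forall b, test1 b ->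
  \int[mu]_(z in I) (f z * derive1 b z) = - \int[mu]_(z in I) (g z * b z).

Lemma mu_itv_lty (a b : R) (ba bb : bool) :
  (mu [set` Interval (BSide ba a) (BSide bb b)] < +oo)%E.
Proof.
by rewrite lebesgue_measure_itv /=; case: ifP => // _; rewrite -EFinB ltry.
Qed.

Lemma measurable_fun_continuous (D : set R) f : continuous f ->
  measurable_fun D f.
Proof. by move=> /continuous_measurable_fun; exact: measurable_funTS. Qed.

Lemma measurable_fun_smooth (D : set R) f : smooth f -> measurable_fun D f.
Proof. by move=> /smooth_continuous; exact: measurable_fun_continuous. Qed.

Lemma Rintegral_derive1 f (a b : R) : a < b -> smooth f ->
  \int[mu]_(z in `]a, b[) derive1 f z = f b - f a.
Proof.
move=> ab sf; have sf' := smooth_deriv sf.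
rewrite /Rintegral -(@integral_itv_bndoo _ _ _ _ true false); last first.
  by apply/measurable_EFinP; exact: measurable_fun_smooth.
rewrite (@continuous_FTC2 _ _ f)//.
- exact/continuous_subspaceT/smooth_continuous.
- have cf := smooth_continuous sf; split.
  + by move=> x _; exact: smooth_derivable.
  + by apply: cvg_at_right_filter; exact: cf.
  + by apply: cvg_at_left_filter; exact: cf.
Qed.

Lemma near_inv_lt (d : R) : 0 < d -> \forall n \near \oo, n.+1%:R^-1 < d.
Proof.
move=> d0; have /cvgrPdist_lt/(_ _ d0) := @cvg_harmonic R.
apply: filterS => n; rewrite sub0r normrN /= ger0_norm ?invr_ge0//.
Qed.

(** The derivative of [ramp p e] has integral 1, lives in [p, p + e] and is at most [M / e]. The
    error is therefore at most [4 * M] times the mean of |f - f p| over the ball of radius 2 e,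
    which tends to 0 at a Lebesgue point. *)
Lemma derive_ramp_cvg f p : Rintegrable mu I f -> I p ->
  lebesgue_pt (f \_ I) p ->
  \int[mu]_(z in I) (f z * derive1 (ramp p n.+1%:R^-1) z) @[n --> \oo] --> f p.
Proof.
move=> fi Ip lp; have mf := measurable_Rintegrable fi.
have [M M0 rM] := derive_ramp_bounded R.
have Ip' := Ip; rewrite /= in_itv /= in Ip'; have /andP[p1 p2] := Ip'.
have h0 n : 0 < n.+1%:R^-1 :> R by rewrite invr_gt0.
apply/cvgrPdist_le => eps eps0.
pose F := f \_ I.
have e40 : 0 < eps / (4 * M) by rewrite divr_gt0// mulr_gt0.
have [del/= del0 Hdel] :
    \forall r \near 0^'+, (davg F p r < (eps / (4 * M))%:E)%E.
  have e0E : (0%:E < (eps / (4 * M))%:E)%E by rewrite lte_fin.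
  exact: (lp _ (open_ereal_lt' e0E)).
have p10 : 0 < (1 - p) / 2 by lra.
have p20 : 0 < (p + 1) / 2 by lra.
have del20 : 0 < del / 2 by lra.
near=> n.
have edel : n.+1%:R^-1 < del / 2 by near: n; exact: near_inv_lt.
have ep : n.+1%:R^-1 < (1 - p) / 2 by near: n; exact: near_inv_lt.
have ep' : n.+1%:R^-1 < (p + 1) / 2 by near: n; exact: near_inv_lt.
set e : R := n.+1%:R^-1 in edel ep ep' *.
(* The radius is twice [e] because the open ball has to contain the closed support [p, p + e]. *)
have [e0 BI] : 0 < e /\ ball p (e *+ 2) `<=` I.
  split; first exact: h0.
  by move=> z; rewrite ball_itv/= !in_itv/= => /andP[? ?]; lra.
have ie : Rintegrable mu I (derive1 (ramp p e)).
  apply: (@Rintegrable_bounded _ _ _ _ _ _ _ (M / e)) => //.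
  - exact: mu_itv_lty.
  - by apply: measurable_fun_smooth; apply: smooth_deriv; exact: smooth_ramp.
  - by move=> z _; exact: rM.
have mr : measurable_fun I (derive1 (ramp p e)).
  exact: measurable_Rintegrable ie.
have ife : Rintegrable mu I (fun z => f z * derive1 (ramp p e) z).
  by apply: (@RintegrableMb _ _ _ _ _ _ (M / e)) => // z _; exact: rM.
have -> : f p = \int[mu]_(z in I) (f p * derive1 (ramp p e) z).
  rewrite RintegralZl// Rintegral_derive1//; last exact: smooth_ramp.
  rewrite ramp_ge//; last by lra.
  by rewrite ramp_le ?subr0 ?mulr1//; lra.
rewrite -RintegralB//; last exact: RintegrableZ.
apply: le_trans (le_normr_Rintegral _ _) _ => //.
  by apply: RintegrableB => //; exact: RintegrableZ.
pose B : set R := ball p (e *+ 2).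
have mB : measurable B by exact: measurable_ball.
have Fp : F p = f p by rewrite /F patchE mem_set.
have FB z : B z -> F z = f z by move=> Bz; rewrite /F patchE mem_set//; exact: BI.
rewrite -lee_fin -Rintegrable_fineK//; last first.
  by apply: integrable_norm; apply: RintegrableB => //; exact: RintegrableZ.
have mFB : measurable_fun B (fun z => `|(F z - F p)%:E|%E).
  apply: measurableT_comp => //; apply/measurable_EFinP.
  apply: measurable_funB => //.
  apply: (@eq_measurable_fun _ _ _ _ _ f); first by move=> z /set_mem/FB.
  exact: measurable_funS mf.
apply: (@le_trans _ _ (\int[mu]_(z in B) ((M / e)%:E * `|(F z - F p)%:E|)))%E.
  rewrite [leRHS]integral_mkcond [leLHS]integral_mkcond.
  apply: ge0_le_integral => //=.
  - by move=> z _; rewrite patchE; case: ifP.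
  - apply/(measurable_restrictT _ _).1 => //; apply/measurable_EFinP.
    apply: measurableT_comp => //; apply: measurable_funB; exact: measurable_funM.
  - apply/(measurable_restrictT _ _).1 => //.
    exact: measurable_funeM.
  - move=> z _; rewrite !patchE.
    have [zB|zB] := boolP (z \in B).
      move/set_mem : zB => zB.
      rewrite (mem_set (BI _ zB)) FB// Fp /= lee_fin -mulrBl normrM mulrC distrC.
      by rewrite ler_wpM2r// rM.
    case: ifPn => // zI; rewrite derive_ramp_out ?mulr0 ?subrr ?normr0//.
    apply: contra zB => /andP[? ?]; apply/mem_set.
    by rewrite /B ball_itv/= in_itv/=; apply/andP; split; lra.
have Me0 : (0 <= (M / e)%:E)%E by rewrite lee_fin divr_ge0// ltW.
rewrite ge0_integralZl//.
have e20 : 0 < e *+ 2 by lra.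
have /= := Hdel (e *+ 2) _ e20; rewrite /ball_ /= sub0r normrN gtr0_norm//.
move=> H; move: (H ltac:(lra)); rewrite /davg /iavg lebesgue_measure_ball ?(ltW e20)// => Hd.
have e40' : 0 < e *+ 2 *+ 2 by lra.
have {Hd} : (\int[mu]_(y in B) `|((center (F p) \o F) y)%:E| <=
    (e *+ 2 *+ 2 * (eps / (4 * M)))%:E)%E.
  move: (integral _ _ _) Hd => J; rewrite inver gt_eqF// => Hd.
  by rewrite EFinM -lee_pdivrMl// ltW.
move=> Hd; apply: le_trans (lee_wpmul2l _ Hd) _.
  exact: Me0.
rewrite -EFinM lee_fin (_ : M / e * _ = eps)//.
by rewrite -mulrnA -[_ *+ (2 * 2)]mulr_natr; field; rewrite !gt_eqF.
Unshelve. all: by end_near. Qed.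

Lemma test1_derive_ramp p e : 0 < e -> -1 < p -> p + e < 1 ->
  test1 (derive1 (ramp p e)).
Proof.
move=> e0 p1 pe; split; first by apply: smooth_deriv; exact: smooth_ramp.
exists (Num.min (p + 1) (1 - (p + e))); first by rewrite lt_min; lra.
move=> z zd; apply: derive_ramp_out => //; apply: contra zd => /andP[pz zp].
have [? ?] : Num.min (p + 1) (1 - (p + e)) <= p + 1 /\
    Num.min (p + 1) (1 - (p + e)) <= 1 - (p + e) by rewrite !ge_min !lexx orbT.
by apply/andP; split; lra.
Qed.

Lemma test1_plateau p q e : 0 < e -> p <= q -> -1 < p -> q + e < 1 ->
  test1 (plateau p q e).
Proof.
move=> e0 pq p1 pe; split; first exact: smooth_plateau.
exists (Num.min (p + 1) (1 - (q + e))); first by rewrite lt_min; lra.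
move=> z zd; apply: plateau_out => //; apply: contra zd => /andP[pz zp].
have [? ?] : Num.min (p + 1) (1 - (q + e)) <= p + 1 /\
    Num.min (p + 1) (1 - (q + e)) <= 1 - (q + e) by rewrite !ge_min !lexx orbT.
by apply/andP; split; lra.
Qed.

Lemma ae_mono (P Q : R -> Prop) : (forall z, P z -> Q z) ->
  {ae mu, forall z, P z} -> {ae mu, forall z, Q z}.
Proof. exact: (@filterS _ _ (ae_filter_ringOfSetsType mu)). Qed.

(** At these points the value of the given representative is the limit of its local averages, so
    pointwise statements about weakly differentiable functions need no choice of a continuous
    representative. *)
Definition good f p := I p /\ lebesgue_pt (f \_ I) p.

Lemma ae_good f : Rintegrable mu I f -> {ae mu, forall z, I z -> good f z}.
Proof.
move=> fi; have := lebesgue_differentiation (integrable_locally _ fi).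
by move=> /(_ (measurable_itv _)); apply: ae_mono => z lz Iz.
Qed.

(** Fundamental lemma of the calculus of variations: the derivatives of narrow ramps at [p] are test
    functions that converge to evaluation at [p]. *)
Lemma weak_zero f p : Rintegrable mu I f -> good f p ->
  (forall b, test1 b -> \int[mu]_(z in I) (f z * b z) = 0) -> f p = 0.
Proof.
move=> fi [Ip lp] f0; have fcvg := derive_ramp_cvg fi Ip lp.
have Ip' := Ip; rewrite /= in_itv /= in Ip'; have /andP[p1 p2] := Ip'.
have p10 : 0 < 1 - p by lra.
apply: (cvg_unique _ fcvg) => //; apply: cvg_near_cst.
near=> n; apply: f0; apply: test1_derive_ramp => //.
by rewrite -ltrBrDl; near: n; exact: near_inv_lt.
Unshelve. all: by end_near. Qed.

(** The limit interval is half-open because a plateau is still 0 at [p], whereas at [q] it has not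
    begun to fall. *)
Lemma plateau_cvg p q z : p < q ->
  plateau p q n.+1%:R^-1 z @[n --> \oo] --> (\1_(`]p, q]%classic : set R) z : R).
Proof.
move=> pq; apply: cvg_near_cst.
have h0 n : 0 < n.+1%:R^-1 :> R by rewrite invr_gt0.
have [zp|pz] := leP z p.
  near=> n; rewrite indicE memNset/= ?in_itv/= ?ltNge ?zp//.
  by rewrite /plateau !ramp_le ?subrr// (le_trans zp)// ltW.
have [zq|qz] := leP z q.
  have zp0 : 0 < z - p by lra.
  near=> n; rewrite indicE mem_set/= ?in_itv/= ?pz//.
  rewrite plateau_in// zq andbT -lerBrDl ltW//; near: n; exact: near_inv_lt.
have zq0 : 0 < z - q by lra.
near=> n; rewrite indicE memNset/= ?in_itv/= ?pz ?leNgt ?qz//.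
have e1 : n.+1%:R^-1 < z - q by near: n; exact: near_inv_lt.
move: (n.+1%:R^-1 : R) (h0 n) e1 => e e0 e1.
by rewrite /plateau !ramp_ge ?subrr//; lra.
Unshelve. all: by end_near. Qed.

(** Test with plateaus between [p] and [q]. As the width shrinks, their derivatives tend to
    evaluation at [p] minus evaluation at [q], and the plateaus tend boundedly to an indicator
    function. *)
Lemma weak_deriv_increment f g p q : Rintegrable mu I f -> Rintegrable mu I g ->
  weak_deriv f g -> good f p -> good f q -> p < q ->
  f q - f p = \int[mu]_(z in `]p, q[) g z.
Proof.
move=> fi gi fg [Ip lp] [Iq lq] pq.
have Ip' := Ip; rewrite /= in_itv /= in Ip'; have /andP[p1 p2] := Ip'.
have Iq' := Iq; rewrite /= in_itv /= in Iq'; have /andP[q1 q2] := Iq'.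
have cp := derive_ramp_cvg fi Ip lp; have cq := derive_ramp_cvg fi Iq lq.
have mg := measurable_Rintegrable gi.
have cg : \int[mu]_(z in I) (g z * plateau p q n.+1%:R^-1 z) @[n --> \oo] -->
    \int[mu]_(z in I) (g z * \1_(`]p, q]%classic : set R) z).
  apply: (@dominated_cvg_Rintegral _ _ _ mu I _ _ _ (fun z => `|g z|)) => //.
  - move=> n; apply: measurable_funM => //.
    by apply: measurable_fun_smooth; exact: smooth_plateau.
  - exact: integrable_norm.
  - by move=> z _; apply: cvgM; [exact: cvg_cst|exact: plateau_cvg].
  - by move=> n z _; rewrite normrM ler_piMr// plateau_bounded.
have -> : \int[mu]_(z in `]p, q[) g z =
    \int[mu]_(z in I) (g z * \1_(`]p, q]%classic : set R) z).
  rewrite Rintegral_indicM//; last first.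
    by move=> z /=; rewrite !in_itv/= => /andP[? ?]; lra.
  apply: Rintegral_itv_bndo_bndc; apply: RintegrableS gi => //.
  by move=> z /=; rewrite !in_itv/= => /andP[? ?]; lra.
pose w n := \int[mu]_(z in I) (f z * derive1 (ramp q n.+1%:R^-1) z) -
  \int[mu]_(z in I) (f z * derive1 (ramp p n.+1%:R^-1) z).
have cw : w n @[n --> \oo] --> f q - f p by exact: cvgB.
rewrite -(cvg_lim (@Rhausdorff R) cw); apply: (cvg_lim (@Rhausdorff R)).
apply: cvg_trans cg; apply: near_eq_cvg.
have q10 : 0 < 1 - q by lra.
near=> n.
have e1 : n.+1%:R^-1 < 1 - q by near: n; exact: near_inv_lt.
have h0 : 0 < n.+1%:R^-1 :> R by rewrite invr_gt0.
rewrite /w; move: (n.+1%:R^-1 : R) e1 h0 => e e1 e0.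
have [M M0 rM] := derive_ramp_bounded R.
have ir c : Rintegrable mu I (fun z => f z * derive1 (ramp c e) z).
  apply: (@RintegrableMb _ _ _ _ _ _ (M / e)) => //.
    by apply: measurable_fun_smooth; apply: smooth_deriv; exact: smooth_ramp.
  by move=> z _; exact: rM.
have /fg : test1 (plateau p q e) by apply: test1_plateau => //; lra.
move=> H; rewrite -[LHS]opprK -H -opprB.
rewrite -(RintegralB _ (ir p) (ir q))//.
by congr -%R; apply: eq_Rintegral => z _; rewrite derive_plateauE mulrBr.
Unshelve. all: by end_near. Qed.

End WeakDerivativeOneVariable.

(** * Interpolation of g between u and h on one cell *)

Section DegenerateInterpolation.
Variable R : realType.
Notation mu := (@lebesgue_measure R).
Notation I := (`]-1, 1[%classic : set R).
Implicit Types (a b c d p q z : R).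

Lemma Rintegral_itv_split (f : R -> R) a b c : a < b -> b < c ->
  Rintegrable mu `]a, c[ f ->
  \int[mu]_(z in `]a, c[) f z =
  \int[mu]_(z in `]a, b[) f z + \int[mu]_(z in `]b, c[) f z.
Proof.
move=> ab bc fi.
have fi' : Rintegrable mu `]a, b[ f.
  by apply: RintegrableS fi => // z /=; rewrite !in_itv/= => /andP[? ?]; lra.
rewrite (Rintegral_itv_bndo_bndc fi').
by rewrite -(Rintegral_itvB fi (x := b)) ?bnd_simp ?ltW//; lra.
Qed.

Lemma Rintegral_itv_cst (a b k : R) : a <= b ->
  \int[mu]_(z in `]a, b[) k = k * (b - a).
Proof.
move=> ab; rewrite Rintegral_cst//= lebesgue_measure_itv/= lte_fin.
by case: ltgtP ab => // -> _; rewrite subrr.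
Qed.

Lemma Rintegrable_itv_cst (a b k : R) : Rintegrable mu `]a, b[ (cst k).
Proof.
apply: (@Rintegrable_bounded _ _ _ _ _ _ _ `|k|) => //; exact: mu_itv_lty.
Qed.

Lemma ae_lower_Rintegral (f : R -> R) a b k : a <= b ->
  Rintegrable mu `]a, b[ f ->
  {ae mu, forall z, `]a, b[%classic z -> k <= f z} ->
  k * (b - a) <= \int[mu]_(z in `]a, b[) f z.
Proof.
move=> ab fi kf; rewrite -(Rintegral_itv_cst k ab).
by apply: ae_le_Rintegral => //; exact: Rintegrable_itv_cst.
Qed.

Variables u g h : R -> R.
Hypotheses (Lu : L2 mu I u) (Lg : L2 mu I g) (Lh : L2 mu I h).
Hypotheses (ug : weak_deriv u g) (gh : weak_deriv g h).

Let L2_int (f : R -> R) (lf : L2 mu I f) : Rintegrable mu I f.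
Proof. by apply: L2_Rintegrable lf => //; exact: mu_itv_lty. Qed.

Let sub_I a b : -1 <= a -> b <= 1 -> `]a, b[ `<=` I.
Proof. by move=> a1 b1 z /=; rewrite !in_itv/= => /andP[? ?]; lra. Qed.

Lemma increment_le c d y z : -1 <= c -> d <= 1 -> c < y < d -> c < z < d ->
  good g y -> good g z -> `|g y - g z| <= \int[mu]_(t in `]c, d[) `|h t|.
Proof.
move=> c1 d1; wlog yz : y z / y < z => [hw ycd zcd gy gz|].
  have [yz|zy|->] := ltgtP y z; first exact: hw.
    by rewrite distrC; exact: hw.
  by rewrite subrr normr0 Rintegral_ge0.
move=> /andP[cy yd] /andP[cz zd] gy gz; rewrite distrC.
rewrite (weak_deriv_increment (L2_int Lg) (L2_int Lh) gh gy gz yz).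
have hi : Rintegrable mu `]c, d[ h by apply: RintegrableS (L2_int Lh) => //; exact: sub_I.
have yzcd : `]y, z[ `<=` `]c, d[.
  by move=> t /=; rewrite !in_itv/= => /andP[? ?]; lra.
apply: le_trans (le_normr_Rintegral _ _) _ => //; first exact: RintegrableS hi.
by apply: subset_Rintegral => //; exact: integrable_norm.
Qed.

(** The mean of [g] over []s, r[] is the slope of [u] between these points, and [g z] differs from
    it by at most the integral of |h|. Taking [s] and [r] in the outer thirds keeps [r - s] at least
    a third of [b - a]. The point [z] may lie outside []a, b[], as the cell at the origin
    requires. *)
Lemma secant_bound a b c d z r s : -1 <= c -> c <= a -> a < b -> b <= d ->
  d <= 1 -> c < z < d -> good g z -> good u s -> good u r ->
  a < s < a + (b - a) / 3 -> b - (b - a) / 3 < r < b ->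
  (b - a) / 3 * `|g z| <=
    `|u r| + `|u s| + (b - a) * \int[mu]_(t in `]c, d[) `|h t|.
Proof.
move=> c1 ca ab bd d1 zcd gz us ur /andP[as1 as2] /andP[br1 br2].
have sr : s < r by lra.
set H := \int[mu]_(t in _) _.
have H0 : 0 <= H by apply: Rintegral_ge0.
have srI : `]s, r[ `<=` I by apply: sub_I; lra.
have gi : Rintegrable mu `]s, r[ g by apply: RintegrableS (L2_int Lg).
have ic := Rintegrable_itv_cst s r (g z).
have igz : Rintegrable mu `]s, r[ (fun y => g z - g y).
  exact: (RintegrableB _ ic gi).
have E : (r - s) * g z = (u r - u s) + \int[mu]_(y in `]s, r[) (g z - g y).
  rewrite (weak_deriv_increment (L2_int Lu) (L2_int Lg) ug us ur sr).
  rewrite (RintegralB _ ic gi)// Rintegral_itv_cst ?ltW//; ring.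
have err : `|\int[mu]_(y in `]s, r[) (g z - g y)| <= H * (r - s).
  apply: le_trans (le_normr_Rintegral _ _) _ => //.
  rewrite -(Rintegral_itv_cst H (ltW sr)); apply: ae_le_Rintegral => //.
  - exact: integrable_norm.
  - exact: Rintegrable_itv_cst.
  apply: ae_mono (ae_good (L2_int Lg)).
  move=> y gy ysr; have gy' := gy (srI _ ysr).
  apply: (increment_le c1 d1 zcd _ gz gy').
  by move: ysr => /=; rewrite in_itv/= => /andP[? ?]; apply/andP; split; lra.
have : (r - s) * `|g z| <= `|u r| + `|u s| + H * (r - s).
  have rs0 : 0 < r - s by rewrite subr_gt0.
  rewrite -{1}(gtr0_norm rs0) -normrM E.
  by apply: le_trans (ler_normD _ _) _; rewrite lerD// ler_normB.
have rs1 : (b - a) / 3 <= r - s by lra.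
have rs2 : r - s <= b - a by lra.
have := ler_wpM2l H0 rs2; have := ler_wpM2r (normr_ge0 (g z)) rs1; lra.
Qed.

(** Square [secant_bound] by (x + y + w)^2 <= 3 (x^2 + y^2 + w^2), which gives the factor 27 = 9 *
    3. Then average over [s] and over [r] in the outer thirds. Each average costs 3 / (b - a) times
    the integral of u^2, whence 162 = 27 * 6. Cauchy-Schwarz handles the integral of |h|. *)
Lemma pointwise_bound a b c d z : -1 <= c -> c <= a -> a < b -> b <= d ->
  d <= 1 -> c < z < d -> good g z ->
  g z ^+ 2 <= 162 / (b - a) ^+ 3 * \int[mu]_(t in `]a, b[) (u t ^+ 2) +
    27 * (d - c) * \int[mu]_(t in `]c, d[) (h t ^+ 2).
Proof.
move=> c1 ca ab bd d1 zcd gz.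
set U := \int[mu]_(t in _) _; set H2 := \int[mu]_(t in _) (h t ^+ 2).
pose H := \int[mu]_(t in `]c, d[) `|h t|; pose l := b - a.
have l0 : 0 < l by rewrite subr_gt0.
have lE : l = b - a by [].
have cd : c < d by lra.
have lh : L2 mu `]c, d[ h by apply: L2S Lh => //; apply: sub_I; lra.
have HH2 : H ^+ 2 <= (d - c) * H2.
  have lc : L2 mu `]c, d[ (cst 1) by apply: L2_cst => //; exact: mu_itv_lty.
  have lnh : L2 mu `]c, d[ (fun t => `|h t|).
    apply: (L2_le _ _ lh) => //; last by move=> t _; rewrite normr_id.
    by apply: measurableT_comp => //; case: lh.
  have := @Cauchy_Schwarz _ _ _ mu `]c, d[ ltac:(by []) _ _ lc lnh.
  have -> : \int[mu]_(t in `]c, d[) (cst 1 t * `|h t|) = H.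
    by apply: eq_Rintegral => t _; rewrite mul1r.
  have -> : \int[mu]_(t in `]c, d[) ((cst 1 t : R) ^+ 2) = d - c.
    rewrite -[RHS]mul1r -(Rintegral_itv_cst 1 (ltW cd)).
    by apply: eq_Rintegral => t _; rewrite expr1n.
  have -> // : \int[mu]_(t in `]c, d[) (`|h t| ^+ 2) = H2.
  by apply: eq_Rintegral => t _; rewrite real_normK ?num_real.
have lu : L2 mu I u by [].
have key r s : good u s -> good u r ->
    a < s < a + l / 3 -> b - l / 3 < r < b ->
    l ^+ 2 / 27 * g z ^+ 2 - l ^+ 2 * H ^+ 2 - u r ^+ 2 <= u s ^+ 2.
  move=> us ur sab rab; have := secant_bound c1 ca ab bd d1 zcd gz us ur sab rab.
  rewrite -/H -/l -[g z ^+ 2]real_normK ?num_real// -[u r ^+ 2]real_normK ?num_real//.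
  rewrite -[u s ^+ 2]real_normK ?num_real//.
  have H0 : 0 <= H by apply: Rintegral_ge0.
  move: `|g z| `|u r| `|u s| (normr_ge0 (g z)) (normr_ge0 (u r)) (normr_ge0 (u s)).
  move=> G X Y G0 X0 Y0 GXY.
  have : (l / 3 * G) ^+ 2 <= (X + Y + l * H) ^+ 2.
    rewrite ler_sqr ?nnegrE//; first by rewrite mulr_ge0// divr_ge0// ltW.
    by rewrite !addr_ge0// mulr_ge0// ltW.
  have := sqr_ge0 (X - Y); have := sqr_ge0 (X - l * H); have := sqr_ge0 (Y - l * H).
  nra.
have ui2 (p q : R) : a <= p -> q <= b -> Rintegrable mu `]p, q[ (fun t => u t ^+ 2).
  move=> ap qb; have [_] := lu; apply: RintegrableS => //; apply: sub_I; lra.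
have subU (p q : R) : a <= p -> q <= b -> \int[mu]_(t in `]p, q[) (u t ^+ 2) <= U.
  move=> ap qb; apply: subset_Rintegral => //; last exact: ui2.
    by move=> t /=; rewrite !in_itv/= => /andP[? ?]; lra.
  by move=> t _; exact: sqr_ge0.
have aeu := ae_good (L2_int Lu).
have step1 r : good u r -> b - l / 3 < r < b ->
    (l ^+ 2 / 27 * g z ^+ 2 - l ^+ 2 * H ^+ 2) - 3 / l * U <= u r ^+ 2.
  move=> ur rab.
  have : (l ^+ 2 / 27 * g z ^+ 2 - l ^+ 2 * H ^+ 2 - u r ^+ 2) * (a + l / 3 - a) <= U.
    apply: le_trans (subU a (a + l / 3) _ _); [|exact: lexx|lra].
    apply: ae_lower_Rintegral; [lra|apply: ui2; lra|].
    apply: ae_mono aeu.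
    move=> s us sab; have Is : I s.
      by move: sab => /=; rewrite !in_itv/= => /andP[? ?]; lra.
    by apply: (key r s (us Is) ur _ rab); move: sab; rewrite /= in_itv.
  rewrite (_ : a + l / 3 - a = l / 3); last by ring.
  rewrite -ler_pdivlMr ?divr_gt0//.
  rewrite (_ : U / (l / 3) = 3 / l * U); last by field; rewrite gt_eqF.
  lra.
have : (l ^+ 2 / 27 * g z ^+ 2 - l ^+ 2 * H ^+ 2 - 3 / l * U) * (b - (b - l / 3)) <= U.
  apply: le_trans (subU (b - l / 3) b _ _); [|lra|exact: lexx].
  apply: ae_lower_Rintegral; [lra|apply: ui2; lra|].
  apply: ae_mono aeu.
  move=> r ur rab; have Ir : I r.
    by move: rab => /=; rewrite !in_itv/= => /andP[? ?]; lra.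
  by apply: (step1 r (ur Ir)); move: rab; rewrite /= in_itv.
rewrite (_ : b - (b - l / 3) = l / 3); last by ring.
rewrite -ler_pdivlMr ?divr_gt0//.
rewrite (_ : U / (l / 3) = 3 / l * U); last by field; rewrite gt_eqF.
move=> S.
have : l ^+ 2 / 27 * g z ^+ 2 <= l ^+ 2 * ((d - c) * H2) + 6 / l * U.
  have := ler_wpM2l (sqr_ge0 l) HH2.
  rewrite (_ : 6 / l * U = 2 * (3 / l * U)); last by field; rewrite gt_eqF.
  lra.
have l20 : 0 < l ^+ 2 / 27 by rewrite divr_gt0 ?exprn_gt0.
rewrite -ler_pdivlMl// => /le_trans; apply; rewrite le_eqVlt; apply/orP; left.
by rewrite -lE; apply/eqP; field; rewrite gt_eqF.
Qed.

End DegenerateInterpolation.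

(** * The degenerate interpolation inequality, by summation over cells *)

Section DegenerateInterpolationCells.
Variable R : realType.
Notation mu := (@lebesgue_measure R).
Notation I := (`]-1, 1[%classic : set R).
Implicit Types (a b c d p q z : R).

Variables u g h : R -> R.
Hypotheses (Lu : L2 mu I u) (Lg : L2 mu I g) (Lh : L2 mu I h).
Hypotheses (ug : weak_deriv u g) (gh : weak_deriv g h).

Lemma Rintegrable_norm_sqr : Rintegrable mu I (fun z => `|z| * g z ^+ 2).
Proof.
apply: (@eq_Rintegrable _ _ _ mu _ _ (fun z => g z ^+ 2 * `|z|)).
- by [].
- by move=> z _; rewrite mulrC.
apply: (@RintegrableMb _ _ _ mu _ _ 1) => //; first by case: Lg.
by move=> z /=; rewrite in_itv/= normr_id ler_norml => /andP[? ?]; lra.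
Qed.

Lemma Rintegrable_sqr_sqr : Rintegrable mu I (fun z => z ^+ 2 * u z ^+ 2).
Proof.
apply: (@eq_Rintegrable _ _ _ mu _ _ (fun z => u z ^+ 2 * z ^+ 2)).
- by [].
- by move=> z _; rewrite mulrC.
apply: (@RintegrableMb _ _ _ mu _ _ 1) => //; first by case: Lu.
move=> z /=; rewrite in_itv/= => /andP[? ?]; rewrite normrX exprn_ile1//.
by rewrite ler_norml; lra.
Qed.

(** Integrating [pointwise_bound] over the cell []c, d[] leaves two numerical conditions, one for
    each term on the right. Since [u] is sampled only on []a, b[], where |z| >= al, its unweighted
    norm is controlled by the weighted one even if the cell touches 0. *)
Lemma cell_bound (n m al C : R) a b c d : -1 <= c -> c <= a -> a < b ->
  b <= d -> d <= 1 -> 0 < al -> 0 <= n -> 0 <= C ->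
  (forall z, c < z < d -> `|z| <= m) -> (forall z, a < z < b -> al <= `|z|) ->
  n * m * (d - c) * (162 / (b - a) ^+ 3) <= C * n ^+ 2 * al ^+ 2 ->
  n * m * (d - c) * (27 * (d - c)) <= C ->
  n * \int[mu]_(z in `]c, d[) (`|z| * g z ^+ 2) <=
  C * (n ^+ 2 * \int[mu]_(z in `]c, d[) (z ^+ 2 * u z ^+ 2) +
       \int[mu]_(z in `]c, d[) (h z ^+ 2)).
Proof.
move=> c1 ca ab bd d1 al0 n0 C0 zm zal C1 C2.
have cd : c < d by lra.
have cdI : `]c, d[ `<=` I.
  by move=> z /=; rewrite !in_itv/= => /andP[? ?]; lra.
have abcd : `]a, b[ `<=` `]c, d[.
  by move=> z /=; rewrite !in_itv/= => /andP[? ?]; lra.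
have gi : Rintegrable mu I g.
  by apply: L2_Rintegrable Lg => //; exact: mu_itv_lty.
have lg : L2 mu `]c, d[ g by apply: L2S Lg.
have lu : L2 mu `]c, d[ u by apply: L2S Lu.
pose U := \int[mu]_(z in `]a, b[) (u z ^+ 2).
pose V := \int[mu]_(z in `]c, d[) (z ^+ 2 * u z ^+ 2).
pose H2 := \int[mu]_(z in `]c, d[) (h z ^+ 2).
have H20 : 0 <= H2 by apply: Rintegral_ge0 => z _; exact: sqr_ge0.
have U0 : 0 <= U by apply: Rintegral_ge0 => z _; exact: sqr_ge0.
have igz : Rintegrable mu `]c, d[ (fun z => `|z| * g z ^+ 2).
  exact: RintegrableS Rintegrable_norm_sqr.
have iuz : Rintegrable mu `]c, d[ (fun z => z ^+ 2 * u z ^+ 2).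
  exact: RintegrableS Rintegrable_sqr_sqr.
have UV : al ^+ 2 * U <= V.
  have iu : Rintegrable mu `]a, b[ (fun z => u z ^+ 2).
    by case: lu => _; apply: RintegrableS.
  apply: (@le_trans _ _ (\int[mu]_(z in `]a, b[) (z ^+ 2 * u z ^+ 2))); last first.
    apply: subset_Rintegral => // z _; exact: mulr_ge0 (sqr_ge0 _) (sqr_ge0 _).
  rewrite -RintegralZl//; apply: le_Rintegral => //.
  - exact: RintegrableZ.
  - exact: RintegrableS iuz.
  move=> z /=; rewrite in_itv/= => zab; rewrite ler_wpM2r ?sqr_ge0//.
  by rewrite ler_norm_sqr ger0_norm ?(ltW al0)// zal.
pose Bd := 162 / (b - a) ^+ 3 * U + 27 * (d - c) * H2.
have m0 : 0 <= m.
  by apply: le_trans (normr_ge0 ((c + d) / 2)) (zm _ _); apply/andP; split; lra.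
have gB : \int[mu]_(z in `]c, d[) (`|z| * g z ^+ 2) <= m * Bd * (d - c).
  rewrite -(Rintegral_itv_cst (m * Bd) (ltW cd)); apply: ae_le_Rintegral => //.
    exact: Rintegrable_itv_cst.
  apply: ae_mono (ae_good gi) => z gz zcd.
  have zcd' : c < z < d by move: zcd; rewrite /= in_itv.
  apply: ler_pM => //; [exact: sqr_ge0|exact: zm|].
  exact: (pointwise_bound Lu Lg Lh ug gh c1 ca ab bd d1 zcd' (gz (cdI _ zcd))).
apply: le_trans (ler_wpM2l n0 gB) _.
rewrite -/V -/H2 /Bd.
rewrite (_ : n * _ = n * m * (d - c) * (162 / (b - a) ^+ 3) * U +
  n * m * (d - c) * (27 * (d - c)) * H2); last by ring.
rewrite [leRHS]mulrDr lerD//; last exact: ler_wpM2r.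
apply: le_trans (ler_wpM2r U0 C1) _.
by rewrite -[C * _ * _ * _]mulrA -mulrA; do 2 rewrite ler_wpM2l ?sqr_ge0//.
Qed.

(** The boolean selects the side of 0, so that one induction over cells serves both halves of the
    interval. *)
Definition half_itv (s : bool) a b : set R :=
  if s then `]a, b[%classic else `]-b, -a[%classic.

Lemma half_cell_bound s (n C : R) c a b : 0 <= c -> c <= a -> 0 < a -> a < b ->
  b <= 1 -> 0 <= n -> 0 <= C ->
  n * b * (b - c) * (162 / (b - a) ^+ 3) <= C * n ^+ 2 * a ^+ 2 ->
  n * b * (b - c) * (27 * (b - c)) <= C ->
  n * \int[mu]_(z in half_itv s c b) (`|z| * g z ^+ 2) <=
  C * (n ^+ 2 * \int[mu]_(z in half_itv s c b) (z ^+ 2 * u z ^+ 2) +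
       \int[mu]_(z in half_itv s c b) (h z ^+ 2)).
Proof.
move=> c0 ca a0 ab b1 n0 C0 C1 C2; case: s => /=.
  apply: (@cell_bound _ b a C a b c b) => //; try lra.
    by move=> z /andP[? ?]; rewrite ger0_norm; lra.
  by move=> z /andP[? ?]; rewrite ger0_norm; lra.
apply: (@cell_bound _ b a C (- b) (- a) (- b) (- c)) => //; try lra.
- by move=> z /andP[? ?]; rewrite ler_norml; lra.
- by move=> z /andP[? ?]; rewrite ltr0_norm; lra.
by rewrite !opprK [- c + b]addrC [- a + b]addrC.
Qed.

Lemma half_itv_split s (f : R -> R) a b c : a < b -> b < c ->
  Rintegrable mu (half_itv s a c) f ->
  \int[mu]_(z in half_itv s a c) f z =
  \int[mu]_(z in half_itv s a b) f z + \int[mu]_(z in half_itv s b c) f z.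
Proof.
move=> ab bc; case: s => /= fi; first exact: Rintegral_itv_split.
by rewrite (@Rintegral_itv_split _ _ (- c) (- b) (- a)) ?ltrN2// addrC.
Qed.

(* [A = A_j], [B = A_(j+1)] with [A_j^3 = j / N]: the nodes [A_j^2] are spaced by
   about [(n A_j^2)^(-1/2)], the natural length scale of the problem *)
Lemma node_spacing (N n A B : R) : 0 < N -> 0 < n -> n <= N ^+ 2 ->
  N ^+ 2 <= 4 * n -> 0 < A -> A < B -> 1 <= N * A ^+ 3 ->
  N * B ^+ 3 = N * A ^+ 3 + 1 ->
  [/\ B ^+ 2 <= 2 * A ^+ 2, n * (A ^+ 2 * (B ^+ 2 - A ^+ 2) ^+ 2) <= 1 &
     1 <= 49 * n * (A ^+ 2 * (B ^+ 2 - A ^+ 2) ^+ 2)].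
Proof.
move=> N0 n0 nN Nn A0 AB NA NB.
have B0 : 0 < B by lra.
have BA3 : B ^+ 3 <= 2 * A ^+ 3 by rewrite -(ler_pM2l N0); lra.
have BA2 : B ^+ 2 <= 2 * A ^+ 2.
  have B20 := sqr_ge0 B.
  have A20 : 0 <= 2 * A ^+ 2 by apply: mulr_ge0 => //; exact: sqr_ge0.
  rewrite -(@ler_pXn2r _ 3) ?nnegrE//.
  rewrite [(2 * _) ^+ 3]exprMn [B ^+ 2 ^+ 3]exprAC [A ^+ 2 ^+ 3]exprAC.
  apply: (@le_trans _ _ ((2 * A ^+ 3) ^+ 2)).
    rewrite ler_sqr ?nnegrE//; first exact: exprn_ge0 (ltW B0).
    by apply: mulr_ge0 => //; exact: exprn_ge0 (ltW A0).
  by rewrite exprMn ler_wpM2r ?sqr_ge0// -!natrX ler_nat.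
pose X := A * (B ^+ 2 - A ^+ 2).
have XE : A ^+ 2 * (B ^+ 2 - A ^+ 2) ^+ 2 = X ^+ 2 by rewrite /X exprMn.
have S0 : 0 < A ^+ 2 + A * B + B ^+ 2.
  by rewrite !addr_gt0 ?mulr_gt0 ?exprn_gt0.
have NBA : N * (B - A) * (A ^+ 2 + A * B + B ^+ 2) = 1.
  by rewrite -[RHS](addrK (N * A ^+ 3)) [1 + _]addrC -NB; ring.
have NBA0 : 0 < N * (B - A) by rewrite mulr_gt0// subr_gt0.
have NX1 : N * X <= 1.
  rewrite -NBA /X (_ : N * _ = N * (B - A) * (A ^+ 2 + A * B)); last by ring.
  by rewrite ler_pM2l// lerDl sqr_ge0.
(* From B^2 <= 2 A^2 follows 2 (A^2 + A B + B^2) <= 7 (A^2 + A B). Squaring the 7 gives the 49, and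
   the square of the 2 cancels the 4 in N^2 <= 4 n. *)
have NX2 : 2 <= 7 * (N * X).
  have : 2 * (A ^+ 2 + A * B + B ^+ 2) <= 7 * (A ^+ 2 + A * B).
    by have := mulr_gt0 A0 B0; have := exprn_gt0 2 A0; lra.
  move=> /(ler_wpM2l (ltW NBA0)).
  rewrite (_ : N * X = N * (B - A) * (A ^+ 2 + A * B)); last by rewrite /X; ring.
  by rewrite mulrCA NBA mulr1 [leRHS]mulrCA.
have X0 : 0 <= X by rewrite /X mulr_ge0 ?subr_ge0 ?ler_sqr ?nnegrE ?ltW.
split=> //; rewrite XE.
  apply: (@le_trans _ _ (N ^+ 2 * X ^+ 2)); first by rewrite ler_wpM2r ?sqr_ge0.
  by rewrite -exprMn; exact: exprn_ile1 (mulr_ge0 (ltW N0) X0) NX1.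
have : (2 : R) ^+ 2 <= (7 * (N * X)) ^+ 2.
  by apply: lerXn2r => //; rewrite nnegrE; lra.
rewrite (_ : (7 * _) ^+ 2 = 49 * (N ^+ 2 * X ^+ 2)); last by ring.
by have := ler_wpM2r (sqr_ge0 X) Nn; lra.
Qed.

(** A round value above 162 * 4 * 343 = 222264, which the cell at the origin requires; all other
    conditions ask for less. *)
Definition deg_cst : R := 500 ^+ 2.

Lemma deg_cst_ge0 : 0 <= deg_cst.
Proof. exact: sqr_ge0. Qed.

Lemma cell_numerics_step (n a b : R) : 0 < n -> 0 < a -> a < b -> b <= 2 * a ->
  n * (a * (b - a) ^+ 2) <= 1 -> 1 <= 49 * n * (a * (b - a) ^+ 2) ->
  n * b * (b - a) * (162 / (b - a) ^+ 3) <= deg_cst * n ^+ 2 * a ^+ 2 /\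
  n * b * (b - a) * (27 * (b - a)) <= deg_cst.
Proof.
move=> n0 a0 ab ba u1 l1; have l0 : 0 < b - a by lra.
have DE : deg_cst = 500 * 500 by rewrite /deg_cst expr2.
split.
  rewrite (_ : _ * (162 / _) = 162 * (n * b) / (b - a) ^+ 2); last first.
    by field; rewrite gt_eqF.
  rewrite ler_pdivrMr ?exprn_gt0// DE.
  have na0 : 0 <= 324 * (n * a) by have := mulr_gt0 n0 a0; lra.
  have h1 := ler_wpM2l na0 l1.
  have h2 := ler_wpM2l (ltW n0) ba.
  have h3 := mulr_ge0 (mulr_ge0 (sqr_ge0 n) (sqr_ge0 a)) (sqr_ge0 (b - a)).
  nra.
rewrite (_ : _ * (27 * _) = 27 * (n * (b - a) ^+ 2 * b)); last by ring.
have h3 : 0 <= n * (b - a) ^+ 2 by rewrite mulr_ge0 ?sqr_ge0 ?ltW.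
have := ler_wpM2l h3 ba; rewrite DE; nra.
Qed.

(** The cell at the origin is []0, b[], of length of order at most n^(-1/3), with [u] sampled on
    []a, b[]. Combining n a^3 <= 1 with the lower bound on [b - a] gives a <= 7 (b - a), so the
    sampled part is a fixed fraction of the cell. *)
Lemma cell_numerics_first (n a b : R) : 0 < n -> 0 < a -> a < b -> b <= 2 * a ->
  n * a ^+ 3 <= 1 -> 1 <= 49 * n * (a * (b - a) ^+ 2) ->
  n * b * (b - 0) * (162 / (b - a) ^+ 3) <= deg_cst * n ^+ 2 * a ^+ 2 /\
  n * b * (b - 0) * (27 * (b - 0)) <= deg_cst.
Proof.
move=> n0 a0 ab ba na3 l1; have l0 : 0 < b - a by lra.
have DE : deg_cst = 500 * 500 by rewrite /deg_cst expr2.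
have b0 : 0 < b by lra.
have b2 : b ^+ 2 <= 4 * a ^+ 2.
  rewrite (_ : 4 * _ = (2 * a) ^+ 2); last by rewrite exprMn -natrX.
  by rewrite ler_sqr ?nnegrE ?mulr_ge0 ?(ltW a0) ?(ltW b0).
rewrite subr0; split.
  rewrite (_ : _ * (162 / _) = 162 * (n * b ^+ 2) / (b - a) ^+ 3); last first.
    by field; rewrite gt_eqF.
  rewrite ler_pdivrMr ?exprn_gt0// DE.
  have al : a <= 7 * (b - a).
    rewrite -ler_sqr ?nnegrE ?mulr_ge0 ?(ltW a0) ?(ltW l0)// exprMn.
    rewrite -(ler_pM2l (mulr_gt0 n0 a0)); lra.
  have na2 : 0 <= n * a ^+ 2 by rewrite mulr_ge0 ?sqr_ge0 ?ltW.
  have k1 : n * a * a <= 49 * n * (a * (b - a) ^+ 2) * (n * a * (7 * (b - a))).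
    rewrite -[leLHS]mul1r; apply: ler_pM => //.
    - by rewrite !mulr_ge0 ?(ltW n0) ?(ltW a0).
    - by rewrite ler_wpM2l// mulr_ge0 ?(ltW n0) ?(ltW a0).
  have k2 := ler_wpM2l (ltW n0) b2.
  rewrite (_ : 500 * 500 * _ * _ * _ = 500 * 500 / 343 *
    (49 * n * (a * (b - a) ^+ 2) * (n * a * (7 * (b - a))))); last by field.
  lra.
rewrite (_ : _ * (27 * _) = 27 * (n * b ^+ 2 * b)); last by ring.
have h3 : 0 <= n * b ^+ 2 by rewrite mulr_ge0 ?sqr_ge0 ?ltW.
have h4 := ler_wpM2l h3 ba.
have h5 : 0 <= n * a by rewrite mulr_ge0 ?ltW.
have h6 := ler_wpM2l h5 b2; rewrite DE; nra.
Qed.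

(** Take the least admissible [N]: if it exceeds 2, then [N - 1] fails and (N - 1)^2 < n gives the
    upper bound. At least 2 is required because the first cell extends to the second node. *)
Lemma near_sqrt_nat (n : nat) : (0 < n)%N ->
  exists N : nat, [/\ (1 < N)%N, (n <= N ^ 2)%N & (N ^ 2 <= 4 * n)%N].
Proof.
move=> n0; pose P N := (1 < N)%N && (n <= N ^ 2)%N.
have exP : exists N, P N.
  by exists n.+1; rewrite /P ltnS n0/= -mulnn; nia.
exists (ex_minn exP); case: ex_minnP => N /andP[N1 nN] minN; split=> //.
have [->|N2] := eqVneq N 2; first by nia.
have N12 : (1 < N.-1)%N by lia.
have : ~~ P N.-1 by apply/negP => /minN; lia.
by rewrite /P N12/= -ltnNge -!mulnn; nia.
Qed.

Lemma degenerate_half s (n : nat) : (0 < n)%N ->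
  n%:R * \int[mu]_(z in half_itv s 0 1) (`|z| * g z ^+ 2) <=
  deg_cst * (n%:R ^+ 2 * \int[mu]_(z in half_itv s 0 1) (z ^+ 2 * u z ^+ 2) +
       \int[mu]_(z in half_itv s 0 1) (h z ^+ 2)).
Proof.
move=> n0; have [N [N1 nN Nn]] := near_sqrt_nat n0.
have N0 : 0 < N%:R :> R by rewrite ltr0n; lia.
have nR0 : 0 < n%:R :> R by rewrite ltr0n.
have nNR : n%:R <= N%:R ^+ 2 :> R by rewrite -natrX ler_nat.
have NnR : N%:R ^+ 2 <= 4 * n%:R :> R by rewrite -natrX -natrM ler_nat.
(* Cube roots are stored so that the nodes are the squares [A j ^+ 2] and both powers, z and
   z^(3/2), are polynomial in [A j]. *)
pose A (j : nat) : R := (j%:R / N%:R) `^ 3^-1.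
have A0 j : (0 < j)%N -> 0 < A j.
  by move=> j0; rewrite powR_gt0// divr_gt0// ltr0n.
have A3 j : A j ^+ 3 = j%:R / N%:R.
  by rewrite -powR_mulrn ?powR_ge0// -powRrM mulVf ?pnatr_eq0// powRr1.
have Alt i j : (i < j)%N -> A i < A j.
  move=> ij; rewrite -(@ltr_pXn2r _ 3) ?nnegrE ?powR_ge0//.
  by rewrite !A3 ltr_pM2r ?invr_gt0// ltr_nat.
have AN : A N = 1 by rewrite /A divff ?gt_eqF// powR1.
have Ale1 j : (j <= N)%N -> A j ^+ 2 <= 1.
  rewrite leq_eqVlt => /predU1P[->|/Alt]; first by rewrite AN expr1n.
  by rewrite AN => /ltW Aj; rewrite exprn_ile1// powR_ge0.
have A2lt i j : (i < j)%N -> A i ^+ 2 < A j ^+ 2.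
  by move=> ij; rewrite ltr_pXn2r ?nnegrE ?powR_ge0// Alt.
have NA j : N%:R * A j ^+ 3 = j%:R by rewrite A3 mulrC divfK// gt_eqF.
have spacing j : (0 < j)%N -> [/\ A j.+1 ^+ 2 <= 2 * A j ^+ 2,
     n%:R * (A j ^+ 2 * (A j.+1 ^+ 2 - A j ^+ 2) ^+ 2) <= 1 &
     1 <= 49 * n%:R * (A j ^+ 2 * (A j.+1 ^+ 2 - A j ^+ 2) ^+ 2)].
  move=> j0; apply: (@node_spacing N%:R) => //; first exact: A0.
  - exact: Alt.
  - by rewrite NA ler1n.
  - by rewrite !NA natr1.
have mh a b : measurable (half_itv s a b : set (measurableTypeR R)).
  by rewrite /half_itv; case: (s).
have hI a b : 0 <= a -> b <= 1 -> half_itv s a b `<=` I.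
  move=> a0 b1 z; rewrite /half_itv.
  by case: (s) => /=; rewrite !in_itv/= => /andP[? ?]; lra.
(* Induction over the cells, starting at [M = 2]: the first cell runs from 0 to the second node,
   with [u] sampled between the first and the second. *)
suff H M : (1 < M)%N -> (M <= N)%N ->
  n%:R * \int[mu]_(z in half_itv s 0 (A M ^+ 2)) (`|z| * g z ^+ 2) <=
  deg_cst * (n%:R ^+ 2 * \int[mu]_(z in half_itv s 0 (A M ^+ 2)) (z ^+ 2 * u z ^+ 2) +
       \int[mu]_(z in half_itv s 0 (A M ^+ 2)) (h z ^+ 2)).
  by have := H N N1 (leqnn _); rewrite AN expr1n.
elim: M => // M IH; rewrite ltnS leq_eqVlt => /predU1P[<- _|M1 MN].
  have [B2 u1 l1] := spacing 1%N isT.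
  have := NA 1%N; have := NA 2%N; have := A2lt 1%N 2%N isT.
  have := A0 1%N isT; have := A0 2%N isT; move: B2 u1 l1.
  have A2le1 := Ale1 2%N N1; move: A2le1.
  move: (A 1%N) (A 2%N) => a b b1 B2 u1 l1 b0 a0 ab Nb Na.
  have a20 : 0 < a ^+ 2 by rewrite exprn_gt0.
  have na3 : n%:R * (a ^+ 2) ^+ 3 <= 1.
    apply: (@le_trans _ _ ((N%:R * a ^+ 3) ^+ 2)); last by rewrite Na expr1n.
    by rewrite exprAC [(N%:R * _) ^+ 2]exprMn ler_wpM2r ?sqr_ge0.
  have [C1 C2] := cell_numerics_first nR0 a20 ab B2 na3 l1.
  apply: (@half_cell_bound s n%:R deg_cst 0 (a ^+ 2)) => //; try exact: ltW.
  exact: deg_cst_ge0.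
have [B2 u1 l1] := spacing M (ltnW M1).
have aM0 := A0 M (ltnW M1); have A2M := A2lt M M.+1 (ltnSn M).
have iS (f : R -> R) : Rintegrable mu I f ->
    Rintegrable mu (half_itv s 0 (A M.+1 ^+ 2)) f.
  by apply: RintegrableS => //; apply: hI => //; exact: Ale1.
have a20 : 0 < A M ^+ 2 by rewrite exprn_gt0.
rewrite !(half_itv_split a20 A2M); first last.
- exact/iS/Rintegrable_norm_sqr.
- exact/iS/Rintegrable_sqr_sqr.
- by apply: iS; case: Lh.
have {}IH := IH M1 (ltnW MN).
have : n%:R * \int[mu]_(z in half_itv s (A M ^+ 2) (A M.+1 ^+ 2)) (`|z| * g z ^+ 2) <=
  deg_cst * (n%:R ^+ 2 * \int[mu]_(z in half_itv s (A M ^+ 2) (A M.+1 ^+ 2)) (z ^+ 2 * u z ^+ 2) +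
       \int[mu]_(z in half_itv s (A M ^+ 2) (A M.+1 ^+ 2)) (h z ^+ 2)).
  apply: (@half_cell_bound s n%:R deg_cst _ (A M ^+ 2)) => //.
  - exact: ltW.
  - exact: Ale1.
  - exact: deg_cst_ge0.
  - by have [] := cell_numerics_step nR0 a20 A2M B2 u1 l1.
  - by have [] := cell_numerics_step nR0 a20 A2M B2 u1 l1.
move: IH; move: deg_cst => K; lra.
Qed.

Lemma degenerate_interpolation (n : nat) : (0 < n)%N ->
  n%:R * \int[mu]_(z in I) (`|z| * g z ^+ 2) <=
  deg_cst * (n%:R ^+ 2 * \int[mu]_(z in I) (z ^+ 2 * u z ^+ 2) +
             \int[mu]_(z in I) (h z ^+ 2)).
Proof.
move=> n0; have := degenerate_half true n0; have := degenerate_half false n0.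
rewrite /half_itv oppr0 => H1 H2.
have N10 : (-1 : R) < 0 by rewrite ltrN10.
rewrite !(Rintegral_itv_split N10 ltr01).
- by move: H1 H2; move: deg_cst => K; lra.
- by case: Lh.
- exact: Rintegrable_sqr_sqr.
- exact: Rintegrable_norm_sqr.
Qed.

End DegenerateInterpolationCells.

(** * The cosine and sine systems on (x0, x1) and Bessel's inequality *)

Section CosineSystem.
Variable R : realType.
Notation mu := (@lebesgue_measure R).
Variables x0 x1 : R.
Hypothesis x01 : x0 < x1.
Notation D := (`]x0, x1[%classic : set R).
Notation L := (x1 - x0).

Definition freq : R := pi / L.

(** The argument n freq (x - x0) is expanded into the shape expected by [smooth_affine]; [ecosE]
    restores the usual form. It equals 0 at [x0] and n pi at [x1]. *)
Definition ecos (n : nat) (x : R) : R :=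
  cos (n%:R * freq * x + - (n%:R * freq * x0)).

Definition esin (n : nat) (x : R) : R :=
  sin (n%:R * freq * x + - (n%:R * freq * x0)).

Lemma L_gt0 : 0 < L. Proof. by rewrite subr_gt0. Qed.

Lemma freq_gt0 : 0 < freq.
Proof. by rewrite divr_gt0 ?pi_gt0 ?L_gt0. Qed.

Lemma ecosE n x : ecos n x = cos (n%:R * (freq * (x - x0))).
Proof. by rewrite /ecos; congr cos; ring. Qed.

Lemma esinE n x : esin n x = sin (n%:R * (freq * (x - x0))).
Proof. by rewrite /esin; congr sin; ring. Qed.

Lemma ecos0 x : ecos 0 x = 1.
Proof. by rewrite ecosE mul0r cos0. Qed.

Lemma smooth_ecos n : smooth (ecos n).
Proof. by apply: smooth_affine; have [] := smooth_sin_cos R. Qed.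

Lemma smooth_esin n : smooth (esin n).
Proof. by apply: smooth_affine; have [] := smooth_sin_cos R. Qed.

Lemma ecos_le1 n x : `|ecos n x| <= 1.
Proof. exact: cos_max. Qed.

Lemma esin_le1 n x : `|esin n x| <= 1.
Proof. exact: sin_max. Qed.

Lemma measurable_ecos (E : set R) n : measurable_fun E (ecos n).
Proof. by apply: measurable_fun_smooth; exact: smooth_ecos. Qed.

Lemma measurable_esin (E : set R) n : measurable_fun E (esin n).
Proof. by apply: measurable_fun_smooth; exact: smooth_esin. Qed.

Lemma derive1_esin n x : derive1 (esin n) x = n%:R * freq * ecos n x.
Proof.
have daff : is_derive x 1
    (fun x : R => n%:R * freq * x + - (n%:R * freq * x0)) (n%:R * freq).
  rewrite -[X in is_derive _ _ _ X]addr0; apply: is_deriveD.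
  by rewrite -[X in is_derive _ _ _ X]mulr1; exact: is_deriveZ.
have := @is_derive1_comp _ sin _ _ _ _ (is_derive_sin _) daff.
by move=> h; rewrite derive1E (@derive_val _ _ _ _ _ _ _ h) mulrC.
Qed.

Lemma sin_natpi n : sin (n%:R * pi) = 0 :> R.
Proof.
elim: n => [|n IH]; first by rewrite mul0r sin0.
by rewrite -natr1 mulrDl mul1r sinDpi IH oppr0.
Qed.

Lemma esin_x0 n : esin n x0 = 0.
Proof. by rewrite esinE subrr !mulr0 sin0. Qed.

Lemma esin_x1 n : esin n x1 = 0.
Proof. by rewrite esinE /freq divfK ?gt_eqF ?L_gt0// sin_natpi. Qed.

Lemma L2_ecos n : L2 mu D (ecos n).
Proof.
apply: (@L2_bounded _ _ _ mu _ _ _ 1) => //; first exact: mu_itv_lty.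
- exact: measurable_ecos.
- by move=> x _; exact: ecos_le1.
Qed.

Lemma L2D_Rintegrable f : L2 mu D f -> Rintegrable mu D f.
Proof. by apply: L2_Rintegrable => //; exact: mu_itv_lty. Qed.

Lemma Rintegral_ecos n : (0 < n)%N -> \int[mu]_(x in D) ecos n x = 0.
Proof.
move=> n0; have nf0 : n%:R * freq != 0.
  by rewrite mulf_neq0 ?pnatr_eq0 -?lt0n// gt_eqF ?freq_gt0.
have := Rintegral_derive1 x01 (smooth_esin n).
rewrite esin_x0 esin_x1 subrr.
have -> : \int[mu]_(z in D) derive1 (esin n) z =
    \int[mu]_(z in D) (n%:R * freq * ecos n z).
  by apply: eq_Rintegral => z _; rewrite derive1_esin.
rewrite (RintegralZl _ _ (L2D_Rintegrable (L2_ecos n)))//.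
by move=> /eqP; rewrite mulf_eq0 (negbTE nf0) => /eqP.
Qed.

Lemma Rintegral_ecos0 : \int[mu]_(x in D) ecos 0 x = L.
Proof.
rewrite -[RHS]mul1r -(Rintegral_itv_cst 1 (ltW x01)).
by apply: eq_Rintegral => x _; rewrite ecos0.
Qed.

Lemma ecosM m n x : (n <= m)%N ->
  ecos m x * ecos n x = (ecos (m - n) x + ecos (m + n) x) / 2.
Proof.
move=> nm; rewrite !ecosE; move: (freq * (x - x0)) => t.
rewrite natrB// natrD [(m%:R - n%:R) * t]mulrBl [(m%:R + n%:R) * t]mulrDl.
rewrite cosB cosD.
by field.
Qed.

Lemma esinM m n x : (n <= m)%N ->
  esin m x * esin n x = (ecos (m - n) x - ecos (m + n) x) / 2.
Proof.
move=> nm; rewrite !ecosE !esinE; move: (freq * (x - x0)) => t.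
rewrite natrB// natrD [(m%:R - n%:R) * t]mulrBl [(m%:R + n%:R) * t]mulrDl.
rewrite cosB cosD.
by field.
Qed.

(** The boolean is the sign in the product-to-sum formula: [false] for two cosines, [true] for two
    sines. *)
Let int_half (s : bool) m n : (n <= m)%N -> (0 < m)%N ->
  \int[mu]_(x in D) ((ecos (m - n) x + (-1) ^+ s * ecos (m + n) x) / 2) =
  (L / 2) *+ (m == n).
Proof.
move=> nm m0.
have i1 := L2D_Rintegrable (L2_ecos (m - n)).
have i2 : Rintegrable mu D (fun x => (-1) ^+ s * ecos (m + n) x).
  by apply: RintegrableZ => //; exact: L2D_Rintegrable (L2_ecos (m + n)).
rewrite (RintegralZr _ _ (RintegrableD _ i1 i2))//.
rewrite (RintegralD _ i1 i2)// (RintegralZl _ _ (L2D_Rintegrable (L2_ecos _)))//.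
rewrite (Rintegral_ecos (n := (m + n)%N)) ?addn_gt0 ?m0// mulr0 addr0.
have [->|mn] := eqVneq m n; first by rewrite subnn Rintegral_ecos0.
by rewrite Rintegral_ecos ?mul0r// subn_gt0 ltn_neqAle eq_sym mn.
Qed.

Lemma ecos_orthogonal m n : (0 < m)%N ->
  \int[mu]_(x in D) (ecos m x * ecos n x) = (L / 2) *+ (m == n).
Proof.
wlog nm : m n / (n <= m)%N => [hw m0|m0].
  case: (leqP n m) => [|/ltnW] nm; first exact: hw.
  rewrite eq_sym -hw//; last exact: leq_trans m0 nm.
  by apply: eq_Rintegral => x _; rewrite mulrC.
rewrite -(int_half false nm m0); apply: eq_Rintegral => x _.
by rewrite ecosM// expr0 mul1r.
Qed.

Lemma esin_orthogonal m n : (0 < m)%N ->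
  \int[mu]_(x in D) (esin m x * esin n x) = (L / 2) *+ (m == n).
Proof.
wlog nm : m n / (n <= m)%N => [hw m0|m0].
  case: (leqP n m) => [|/ltnW] nm; first exact: hw.
  rewrite eq_sym -hw//; last exact: leq_trans m0 nm.
  by apply: eq_Rintegral => x _; rewrite mulrC.
rewrite -(int_half true nm m0); apply: eq_Rintegral => x _.
by rewrite esinM// expr1 mulN1r.
Qed.

(** Projections are removed one at a time. The residual [r] keeps the later coefficients of [f], and
    its squared norm, which is nonnegative, is that of [f] minus the sum of the squared coefficients
    over [c]. *)
Lemma Bessel (e : nat -> R -> R) (c : R) f : 0 < c ->
  (forall n, L2 mu D (e n)) -> L2 mu D f ->
  (forall m n, \int[mu]_(x in D) (e m x * e n x) = c *+ (m == n)) ->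
  forall M, \sum_(n < M) (\int[mu]_(x in D) (f x * e n x)) ^+ 2 <=
    c * \int[mu]_(x in D) (f x ^+ 2).
Proof.
move=> c0 Le Lf orth M; pose a n := \int[mu]_(x in D) (f x * e n x).
suff [r [Lr rM rE]] : exists r, [/\ L2 mu D r,
    forall n, (M <= n)%N -> \int[mu]_(x in D) (r x * e n x) = a n &
    \int[mu]_(x in D) (r x ^+ 2) =
      \int[mu]_(x in D) (f x ^+ 2) - (\sum_(n < M) a n ^+ 2) / c].
  have : 0 <= \int[mu]_(x in D) (r x ^+ 2).
    by apply: Rintegral_ge0 => x _; exact: sqr_ge0.
  by rewrite rE subr_ge0 ler_pdivrMr// mulrC.
elim: M => [|M [r [Lr rM rE]]].
  by exists f; split=> //; rewrite big_ord0 mul0r subr0.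
exists (fun x => r x - a M / c * e M x); split.
- by apply: L2B => //; exact: L2Z.
- move=> n Mn.
  have i1 := L2M _ Lr (Le n); have i2 := L2M _ (Le M) (Le n).
  have -> : \int[mu]_(x in D) ((r x - a M / c * e M x) * e n x) =
      \int[mu]_(x in D) (r x * e n x - a M / c * (e M x * e n x)).
    by apply: eq_Rintegral => x _; ring.
  rewrite (RintegralB _ (i1 _) (RintegrableZ _ _ (i2 _)))// RintegralZl//; last exact: i2.
  by rewrite rM ?(ltnW Mn)// orth (ltn_eqF Mn) mulr0n mulr0 subr0.
have i1 := Lr.2; have i2 := L2M _ Lr (Le M); have i3 := (Le M).2.
have -> : \int[mu]_(x in D) ((r x - a M / c * e M x) ^+ 2) =
    \int[mu]_(x in D) ((r x ^+ 2 - 2 * (a M / c) * (r x * e M x)) +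
      (a M / c) ^+ 2 * e M x ^+ 2).
  by apply: eq_Rintegral => x _; ring.
have i2' : Rintegrable mu D (fun x => 2 * (a M / c) * (r x * e M x)).
  by apply: RintegrableZ => //; exact: i2.
have i3' : Rintegrable mu D (fun x => (a M / c) ^+ 2 * e M x ^+ 2).
  exact: RintegrableZ.
rewrite (RintegralD _ (RintegrableB _ i1 i2') i3')// (RintegralB _ i1 i2')//.
rewrite !RintegralZl//; last exact: i2.
rewrite rM// rE big_ord_recr/=.
have -> : \int[mu]_(x in D) (e M x ^+ 2) = c.
  by have := orth M M; rewrite eqxx mulr1n => <-; apply: eq_Rintegral => x _; rewrite expr2.
by field; rewrite gt_eqF.
Qed.

End CosineSystem.

(** * Quadratic forms of kernels that are diagonal in the cosine basis *)

Section CosineKernel.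
Variable R : realType.
Notation mu := (@lebesgue_measure R).
Variables x0 x1 : R.
Hypothesis x01 : x0 < x1.
Notation D := (`]x0, x1[%classic : set R).
Notation L := (x1 - x0).
Notation ec := (ecos x0 x1).
Implicit Types f : R -> R.

Definition cos_coef f n : R := \int[mu]_(x in D) (f x * ec n x).

Variables (k0 : R) (k : nat -> R) (M : nat).

(** Only finitely many terms are kept, so every double integral below is a finite combination of
    coefficients and no limit has to be exchanged with an integral. *)
Definition kern (x y : R) : R :=
  k0 + \sum_(i < M) k i * (ec i.+1 x * ec i.+1 y).

Definition kernI (phi : R -> R) (x : R) : R :=
  k0 * (\int[mu]_(y in D) phi y) +
  \sum_(i < M) k i * (ec i.+1 x * cos_coef phi i.+1).

Lemma Rintegrable_ec phi n : Rintegrable mu D phi ->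
  Rintegrable mu D (fun x => phi x * ec n x).
Proof.
move=> ip; apply: (@RintegrableMb _ _ _ mu _ _ 1) => //.
  exact: measurable_ecos.
by move=> x _; exact: ecos_le1.
Qed.

Let term_int phi x i : Rintegrable mu D phi ->
  Rintegrable mu D (fun y => k i * ec i.+1 x * (phi y * ec i.+1 y)).
Proof. by move=> ip; apply: RintegrableZ => //; exact: Rintegrable_ec. Qed.

Let kernE phi x y : phi y * kern x y =
  k0 * phi y + \sum_(i < M) k i * ec i.+1 x * (phi y * ec i.+1 y).
Proof.
rewrite /kern mulrDr mulrC mulr_sumr; congr (_ + _).
by apply: eq_bigr => i _; ring.
Qed.

Lemma Rintegrable_kern phi x : Rintegrable mu D phi ->
  Rintegrable mu D (fun y => phi y * kern x y).
Proof.
move=> ip; apply: (@eq_Rintegrable _ _ _ mu _ _ (fun y => k0 * phi y +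
  \sum_(i < M) k i * ec i.+1 x * (phi y * ec i.+1 y))) => //.
apply: RintegrableD => //; first exact: RintegrableZ.
by apply: Rintegrable_sum => // i; exact: term_int.
Qed.

Lemma Rintegral_kern phi x : Rintegrable mu D phi ->
  \int[mu]_(y in D) (phi y * kern x y) = kernI phi x.
Proof.
move=> ip; rewrite /kernI.
have i1 : Rintegrable mu D (fun y => k0 * phi y) by exact: RintegrableZ.
have i2 : Rintegrable mu D
    (fun y => \sum_(i < M) k i * ec i.+1 x * (phi y * ec i.+1 y)).
  by apply: Rintegrable_sum => // i; exact: term_int.
have -> : \int[mu]_(y in D) (phi y * kern x y) = \int[mu]_(y in D) (k0 * phi y +
    \sum_(i < M) k i * ec i.+1 x * (phi y * ec i.+1 y)).
  by apply: eq_Rintegral => y _; exact: kernE.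
rewrite (RintegralD _ i1 i2)// RintegralZl//; congr (_ + _).
rewrite Rintegral_sum//; last by move=> i; exact: term_int.
apply: eq_bigr => i _; rewrite RintegralZl ?mulrA//.
exact: Rintegrable_ec.
Qed.

Lemma kernI_cst (c : R) x : kernI (cst c) x = k0 * (c * L).
Proof.
rewrite /kernI Rintegral_itv_cst ?ltW// big1 ?addr0// => i _.
rewrite /cos_coef RintegralZl//.
  by rewrite Rintegral_ecos// !mulr0.
exact: L2D_Rintegrable (L2_ecos _ _ _).
Qed.

Let kernI_term (i : 'I_M) phi psi : Rintegrable mu D phi -> 
  Rintegrable mu D (fun x => k i * cos_coef psi i.+1 * (phi x * ec i.+1 x)).
Proof. by move=> ip; apply: RintegrableZ => //; exact: Rintegrable_ec. Qed.

Let kernIE phi psi x : phi x * kernI psi x = k0 * (\int[mu]_(y in D) psi y) * phi x +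
  \sum_(i < M) k i * cos_coef psi i.+1 * (phi x * ec i.+1 x).
Proof.
rewrite /kernI mulrDr [in LHS]mulrC mulr_sumr; congr (_ + _).
by apply: eq_bigr => i _; ring.
Qed.

Lemma Rintegrable_kernI phi psi : Rintegrable mu D phi ->
  Rintegrable mu D (fun x => phi x * kernI psi x).
Proof.
move=> ip; apply: (@eq_Rintegrable _ _ _ mu _ _ (fun x =>
  k0 * (\int[mu]_(y in D) psi y) * phi x +
  \sum_(i < M) k i * cos_coef psi i.+1 * (phi x * ec i.+1 x))) => //.
apply: RintegrableD => //; first exact: RintegrableZ.
by apply: Rintegrable_sum => // i; exact: kernI_term.
Qed.

Lemma Rintegral_kernI phi psi : Rintegrable mu D phi ->
  \int[mu]_(x in D) (phi x * kernI psi x) =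
  k0 * (\int[mu]_(y in D) psi y) * (\int[mu]_(x in D) phi x) +
  \sum_(i < M) k i * (cos_coef psi i.+1 * cos_coef phi i.+1).
Proof.
move=> ip.
have i1 : Rintegrable mu D (fun x => k0 * (\int[mu]_(y in D) psi y) * phi x).
  exact: RintegrableZ.
have i2 : Rintegrable mu D
    (fun x => \sum_(i < M) k i * cos_coef psi i.+1 * (phi x * ec i.+1 x)).
  by apply: Rintegrable_sum => // i; exact: kernI_term.
have -> : \int[mu]_(x in D) (phi x * kernI psi x) = \int[mu]_(x in D)
  (k0 * (\int[mu]_(y in D) psi y) * phi x +
    \sum_(i < M) k i * cos_coef psi i.+1 * (phi x * ec i.+1 x)).
  by apply: eq_Rintegral => y _; exact: kernIE.
rewrite (RintegralD _ i1 i2)// RintegralZl//; congr (_ + _).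
rewrite Rintegral_sum//; last by move=> i; exact: kernI_term.
apply: eq_bigr => i _; rewrite RintegralZl ?mulrA//.
exact: Rintegrable_ec.
Qed.

(** Closed form of the integral over y of (f x - f y)^2 kern(x, y), obtained by expanding the
    square. *)
Definition kern_inner f (x : R) : R :=
  k0 * L * f x ^+ 2 - 2 * (f x * kernI f x) + kernI (fun y => f y ^+ 2) x.

Lemma Rintegrable_sqrB_kern f x : L2 mu D f ->
  Rintegrable mu D (fun y => (f x - f y) ^+ 2 * kern x y).
Proof.
move=> Lf; apply: Rintegrable_kern.
have [] // : L2 mu D (fun y => f x - f y).
apply: (@L2B _ _ _ mu _ _ (cst (f x)) f) => //.
by apply: L2_cst => //; exact: mu_itv_lty.
Qed.

Lemma Rintegral_sqrB_kern f x : L2 mu D f ->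
  \int[mu]_(y in D) ((f x - f y) ^+ 2 * kern x y) = kern_inner f x.
Proof.
move=> Lf; have fi := L2D_Rintegrable Lf; have [_ f2i] := Lf.
have ci := Rintegrable_itv_cst x0 x1 1.
have i1 : Rintegrable mu D (fun y => f x ^+ 2 * (cst 1 y * kern x y)).
  by apply: RintegrableZ => //; exact: Rintegrable_kern.
have i2 : Rintegrable mu D (fun y => 2 * f x * (f y * kern x y)).
  by apply: RintegrableZ => //; exact: Rintegrable_kern.
have i3 : Rintegrable mu D (fun y => f y ^+ 2 * kern x y).
  exact: Rintegrable_kern.
have -> : \int[mu]_(y in D) ((f x - f y) ^+ 2 * kern x y) =
    \int[mu]_(y in D) (f x ^+ 2 * (cst 1 y * kern x y) -
      2 * f x * (f y * kern x y) + f y ^+ 2 * kern x y).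
  by apply: eq_Rintegral => y _ /=; ring.
rewrite (RintegralD _ (RintegrableB _ i1 i2) i3)// (RintegralB _ i1 i2)//.
rewrite (RintegralZl _ _ (Rintegrable_kern x ci))//.
rewrite (RintegralZl _ _ (Rintegrable_kern x fi))//.
by rewrite !Rintegral_kern// kernI_cst /kern_inner; ring.
Qed.

Lemma Rintegrable_kern_inner f : L2 mu D f -> Rintegrable mu D (kern_inner f).
Proof.
move=> Lf; have fi := L2D_Rintegrable Lf; have [_ f2i] := Lf.
apply: RintegrableD => //.
  apply: RintegrableB => //; first exact: RintegrableZ.
  by apply: RintegrableZ => //; exact: Rintegrable_kernI.
apply: (@eq_Rintegrable _ _ _ mu _ _
  (fun x => cst 1 x * kernI (fun y => f y ^+ 2) x)) => //.
  by move=> x _; rewrite mul1r.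
by apply: Rintegrable_kernI; exact: Rintegrable_itv_cst.
Qed.

(** Closed form of the double integral of (f x - f y)^2 kern(x, y). Cosines of positive index have
    mean zero, so the two pure squares see only [k0]. *)
Definition kern_form f : R :=
  2 * k0 * (L * (\int[mu]_(x in D) (f x ^+ 2)) - (\int[mu]_(x in D) f x) ^+ 2) -
  2 * \sum_(i < M) k i * cos_coef f i.+1 ^+ 2.

Lemma Rintegral_kern_inner f : L2 mu D f ->
  \int[mu]_(x in D) kern_inner f x = kern_form f.
Proof.
move=> Lf; have fi := L2D_Rintegrable Lf; have [_ f2i] := Lf.
have ci := Rintegrable_itv_cst x0 x1 1.
have i1 : Rintegrable mu D (fun x => k0 * L * f x ^+ 2).
  by apply: RintegrableZ.
have i2 : Rintegrable mu D (fun x => 2 * (f x * kernI f x)).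
  by apply: RintegrableZ => //; exact: Rintegrable_kernI.
have i3 : Rintegrable mu D (fun x => cst 1 x * kernI (fun y => f y ^+ 2) x).
  exact: Rintegrable_kernI.
have -> : \int[mu]_(x in D) kern_inner f x = \int[mu]_(x in D)
    (k0 * L * f x ^+ 2 - 2 * (f x * kernI f x) +
     cst 1 x * kernI (fun y => f y ^+ 2) x).
  by apply: eq_Rintegral => x _; rewrite /kern_inner mul1r.
rewrite (RintegralD _ (RintegrableB _ i1 i2) i3)// (RintegralB _ i1 i2)//.
rewrite (RintegralZl _ _ f2i)// (RintegralZl _ _ (Rintegrable_kernI f fi))//.
rewrite !Rintegral_kernI// Rintegral_itv_cst ?ltW//.
rewrite [X in _ + (_ + X)]big1 => [|i _].
  rewrite /kern_form mulrDr.
  under eq_bigr do rewrite -expr2.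
  ring.
have -> : cos_coef (cst 1) i.+1 = 0; last by rewrite !mulr0.
rewrite -[RHS](@Rintegral_ecos _ _ _ x01 i.+1)//.
by apply: eq_Rintegral => x _; rewrite mul1r.
Qed.

(** Integrating against a nonnegative kernel preserves a domination of squared differences. The
    constant [e] is multiplied by the total mass of the kernel, [k0 * L ^+ 2]. *)
Lemma kern_form_le f q (e n : R) : L2 mu D f -> L2 mu D q -> 0 <= e -> 0 <= n ->
  (forall x y, D x -> D y -> 0 <= kern x y) ->
  (forall x y, D x -> D y -> (f x - f y) ^+ 2 <= e + n * (q x - q y) ^+ 2) ->
  kern_form f <= e * (k0 * L ^+ 2) + n * kern_form q.
Proof.
move=> Lf Lq e0 n0 kge0 fq; have fi := L2D_Rintegrable Lf.
have inner_le x : D x -> kern_inner f x <= e * (k0 * L) + n * kern_inner q x.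
  move=> Dx; rewrite -!Rintegral_sqrB_kern//.
  have ci := Rintegrable_itv_cst x0 x1 1.
  have i1 := Rintegrable_kern x ci; have i2 := Rintegrable_sqrB_kern x Lq.
  have -> : e * (k0 * L) = e * \int[mu]_(y in D) (cst 1 y * kern x y).
    by rewrite Rintegral_kern// kernI_cst mul1r.
  rewrite -!RintegralZl// -(RintegralD _ (RintegrableZ _ _ i1) (RintegrableZ _ _ i2))//.
  apply: le_Rintegral => //.
  - exact: Rintegrable_sqrB_kern.
  - by apply: RintegrableD => //; exact: RintegrableZ.
  move=> y Dy; rewrite mul1r mulrA -mulrDl ler_wpM2r ?kge0//.
  exact: fq.
rewrite -!Rintegral_kern_inner//.
have -> : e * (k0 * L ^+ 2) = \int[mu]_(x in D) (e * (k0 * L)).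
  by rewrite Rintegral_itv_cst ?ltW//; ring.
have i2 := Rintegrable_kern_inner Lq.
have ci := Rintegrable_itv_cst x0 x1 (e * (k0 * L)).
rewrite -RintegralZl// -(RintegralD _ ci (RintegrableZ _ _ i2))//.
apply: le_Rintegral => //.
- exact: Rintegrable_kern_inner.
- by apply: RintegrableD => //; exact: RintegrableZ.
Qed.

End CosineKernel.

(** * The truncated Poisson kernel and its lower bound *)

Section PoissonKernel.
Variable R : realType.
Implicit Types r t : R.

(** This is |1 - r e^(i t)|^2, the denominator of the Poisson kernel. *)
Definition poisson_den r t : R := 1 - 2 * r * cos t + r ^+ 2.

Lemma poisson_den_ge r t : 0 <= r -> (1 - r) ^+ 2 <= poisson_den r t.
Proof.
move=> r0; have := ler_wpM2l r0 (cos_le1 t); rewrite /poisson_den => h.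
by rewrite sqrrB expr1n mul1r -mulr_natl; lra.
Qed.

Lemma sqr_sin_le t : sin t ^+ 2 <= t ^+ 2.
Proof.
suff H (s : R) : 0 <= s -> `|sin s| <= s.
  rewrite ler_norm_sqr; have [t0|t0] := leP 0 t.
    by rewrite [leRHS]ger0_norm// H.
  by rewrite -normrN -sinN -[leRHS]normrN [leRHS]ger0_norm ?H//; lra.
rewrite le_eqVlt => /predU1P[<-|s0]; first by rewrite sin0 normr0.
have [c _] := @MVT R sin cos 0 s s0 (fun x _ => is_derive_sin x)
  (continuous_subspaceT (@continuous_sin R)).
rewrite sin0 !subr0 => ->; rewrite normrM [X in _ * X]ger0_norm ?(ltW s0)//.
by rewrite ler_piMl ?cos_max// ltW.
Qed.

(** The denominator equals (1 - r)^2 + 2 r (1 - cos t), and 2 (1 - cos t) = 4 sin(t/2)^2 is at most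
    t^2. *)
Lemma poisson_den_le r t : 0 <= r -> r <= 1 ->
  poisson_den r t <= (1 - r) ^+ 2 + t ^+ 2.
Proof.
move=> r0 r1; have h : 2 * (1 - cos t) <= t ^+ 2.
  have -> : cos t = 1 - 2 * sin (t / 2) ^+ 2.
    rewrite {1}[t]splitr cosD -!expr2 cos2sin2; ring.
  have := sqr_sin_le (t / 2); rewrite expr_div_n; lra.
have c0 : 0 <= 2 * (1 - cos t) by have := cos_le1 t; lra.
have := ler_wpM2r c0 r1; rewrite mul1r => h2.
rewrite /poisson_den (_ : (1 - r) ^+ 2 = 1 - 2 * r + r ^+ 2); last by ring.
lra.
Qed.

Definition poisson_sum r M t : R :=
  1 + 2 * \sum_(i < M) r ^+ i.+1 * cos (i.+1%:R * t).

(** The recurrence cos((k+1) t) + cos((k-1) t) = 2 cos t cos(k t) makes the product telescope; only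
    the terms at the truncation remain. *)
Lemma poisson_sumE r M t : poisson_den r t * poisson_sum r M t =
  1 - r ^+ 2 - 2 * r ^+ M.+1 * cos (M.+1%:R * t) + 2 * r ^+ M.+2 * cos (M%:R * t).
Proof.
elim: M => [|M IH].
  by rewrite /poisson_sum big_ord0 /poisson_den mul0r cos0 mul1r; ring.
have -> : poisson_sum r M.+1 t =
    poisson_sum r M t + 2 * r ^+ M.+1 * cos (M.+1%:R * t).
  by rewrite /poisson_sum big_ord_recr/=; ring.
rewrite mulrDr IH.
have -> : cos (M%:R * t) = cos (M.+1%:R * t) * cos t + sin (M.+1%:R * t) * sin t.
  by rewrite -cosB; congr cos; rewrite -natr1; ring.
have -> : cos (M.+2%:R * t) = cos (M.+1%:R * t) * cos t - sin (M.+1%:R * t) * sin t.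
  by rewrite -cosD; congr cos; rewrite -(natr1 M.+1); ring.
by rewrite /poisson_den !exprS; ring.
Qed.

Lemma poisson_sum_ge r M t : 0 < r -> r < 1 ->
  (1 - r ^+ 2) / poisson_den r t - 4 * r ^+ M.+1 / (1 - r) ^+ 2 <=
  poisson_sum r M t.
Proof.
move=> r0 r1; have d1 := poisson_den_ge t (ltW r0).
have s0 : 0 < (1 - r) ^+ 2 by rewrite exprn_gt0// subr_gt0.
have d0 : 0 < poisson_den r t by exact: lt_le_trans d1.
have rM0 : 0 <= r ^+ M.+1 by rewrite exprn_ge0// ltW.
have rM1 : r ^+ M.+2 <= r ^+ M.+1 by rewrite exprS ler_piMl// ltW.
have rem : - (4 * r ^+ M.+1) <= - (2 * r ^+ M.+1 * cos (M.+1%:R * t)) +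
    2 * r ^+ M.+2 * cos (M%:R * t).
  have h1 := ler_wpM2l rM0 (cos_le1 (M.+1%:R * t)).
  have rM2 : 0 <= r ^+ M.+2 by rewrite exprn_ge0// ltW.
  have h2 := ler_wpM2l rM2 (cos_geN1 (M%:R * t)).
  rewrite -![2 * _ * cos _]mulrA; move: h1 h2 rM0 rM1 rM2.
  move: (r ^+ M.+1) (r ^+ M.+2) (cos _) (cos _) => a b u v; lra.
have -> : poisson_sum r M t = (1 - r ^+ 2) / poisson_den r t +
   (- (2 * r ^+ M.+1 * cos (M.+1%:R * t)) + 2 * r ^+ M.+2 * cos (M%:R * t)) /
     poisson_den r t.
  apply: (mulfI (lt0r_neq0 d0)); rewrite poisson_sumE mulrDr.
  by rewrite ![poisson_den _ _ * _]mulrC !divfK ?lt0r_neq0//; ring.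
rewrite lerD2l; apply: (@le_trans _ _ (- (4 * r ^+ M.+1) / poisson_den r t)).
  rewrite mulNr lerN2 ler_wpM2l//; first by rewrite mulr_ge0.
  by rewrite lef_pV2 ?posrE.
by rewrite ler_wpM2r// invr_ge0 ltW.
Qed.

Variables x0 x1 : R.
Hypothesis x01 : x0 < x1.
Notation ec := (ecos x0 x1).

Definition pois_err r M : R := 8 * r ^+ M.+1 / (1 - r) ^+ 2.
(** Product-to-sum turns this into two truncated Poisson sums, at the difference and at the sum of
    the angles, plus [pois_err]: hence 2 = 1 + 1 and the factor 4. The added constant is twice the
    truncation error of [poisson_sum_ge], one for each sum, and restores nonnegativity. *)
Definition pois_kern r M := kern x0 x1 (2 + pois_err r M) (fun i => 4 * r ^+ i.+1) M.

(** The full Poisson kernel at the sum of the angles, a reflection across the end point, is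
    nonnegative and is dropped. *)
Lemma pois_kern_ge r M x y : 0 < r -> r < 1 ->
  (1 - r ^+ 2) / poisson_den r (freq x0 x1 * (x - y)) <= pois_kern r M x y.
Proof.
move=> r0 r1; pose t1 := freq x0 x1 * (x - y).
pose t2 := freq x0 x1 * (x - x0) + freq x0 x1 * (y - x0).
have -> : pois_kern r M x y =
    pois_err r M + poisson_sum r M t1 + poisson_sum r M t2.
  rewrite /pois_kern /kern /poisson_sum.
  have -> : \sum_(i < M) 4 * r ^+ i.+1 * (ec i.+1 x * ec i.+1 y) =
      2 * (\sum_(i < M) r ^+ i.+1 * cos (i.+1%:R * t1)) +
      2 * (\sum_(i < M) r ^+ i.+1 * cos (i.+1%:R * t2)).
    rewrite !mulr_sumr -big_split/=; apply: eq_bigr => i _.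
    rewrite !ecosE /t2.
    have -> : t1 = freq x0 x1 * (x - x0) - freq x0 x1 * (y - x0).
      by rewrite /t1; ring.
    move: (freq x0 x1 * (x - x0)) (freq x0 x1 * (y - x0)) => u v.
    rewrite [_ * (u - v)]mulrBr [_ * (u + v)]mulrDr cosB cosD; ring.
  ring.
have h1 := poisson_sum_ge M t1 r0 r1; have h2 := poisson_sum_ge M t2 r0 r1.
have : 0 <= (1 - r ^+ 2) / poisson_den r t2.
  rewrite divr_ge0 ?subr_ge0 ?exprn_ile1 ?ltW//.
  apply: lt_le_trans (poisson_den_ge t2 (ltW r0)).
  by rewrite exprn_gt0// subr_gt0.
have -> : pois_err r M = 2 * (4 * r ^+ M.+1 / (1 - r) ^+ 2).
  by rewrite /pois_err !mulrA -natrM.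
rewrite -/t1; lra.
Qed.

Lemma pois_kern_ge0 r M x y : 0 < r -> r < 1 -> 0 <= pois_kern r M x y.
Proof.
move=> r0 r1; apply: le_trans (pois_kern_ge M x y r0 r1).
rewrite divr_ge0 ?subr_ge0 ?exprn_ile1 ?ltW//.
apply: lt_le_trans (poisson_den_ge _ (ltW r0)).
by rewrite exprn_gt0// subr_gt0.
Qed.

Lemma pois_err_ge0 r M : 0 < r -> 0 <= pois_err r M.
Proof.
by move=> r0; rewrite /pois_err divr_ge0 ?sqr_ge0// mulr_ge0// exprn_ge0 ?ltW.
Qed.

Lemma pois_err_small r (e : R) : 0 < r -> r < 1 -> 0 < e ->
  \forall M \near \oo, pois_err r M <= e.
Proof.
move=> r0 r1 e0; have s0 : 0 < (1 - r) ^+ 2 by rewrite exprn_gt0// subr_gt0.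
pose d := e * (1 - r) ^+ 2 / 8.
have d0 : 0 < d by rewrite divr_gt0// mulr_gt0.
have nr : `|r| < 1 by rewrite gtr0_norm.
have /cvgr0Pnorm_le/(_ _ d0) := @cvg_expr _ r nr.
apply: filterS => M; rewrite ger0_norm ?exprn_ge0 ?(ltW r0)// /d => h.
rewrite /pois_err ler_pdivrMr// mulrC -ler_pdivlMr//.
by apply: le_trans h; rewrite exprS ler_piMl ?exprn_ge0 ?(ltW r0) ?(ltW r1).
Qed.

End PoissonKernel.

(** * Completeness of the cosine system *)

Section Parseval.
Variable R : realType.
Notation mu := (@lebesgue_measure R).
Variables x0 x1 : R.
Hypothesis x01 : x0 < x1.
Notation D := (`]x0, x1[%classic : set R).
Notation L := (x1 - x0).
Notation ec := (ecos x0 x1).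
Implicit Types f c : R -> R.

Lemma ecos1_inj x y : x0 <= x <= x1 -> x0 <= y <= x1 -> ec 1 x = ec 1 y -> x = y.
Proof.
have f0 := freq_gt0 x01; have L0 := L_gt0 x01.
have ran z : x0 <= z <= x1 -> freq x0 x1 * (z - x0) \in `[0, pi].
  move=> /andP[z0 z1]; rewrite in_itv/= mulr_ge0 ?(ltW f0) ?subr_ge0//=.
  rewrite /freq mulrAC ler_pdivrMr// ler_wpM2l ?pi_ge0// lerD2r//.
move=> xI yI; rewrite !ecosE !mul1r => /cos_inj h.
have := h (ran _ xI) (ran _ yI) => /(mulfI (lt0r_neq0 f0)) => /addIr.
exact.
Qed.

Lemma continuous_sqrB (u : R -> R) : continuous u ->
  continuous (fun p : R * R => (u p.1 - u p.2) ^+ 2).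
Proof.
move=> cu p.
apply: (@continuous_comp _ _ _ (fun p : R * R => u p.1 - u p.2) (fun t => t ^+ 2)).
  apply: (@continuousB _ _ _ (u \o fst) (u \o snd)).
    by apply: continuous_comp; [exact: cvg_fst|exact: cu].
  by apply: continuous_comp; [exact: cvg_snd|exact: cu].
exact: exprn_continuous.
Qed.

(* Korovkin's argument: [cos] separates points, so by compactness it controls
   the oscillation of any continuous function *)
Lemma oscillation_dominated c (e : R) : continuous c -> 0 < e ->
  exists n : nat, forall x y, D x -> D y ->
    (c x - c y) ^+ 2 <= e + n%:R * (ec 1 x - ec 1 y) ^+ 2.
Proof.
move=> cc e0; have cq := smooth_continuous (smooth_ecos x0 x1 1).
pose K : set (R * R) := `[x0, x1] `*` `[x0, x1].
have cK : compact K by apply: compact_setX; exact: segment_compact.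
pose P (n : nat) (p : R * R) :=
  (c p.1 - c p.2) ^+ 2 <= e + n%:R * (ec 1 p.1 - ec 1 p.2) ^+ 2.
have : \forall n \near \oo, K `<=` P n.
  apply: (compact_near_coveringP _).1 cK _ _ _ _ _ => -[x y] [/= xI yI].
  (* On the diagonal, continuity of [c] suffices and every [n] works. Off it, the oscillation of [c]
     stays below [G] nearby and that of [ec 1] above [k / 2], so any [n] beyond [G / (k / 2)]
     works. *)
  have [qxy|qxy] := eqVneq (ec 1 x) (ec 1 y).
    have xy : x = y by apply: ecos1_inj => //; move: xI yI; rewrite !in_itv.
    exists ([set p | (c p.1 - c p.2) ^+ 2 < e], setT) => /=.
      split; last exact: filterT.
      have H : (c x - c y) ^+ 2 < e by rewrite xy subrr expr0n.
      exact: (@continuous_sqrB c cc (x, y) _ (lt_nbhsl H)).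
    move=> [p n] /= [pe _]; rewrite /P (le_trans (ltW pe))// lerDl mulr_ge0 ?sqr_ge0//.
  pose k := (ec 1 x - ec 1 y) ^+ 2; pose G := (c x - c y) ^+ 2 + 1.
  have k0 : 0 < k by rewrite /k exprn_even_gt0//= subr_eq0.
  exists ([set p | (c p.1 - c p.2) ^+ 2 < G /\ k / 2 < (ec 1 p.1 - ec 1 p.2) ^+ 2],
    [set n | G / (k / 2) <= n%:R]) => /=.
    split; last exact: nbhs_infty_ger.
    apply: filterI.
      have H : (c x - c y) ^+ 2 < G by rewrite /G ltrDl.
      exact: (@continuous_sqrB c cc (x, y) _ (lt_nbhsl H)).
    have H : k / 2 < (ec 1 x - ec 1 y) ^+ 2 by rewrite -/k; lra.
    exact: (@continuous_sqrB (ec 1) cq (x, y) _ (lt_nbhsr H)).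
  move=> [p n] /= [[pG pk] nG]; rewrite /P (le_trans (ltW pG))//.
  have k20 : 0 < k / 2 by lra.
  move: nG; rewrite ler_pdivrMr// => nG.
  have := ler_wpM2l (ler0n R n) (ltW pk); lra.
move=> [n _ HN]; exists n => x y Dx Dy.
apply: (HN n (leqnn n) (x, y)); split => /=.
  by move: Dx => /=; rewrite !in_itv/= => /andP[? ?]; lra.
by move: Dy => /=; rewrite !in_itv/= => /andP[? ?]; lra.
Qed.

Definition clamp (m x : R) : R := Num.max (- m) (Num.min m x).

Lemma clampP (m x : R) : 0 <= m -> [\/ clamp m x = m /\ m <= x,
  clamp m x = - m /\ x <= - m | clamp m x = x /\ - m <= x <= m].
Proof.
move=> m0; rewrite /clamp; case: (leP m x) => mx.
  by case: (leP (- m) m) => h; [constructor 1|lra].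
by case: (leP (- m) x) => h; [constructor 3|constructor 2]; split=> //; lra.
Qed.

Lemma clamp_le (m x : R) : 0 <= m -> `|clamp m x| <= m.
Proof. by move=> m0; case: (clampP x m0) => -[-> h]; rewrite ler_norml; lra. Qed.

Lemma clamp_lip (m x y : R) : 0 <= m -> `|clamp m x - clamp m y| <= `|x - y|.
Proof.
move=> m0; have := ler_norm (x - y); have := ler_norm (y - x).
rewrite distrC => h1 h2.
by case: (clampP x m0) => -[-> hx]; case: (clampP y m0) => -[-> hy];
  rewrite ler_norml; lra.
Qed.

Lemma clamp_id (m x : R) : 0 <= m -> `|x| <= m -> clamp m x = x.
Proof.
by move=> m0; rewrite ler_norml; case: (clampP x m0) => -[-> h] h'; lra.
Qed.

Lemma clamp_sub (m x : R) : 0 <= m -> `|x - clamp m x| <= `|x|.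
Proof.
move=> m0; have := ler_norm x; have := ler_norm (- x); rewrite normrN => h1 h2.
by case: (clampP x m0) => -[-> h]; rewrite ler_norml; lra.
Qed.

Lemma measurable_clamp m f : measurable_fun D f ->
  measurable_fun D (fun x => clamp m (f x)).
Proof.
move=> mf; apply: measurable_maxr; first exact: measurable_cst.
by apply: measurable_minr => //; exact: measurable_cst.
Qed.

Lemma continuous_clamp m f : continuous f -> continuous (fun x => clamp m (f x)).
Proof.
move=> cf x; apply: (@continuous_max _ _ (cst (- m)) (fun x => Num.min m (f x))).
  exact: cst_continuous.
apply: (@continuous_min _ _ (cst m) f); first exact: cst_continuous.
exact: cf.
Qed.

(** Continuous functions are dense in L^1. Clamping [f] and the approximant at the same level [m]
    upgrades this to L^2, since the squared difference of two functions bounded by [m] is at most 2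
    m times its absolute value. The two errors of size e/4 are doubled by (a + b)^2 <= 2 a^2 + 2
    b^2. *)
Lemma L2_continuous_dense f (e : R) : L2 mu D f -> 0 < e ->
  exists2 c, continuous c /\ L2 mu D c & \int[mu]_(x in D) ((f x - c x) ^+ 2) <= e.
Proof.
move=> Lf e0; have [mf f2i] := Lf.
have cvg1 : \int[mu]_(x in D) ((f x - clamp n%:R (f x)) ^+ 2) @[n --> \oo] -->
    \int[mu]_(x in D) (cst 0 x).
  apply: (@dominated_cvg_Rintegral _ _ _ mu _ _ _ _ (fun x => f x ^+ 2)) => //.
  - move=> n; apply: measurable_funX; apply: measurable_funB => //.
    exact: measurable_clamp.
  - move=> x _; apply: cvg_near_cst; near=> n.
    rewrite clamp_id ?subrr ?expr0n//; near: n; exact: nbhs_infty_ger.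
  - by move=> n x _; rewrite ger0_norm ?sqr_ge0// ler_norm_sqr clamp_sub.
have e40 : 0 < e / 4 by lra.
have [m hm] : exists m : nat,
    \int[mu]_(x in D) ((f x - clamp m%:R (f x)) ^+ 2) <= e / 4.
  move: cvg1; rewrite Rintegral_cst// mul0r => /cvgr0Pnorm_le/(_ _ e40)[m _ h].
  by exists m; apply: le_trans (ler_norm _) (h m _) => /=.
pose fm x := clamp m%:R (f x).
have Lfm : L2 mu D fm.
  apply: (@L2_bounded _ _ _ mu _ _ _ m%:R) => //; first exact: mu_itv_lty.
  - exact: measurable_clamp.
  - by move=> x _; exact: clamp_le.
have [g_ [cg ig /fine_cvgP[gfin gcvg]]] := @approximation_continuous_integrable
  R D fm (measurable_itv _) (mu_itv_lty _ _ _ _) (L2D_Rintegrable Lfm).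
have d0 : 0 < e / 4 / (2 * m%:R + 1).
  by rewrite divr_gt0// ltr_wpDl// mulr_ge0.
have [j hj] : exists j : nat,
    \int[mu]_(x in D) `|fm x - g_ j x| <= e / 4 / (2 * m%:R + 1).
  move/cvgr0Pnorm_le: gcvg => /(_ _ d0)[j _ h].
  by exists j; apply: le_trans (ler_norm _) (h j _) => /=.
pose c x := clamp m%:R (g_ j x).
have cc : continuous c by exact: continuous_clamp.
have Lc : L2 mu D c.
  apply: (@L2_bounded _ _ _ mu _ _ _ m%:R) => //; first exact: mu_itv_lty.
  - exact: measurable_fun_continuous.
  - by move=> x _; exact: clamp_le.
exists c => //.
have i1 : Rintegrable mu D (fun x => (f x - fm x) ^+ 2).
  by have [] // : L2 mu D (fun x => f x - fm x) by apply: L2B.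
have i2 : Rintegrable mu D (fun x => (fm x - c x) ^+ 2).
  by have [] // : L2 mu D (fun x => fm x - c x) by apply: L2B.
have i3 : Rintegrable mu D (fun x => `|fm x - g_ j x|).
  have i30 : Rintegrable mu D (fun x => fm x - g_ j x).
    by apply: RintegrableB => //; [exact: L2D_Rintegrable|exact: ig].
  exact: (integrable_norm i30).
have h2 : \int[mu]_(x in D) ((fm x - c x) ^+ 2) <= e / 4.
  apply: (@le_trans _ _ ((2 * m%:R + 1) * \int[mu]_(x in D) `|fm x - g_ j x|)).
    rewrite -RintegralZl//; apply: le_Rintegral => //; first exact: RintegrableZ.
    move=> x _; rewrite -real_normK ?num_real// expr2.
    apply: ler_pM => //.
      apply: le_trans (ler_normB _ _) _.
      have := clamp_le (f x) (ler0n R m); have := clamp_le (g_ j x) (ler0n R m).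
      by rewrite -/(fm x) -/(c x); lra.
    have := clamp_lip (fm x) (g_ j x) (ler0n R m).
    by rewrite (clamp_id (ler0n R m) (clamp_le (f x) (ler0n R m))).
  by rewrite mulrC -ler_pdivlMr// ltr_wpDl// mulr_ge0.
apply: (@le_trans _ _ (\int[mu]_(x in D)
    (2 * (f x - fm x) ^+ 2 + 2 * (fm x - c x) ^+ 2))).
  apply: le_Rintegral => //.
  - by have [] // : L2 mu D (fun x => f x - c x) by apply: L2B.
  - by apply: RintegrableD => //; exact: RintegrableZ.
  move=> x _; rewrite -subr_ge0.
  by rewrite (_ : _ - _ = (f x - fm x - (fm x - c x)) ^+ 2) ?sqr_ge0//; ring.
rewrite (RintegralD _ (RintegrableZ _ _ i1) (RintegrableZ _ _ i2))//.
rewrite !RintegralZl//; move: hm h2; rewrite -/fm; lra.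
Unshelve. all: by end_near. Qed.

(** [L] times the squared L^2 distance from [f] to the span of the cosines of index at most [M].
    Clearing the denominators L and L/2 gives the coefficients 1 and 2. *)
Definition defect f (M : nat) : R :=
  L * (\int[mu]_(x in D) (f x ^+ 2)) - (\int[mu]_(x in D) f x) ^+ 2 -
  2 * \sum_(i < M) cos_coef x0 x1 f i.+1 ^+ 2.

Lemma defect_ge0 f M : L2 mu D f -> 0 <= defect f M.
Proof.
move=> Lf; have L0 := L_gt0 x01; have fi := L2D_Rintegrable Lf.
(* The constant function 1 has squared norm [L]; scaled by [s] it has [L / 2] like the other
   cosines, as [Bessel] requires. *)
pose s : R := Num.sqrt 2^-1; have s2 : s ^+ 2 = 2^-1 by rewrite sqr_sqrtr// invr_ge0.
pose e n : R -> R := if n is n'.+1 then ec n'.+1 else cst s.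
have Le n : L2 mu D (e n).
  case: n => [|n] /=; last exact: L2_ecos.
  by apply: L2_cst => //; exact: mu_itv_lty.
have eci n := L2D_Rintegrable (L2_ecos x0 x1 n).
have orth m n : \int[mu]_(x in D) (e m x * e n x) = (L / 2) *+ (m == n).
  case: m => [|m]; case: n => [|n] /=.
  - rewrite Rintegral_itv_cst ?ltW// -expr2 s2 mulr1n; ring.
  - by rewrite (RintegralZl _ _ (eci n.+1))// (Rintegral_ecos x01)// mulr0.
  - by rewrite (RintegralZr _ _ (eci m.+1))// (Rintegral_ecos x01)// mul0r.
  - by rewrite ecos_orthogonal.
have L20 : 0 < L / 2 by rewrite divr_gt0.
have := Bessel L20 Le Lf orth M.+1.
rewrite big_ord_recl /= RintegralZr// exprMn s2.
rewrite /defect /cos_coef /bump/=; lra.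
Qed.

Lemma defect_le f M : defect f M <= L * (\int[mu]_(x in D) (f x ^+ 2)).
Proof.
rewrite /defect -addrA gerDl -opprD oppr_le0 addr_ge0 ?sqr_ge0// mulr_ge0//.
by apply: sumr_ge0 => i _; exact: sqr_ge0.
Qed.

Lemma defect_decr f M N : (M <= N)%N -> defect f N <= defect f M.
Proof.
move=> MN; rewrite /defect lerD2l lerN2 ler_wpM2l//.
rewrite -(subnKC MN) big_split_ord/= lerDl.
by apply: sumr_ge0 => i _; exact: sqr_ge0.
Qed.

(** [defect] is a nonnegative quadratic form, so the parallelogram identity for f = c + g and h = c
    - g yields the bound once the term of [h] is discarded. *)
Lemma defectD f c M : L2 mu D f -> L2 mu D c ->
  defect f M <= 2 * defect c M + 2 * defect (fun x => f x - c x) M.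
Proof.
move=> Lf Lc; pose g x := f x - c x; pose h x := 2 * c x - f x.
have Lh : L2 mu D h by apply: L2B => //; exact: L2Z.
have Lg : L2 mu D g by apply: L2B.
have fi := L2D_Rintegrable Lf; have ci := L2D_Rintegrable Lc.
have := defect_ge0 M Lh.
suff -> : defect h M = 2 * defect c M + 2 * defect g M - defect f M by lra.
have lin n : cos_coef x0 x1 g n = cos_coef x0 x1 f n - cos_coef x0 x1 c n.
  rewrite /cos_coef -(RintegralB _ (Rintegrable_ec n fi) (Rintegrable_ec n ci))//.
  by apply: eq_Rintegral => x _; rewrite /g mulrBl.
have linh n : cos_coef x0 x1 h n = 2 * cos_coef x0 x1 c n - cos_coef x0 x1 f n.
  have ic := Rintegrable_ec n ci.
  rewrite /cos_coef -(RintegralZl _ _ ic)// -(RintegralB _ (RintegrableZ _ _ ic) (Rintegrable_ec n fi))//.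
  by apply: eq_Rintegral => x _; rewrite /h; ring.
have ling : \int[mu]_(x in D) g x = \int[mu]_(x in D) f x - \int[mu]_(x in D) c x.
  by rewrite -(RintegralB _ fi ci).
have linh0 : \int[mu]_(x in D) h x = 2 * (\int[mu]_(x in D) c x) - \int[mu]_(x in D) f x.
  by rewrite -(RintegralZl _ _ ci)// -(RintegralB _ (RintegrableZ _ _ ci) fi).
have sqr : \int[mu]_(x in D) (h x ^+ 2) = 2 * (\int[mu]_(x in D) (c x ^+ 2)) +
    2 * (\int[mu]_(x in D) (g x ^+ 2)) - \int[mu]_(x in D) (f x ^+ 2).
  have i1 := Lc.2; have i2 := Lg.2; have i3 := Lf.2.
  rewrite -(RintegralZl _ _ i1)// -(RintegralZl _ _ i2)//.
  rewrite -(RintegralD _ (RintegrableZ _ _ i1) (RintegrableZ _ _ i2))//.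
  rewrite -(RintegralB _ (RintegrableD _ (RintegrableZ _ _ i1) (RintegrableZ _ _ i2)) i3)//.
  by apply: eq_Rintegral => x _; rewrite /h /g; ring.
have sums : \sum_(i < M) cos_coef x0 x1 h i.+1 ^+ 2 =
    2 * \sum_(i < M) cos_coef x0 x1 c i.+1 ^+ 2 +
    2 * \sum_(i < M) cos_coef x0 x1 g i.+1 ^+ 2 -
    \sum_(i < M) cos_coef x0 x1 f i.+1 ^+ 2.
  rewrite !mulr_sumr -big_split -sumrB/=; apply: eq_bigr => i _.
  by rewrite lin linh; ring.
by rewrite /defect sqr sums ling linh0; ring.
Qed.

(** Korovkin: the Poisson form of [c] dominates 4 times its defect, and by [oscillation_dominated]
    it is bounded through the form of the single function [ec 1], which is explicit and small when r
    is close to 1. *)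
Lemma defect_continuous c (e : R) : continuous c -> L2 mu D c -> 0 < e ->
  exists M, defect c M <= e.
Proof.
move=> cc Lc e0; have L0 := L_gt0 x01; have L20 : 0 < L ^+ 2 by rewrite exprn_gt0.
pose e1 := e / 2 / (L ^+ 2); have e10 : 0 < e1 by rewrite !divr_gt0.
have [n Hn] := oscillation_dominated cc e10.
(* This makes [n * (1 - r)] at most [e1], and [M] will make [(e1 + n) * er] at most [e1]. The form
   of [c] is then at most 5 e1 L^2, and 5/4 e1 L^2 is below e = 2 e1 L^2. *)
pose r : R := 1 - e1 / (e1 + n%:R + 1).
have den0 : 0 < e1 + n%:R + 1 by rewrite addr_gt0// ltr_wpDr.
have r1 : r < 1 by rewrite /r ltrBlDr ltrDl divr_gt0.
have r0 : 0 < r.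
  rewrite subr_gt0 ltr_pdivrMr// mul1r -addrA ltrDl ltr_wpDl//.
have nr : n%:R * (1 - r) <= e1.
  rewrite /r opprB addrC subrK mulrA ler_pdivrMr// mulrC ler_wpM2l ?(ltW e10)//.
  by rewrite -addrA [e1 + _]addrC -addrA lerDl addr_ge0// ltW.
have m0 : 0 < e1 / (e1 + n%:R + 1) by rewrite divr_gt0.
have [M0 _ HM] := pois_err_small r0 r1 m0.
(* At least one term is kept, so that the truncated kernel sees [ec 1] itself. *)
pose M := (maxn M0 1)%N; pose er := pois_err r M.
have er1 : er <= e1 / (e1 + n%:R + 1) by apply: HM; exact: leq_maxl.
have er0 : 0 <= er by exact: pois_err_ge0.
have ner : (e1 + n%:R) * er <= e1.
  apply: le_trans (ler_wpM2l _ er1) _; first by rewrite addr_ge0// ltW.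
  rewrite mulrCA ler_piMr ?(ltW e10)// ler_pdivrMr// mul1r lerDl//.
have kge0 x y : D x -> D y -> 0 <= kern x0 x1 (2 + er) (fun i => 4 * r ^+ i.+1) M x y.
  by move=> _ _; exact: pois_kern_ge0.
have := kern_form_le x01 Lc (L2_ecos x0 x1 1) (ltW e10) (ler0n R n) kge0 Hn.
have -> : kern_form x0 x1 (2 + er) (fun i => 4 * r ^+ i.+1) M (ec 1) =
    L ^+ 2 * (2 * (1 - r) + er).
  rewrite /kern_form Rintegral_ecos// expr0n subr0.
  have -> : \int[mu]_(x in D) (ec 1 x ^+ 2) = L / 2.
    by rewrite -[RHS]mulr1n -(@ecos_orthogonal _ _ _ x01 1 1 isT).
  have -> : \sum_(i < M) 4 * r ^+ i.+1 * cos_coef x0 x1 (ec 1) i.+1 ^+ 2 =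
      4 * r * (L / 2) ^+ 2.
    have M1 : (0 < M)%N by rewrite /M leq_max orbT.
    rewrite -(prednK M1) big_ord_recl big1 ?addr0 => [|i _].
      by rewrite /cos_coef ecos_orthogonal// expr1 mulr1n.
    by rewrite /cos_coef ecos_orthogonal//= mulr0n expr0n mulr0.
  by field.
have : 4 * defect c M <= kern_form x0 x1 (2 + er) (fun i => 4 * r ^+ i.+1) M c.
  have d0 := defect_ge0 0 Lc; move: d0; rewrite /defect big_ord0 mulr0 subr0.
  rewrite /kern_form; set V := L * _ - _ => V0.
  have S : \sum_(i < M) 4 * r ^+ i.+1 * cos_coef x0 x1 c i.+1 ^+ 2 <=
      4 * \sum_(i < M) cos_coef x0 x1 c i.+1 ^+ 2.
    rewrite mulr_sumr; apply: ler_sum => i _; rewrite ler_wpM2r ?sqr_ge0//.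
    by rewrite ler_piMr// exprn_ile1 ?(ltW r0) ?(ltW r1).
  have := mulr_ge0 er0 V0; lra.
move=> H1 H2; exists M.
have e1E : e = 2 * (e1 * L ^+ 2) by rewrite /e1 divfK ?gt_eqF//; field.
have := ler_wpM2l (ltW L20) nr; have := ler_wpM2l (ltW L20) ner.
have := mulr_gt0 e10 L20; rewrite e1E; move: H1 H2; move: (L ^+ 2) (defect c M) (kern_form _ _ _ _ _ _) => l2 df kf.
lra.
Qed.

Lemma Parseval f (e : R) : L2 mu D f -> 0 < e ->
  exists M, forall N, (M <= N)%N -> defect f N <= e.
Proof.
move=> Lf e0; have L0 := L_gt0 x01.
have e4 : 0 < e / 4 by lra.
have [c [cc Lc] fc] := L2_continuous_dense Lf (divr_gt0 e4 L0).
have [M HM] := defect_continuous cc Lc e4.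
exists M => N MN; apply: le_trans (defect_decr f MN) _.
apply: le_trans (defectD M Lf Lc) _.
have := defect_le (fun x => f x - c x) M.
have : L * \int[mu]_(x in D) (f x - c x) ^+ 2 <= e / 4.
  by rewrite mulrC -ler_pdivlMr.
lra.
Qed.

End Parseval.

(** * Monotonicity and measurability tools for iterated integrals *)

Section IntegralExtras.
Context {R : realType}.
Local Open Scope ereal_scope.

(** The integral of a nonnegative function is a supremum over the simple functions below it, hence
    monotone without measurability. This spares measurability proofs for inner integrals. *)
Lemma ge0_le_integral_nomeas d (T : measurableType d)
    (mu : {measure set T -> \bar R}) (D : set T) (f g : T -> \bar R) :
  (forall x, D x -> 0 <= f x) -> (forall x, D x -> f x <= g x) ->
  \int[mu]_(x in D) f x <= \int[mu]_(x in D) g x.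
Proof.
move=> f0 fg; rewrite !ge0_integralE//; last first.
  by move=> x Dx; exact: le_trans (f0 x Dx) (fg x Dx).
apply: ge_ereal_sup => _ [h hf <-]; apply: ereal_sup_ubound.
exists h => // x; apply: le_trans (hf x) _; rewrite !patchE.
by case: ifPn => // /set_mem; exact: fg.
Qed.

Lemma measurable_section_integral d (T : measurableType d)
    (D : set (measurableTypeR R)) (F : T * measurableTypeR R -> \bar R) :
  measurable D -> measurable_fun setT F -> (forall p, 0 <= F p) ->
  measurable_fun setT (fun t => \int[@lebesgue_measure R]_(y in D) F (t, y)).
Proof.
move=> mD mF F0; pose G (p : T * measurableTypeR R) := F p * (\1_D p.2)%:E.
have mG : measurable_fun setT G.
  apply: emeasurable_funM => //; apply/measurable_EFinP.
  by apply: measurableT_comp; [exact: measurable_indic|exact: measurable_snd].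
have := @measurable_fun_fubini_tonelli_F _ _ _ _ R (@lebesgue_measure R) G mG.
rewrite /fubini_F => H.
have -> : (fun t => \int[@lebesgue_measure R]_(y in D) F (t, y)) =
    (fun t => \int[@lebesgue_measure R]_y G (t, y)).
  apply/funext => t; rewrite integral_mkcond; apply: eq_integral => y _.
  by rewrite patchE /G /= indicE; case: (y \in D); rewrite ?mule1 ?mule0.
by apply: H => p; rewrite mule_ge0// lee_fin.
Qed.

End IntegralExtras.

Section MeasurableInverse.
Variable R : realType.

Lemma measurable_invD (e : R) : 0 < e ->
  measurable_fun setT (fun t : R => (e + t ^+ 2)^-1).
Proof.
move=> e0; have g0 t : e + t ^+ 2 != 0 by rewrite gt_eqF// ltr_pwDl ?sqr_ge0.
have cg : continuous (fun t : R => e + t ^+ 2).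
  by move=> t; apply: cvgD; [exact: cvg_cst|exact: exprn_continuous].
by apply: continuous_measurable_fun => t; apply: cvgV; [exact: g0|exact: cg].
Qed.

(** The inverse is discontinuous at 0. It is the pointwise limit of the continuous functions x /
    (1/(n+1) + x^2), whose value 0 at 0 agrees with the convention that 0 has inverse 0. *)
Lemma measurable_inv : measurable_fun setT (fun x : R => x^-1).
Proof.
apply: (@measurable_fun_cvg _ _ _ _ (fun n (x : R) => x * (n.+1%:R^-1 + x ^+ 2)^-1)).
  move=> n; apply: measurable_funM => //.
  by apply: measurable_invD; rewrite invr_gt0.
move=> x _; have [->|x0] := eqVneq x 0.
  rewrite invr0 (_ : (fun _ => _) = cst 0); first exact: cvg_cst.
  by apply/funext => n; rewrite mul0r.
rewrite (_ : x^-1 = x * (0 + x ^+ 2)^-1); last by rewrite add0r; field.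
apply: cvgM; first exact: cvg_cst.
apply: cvgV; first by rewrite add0r sqrf_eq0.
by apply: cvgD; [exact: cvg_harmonic|exact: cvg_cst].
Qed.

End MeasurableInverse.

(** * The Slobodeckij seminorm bounded by cosine coefficients *)

Section HalfSeminorm.
Variable R : realType.
Notation mu := (@lebesgue_measure R).
Variables x0 x1 : R.
Hypothesis x01 : x0 < x1.
Notation D := (`]x0, x1[%classic : set R).
Notation L := (x1 - x0).
Variable f : R -> R.
Hypotheses (mf : measurable_fun setT f) (Lf : L2 mu D f).
Notation a := (cos_coef x0 x1 f).
Notation w := (freq x0 x1).

Lemma Bernoulli_le (r : R) n : 0 <= r -> r <= 1 -> 1 - r ^+ n <= n%:R * (1 - r).
Proof.
move=> r0 r1; elim: n => [|n IH]; first by rewrite expr0 subrr mul0r.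
rewrite exprS -natr1 mulrDl mul1r.
have rn : r ^+ n <= 1 by rewrite exprn_ile1.
have := mulr_ge0 (_ : 0 <= 1 - r) (_ : 0 <= 1 - r ^+ n).
by rewrite !subr_ge0 r1 rn => /(_ isT isT); lra.
Qed.

(** With r = 1 - s, the form is the sum of 8 (1 - r^n) a_n^2 plus 4 times the defect and twice
    [pois_err] times the variance [V]. Bernoulli bounds 1 - r^n by n s, and a large [M] makes each
    of the two remainders at most eta/2. *)
Lemma kern_form_bound (A s eta : R) : 0 < s -> s < 1 -> 0 < eta ->
  (forall M, \sum_(i < M) i.+1%:R * a i.+1 ^+ 2 <= A) ->
  exists M, kern_form x0 x1 (2 + pois_err (1 - s) M)
    (fun i => 4 * (1 - s) ^+ i.+1) M f <= 8 * s * A + eta.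
Proof.
move=> s0 s1 eta0 hA; pose r := 1 - s.
have r0 : 0 < r by rewrite /r; lra.
have r1 : r < 1 by rewrite /r; lra.
have V0 := defect_ge0 x01 0 Lf; move: V0.
pose V := L * (\int[mu]_(x in D) (f x ^+ 2)) - (\int[mu]_(x in D) f x) ^+ 2.
rewrite /defect big_ord0 mulr0 subr0 -/V => V0.
have e80 : 0 < eta / 8 by lra.
have [M1 HM1] := Parseval x01 Lf e80.
have d0 : 0 < eta / (4 * (V + 1)) by rewrite divr_gt0// mulr_gt0// ltr_wpDl.
have [M2 _ HM2] := pois_err_small r0 r1 d0.
pose M := maxn M1 M2; exists M.
have h1 := HM1 M (leq_maxl _ _).
have h2 : pois_err r M <= eta / (4 * (V + 1)) by apply: HM2; exact: leq_maxr.
have h3 : pois_err r M * V <= eta / 4.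
  apply: (@le_trans _ _ (eta / (4 * (V + 1)) * (V + 1))).
    by apply: ler_pM => //; [exact: pois_err_ge0|rewrite lerDl].
  by rewrite le_eqVlt; apply/orP; left; apply/eqP; field; lra.
have S : \sum_(i < M) a i.+1 ^+ 2 - \sum_(i < M) r ^+ i.+1 * a i.+1 ^+ 2 <= s * A.
  apply: (@le_trans _ _ (s * \sum_(i < M) i.+1%:R * a i.+1 ^+ 2)); last first.
    by rewrite ler_wpM2l// ltW.
  rewrite -sumrB mulr_sumr; apply: ler_sum => i _.
  rewrite -{1}[a i.+1 ^+ 2]mul1r -mulrBl mulrA ler_wpM2r ?sqr_ge0//.
  have := Bernoulli_le i.+1 (ltW r0) (ltW r1).
  by rewrite (_ : 1 - r = s) 1?mulrC// /r; ring.
move: h1; rewrite /defect -/V /kern_form -/V -/r.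
have -> : \sum_(i < M) 4 * r ^+ i.+1 * a i.+1 ^+ 2 =
    4 * \sum_(i < M) r ^+ i.+1 * a i.+1 ^+ 2.
  by rewrite mulr_sumr; apply: eq_bigr => i _; rewrite mulrA.
move: h3 S; move: (\sum_(i < M) a i.+1 ^+ 2) (\sum_(i < M) r ^+ i.+1 * a i.+1 ^+ 2).
move: (pois_err r M) => er S1 S2; lra.
Qed.

(** For r = 1 - s the Poisson kernel at angle t is at least s / (s^2 + t^2), because 1 - r^2 = s (1
    + r) >= s. Dividing the bound 8 s A on its form by s gives a constant independent of s. *)
Lemma regularized_seminorm (A s : R) : 0 < s -> s < 1 ->
  (forall M, \sum_(i < M) i.+1%:R * a i.+1 ^+ 2 <= A) ->
  (\int[mu]_(x in D) \int[mu]_(y in D)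
     ((f x - f y) ^+ 2 / (s ^+ 2 + (w * (x - y)) ^+ 2))%:E <= (8 * A)%:E)%E.
Proof.
move=> s0 s1 hA; apply/lee_addgt0Pr => eta eta0.
have [M HM] := kern_form_bound s0 s1 (mulr_gt0 s0 eta0) hA.
pose r := 1 - s; have r0 : 0 < r by rewrite /r; lra.
have r1 : r < 1 by rewrite /r; lra.
have rs : 1 - r = s by rewrite /r; ring.
have ptw x y : s * ((f x - f y) ^+ 2 / (s ^+ 2 + (w * (x - y)) ^+ 2)) <=
    (f x - f y) ^+ 2 * pois_kern x0 x1 r M x y.
  rewrite mulrCA ler_wpM2l ?sqr_ge0//.
  apply: le_trans (pois_kern_ge _ _ M x y r0 r1).
  set t := w * (x - y).
  have d0 : 0 < poisson_den r t.
    apply: lt_le_trans (poisson_den_ge t (ltW r0)).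
    by rewrite exprn_gt0// subr_gt0.
  have d1 := poisson_den_le t (ltW r0) (ltW r1); rewrite rs in d1.
  have t0 : 0 < s ^+ 2 + t ^+ 2 by exact: lt_le_trans d1.
  rewrite (_ : 1 - r ^+ 2 = (1 - r) * (1 + r)); last by ring.
  rewrite rs -mulrA ler_wpM2l ?(ltW s0)//.
  rewrite -[leLHS]mul1r ler_pM ?invr_ge0 ?(ltW t0)//; first by lra.
  by rewrite lef_pV2 ?posrE.
have inner x : (\int[mu]_(y in D)
     ((f x - f y) ^+ 2 / (s ^+ 2 + (w * (x - y)) ^+ 2))%:E <=
   (s^-1 * kern_inner x0 x1 (2 + pois_err r M) (fun i => 4 * r ^+ i.+1) M f x)%:E)%E.
  have i1 := Rintegrable_sqrB_kern (2 + pois_err r M) (fun i => 4 * r ^+ i.+1) M x Lf.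
  rewrite -(Rintegral_sqrB_kern x01 _ _ _ _ Lf) -(RintegralZl _ _ i1)//.
  rewrite -Rintegrable_fineK//; last exact: RintegrableZ.
  apply: ge0_le_integral_nomeas => y _; rewrite lee_fin.
    by rewrite divr_ge0 ?sqr_ge0// addr_ge0 ?sqr_ge0.
  by rewrite ler_pdivlMl// ptw.
have i2 := Rintegrable_kern_inner (2 + pois_err r M) (fun i => 4 * r ^+ i.+1) M Lf.
apply: (@le_trans _ _ (\int[mu]_(x in D) (s^-1 * kern_inner x0 x1
    (2 + pois_err r M) (fun i => 4 * r ^+ i.+1) M f x)%:E)%E).
  apply: ge0_le_integral_nomeas => x _; last exact: inner.
  apply: integral_ge0 => y _; rewrite lee_fin.
  by rewrite divr_ge0 ?sqr_ge0// addr_ge0 ?sqr_ge0.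
rewrite Rintegrable_fineK//; last exact: RintegrableZ.
rewrite RintegralZl// Rintegral_kern_inner// -EFinD lee_fin.
by rewrite mulrC ler_pdivrMr// (le_trans HM)// -/r; lra.
Qed.

(** Let s decrease to 0 along 1/(m+2), which stays below 1. The regularized quotients increase, so
    monotone convergence applies to both integrals. On the diagonal they are 0, and so is the limit
    because 0 has inverse 0. *)
Lemma seminorm_le_real (A : R) :
  (forall M, \sum_(i < M) i.+1%:R * a i.+1 ^+ 2 <= A) ->
  (\int[mu]_(x in D) \int[mu]_(y in D)
     ((f x - f y) ^+ 2 / (x - y) ^+ 2)%:E <= (8 * w ^+ 2 * A)%:E)%E.
Proof.
move=> hA; have w0 := freq_gt0 x01; have w20 : 0 < w ^+ 2 by rewrite exprn_gt0.
pose s m : R := m.+2%:R^-1.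
have s0 m : 0 < s m by rewrite invr_gt0.
have s1 m : s m < 1 by rewrite /s invf_lt1 ?ltr1n.
have s_0 : s m @[m --> \oo] --> (0 : R).
  apply/cvgrPdist_lt => e e0; apply: filterS (near_inv_lt e0) => m h.
  rewrite sub0r normrN gtr0_norm ?s0//; apply: le_lt_trans h.
  by rewrite /s lef_pV2 ?posrE ?ltr0n// ler_nat.
have mDD : measurable (D : set (measurableTypeR R)) by exact: measurable_itv.
have den0 m t : 0 < s m ^+ 2 + (w * t) ^+ 2.
  by rewrite ltr_pwDl ?sqr_ge0// exprn_gt0.
pose F m (p : R * R) : \bar R :=
  ((f p.1 - f p.2) ^+ 2 / (s m ^+ 2 + (w * (p.1 - p.2)) ^+ 2))%:E.
have F0 m p : (0 <= F m p)%E.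
  by rewrite lee_fin divr_ge0 ?sqr_ge0// ltW// den0.
have mF m : measurable_fun setT
    (F m : measurableTypeR R * measurableTypeR R -> \bar R).
  have m1 : measurable_fun setT (fst : measurableTypeR R * measurableTypeR R -> _).
    exact: measurable_fst.
  have m2 : measurable_fun setT (snd : measurableTypeR R * measurableTypeR R -> _).
    exact: measurable_snd.
  apply/measurable_EFinP; apply: measurable_funM.
    apply: measurable_funX; apply: measurable_funB.
      by apply: measurableT_comp; [exact: mf|].
    by apply: measurableT_comp; [exact: mf|].
  have sm0 : 0 < s m ^+ 2 by rewrite exprn_gt0.
  apply: (measurableT_comp (measurable_invD sm0)).
  by apply: measurable_funM => //; exact: measurable_funB.
have ndF x y : nondecreasing_seq (fun m => F m (x, y)).
  move=> m n mn; rewrite lee_fin ler_wpM2l ?sqr_ge0//.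
  rewrite lef_pV2 ?posrE ?den0// lerD2r ler_sqr ?nnegrE ?(ltW (s0 _))//.
  by rewrite lef_pV2 ?posrE ?ltr0n// ler_nat !ltnS.
pose G (x y : R) : \bar R := ((w ^+ 2)^-1 * ((f x - f y) ^+ 2 / (x - y) ^+ 2))%:E.
have cvF x y : F m (x, y) @[m --> \oo] --> G x y.
  pose Fr m : R := (f x - f y) ^+ 2 / (s m ^+ 2 + (w * (x - y)) ^+ 2).
  suff cFr : Fr m @[m --> \oo] --> (w ^+ 2)^-1 * ((f x - f y) ^+ 2 / (x - y) ^+ 2).
    by apply: cvg_EFin; [exact: nearW|exact: cFr].
  have [xy|xy] := eqVneq x y.
    rewrite (_ : Fr = cst 0); last first.
      by apply/funext => m /=; rewrite /Fr xy subrr expr0n mul0r.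
    by rewrite xy subrr expr0n mul0r mulr0; exact: cvg_cst.
  have xyN0 : x - y != 0 by rewrite subr_eq0.
  have wN0 : w != 0 by rewrite gt_eqF.
  have xy0 : (w * (x - y)) ^+ 2 != 0 by rewrite sqrf_eq0 mulf_neq0.
  have -> : (w ^+ 2)^-1 * ((f x - f y) ^+ 2 / (x - y) ^+ 2) =
      (f x - f y) ^+ 2 / (0 ^+ 2 + (w * (x - y)) ^+ 2).
    by rewrite expr0n /= add0r; field; rewrite xyN0.
  rewrite /Fr; apply: cvgM; first exact: cvg_cst.
  apply: cvgV; first by rewrite expr0n add0r.
  apply: cvgD; last exact: cvg_cst.
  apply: (@cvg_comp _ _ _ s (fun t => t ^+ 2) _ (nbhs 0)); last exact: exprn_continuous.
  exact: s_0.
have mFy m x : measurable_fun D (fun y => F m (x, y)).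
  apply: measurable_funTS.
  by apply: (measurableT_comp (mF m)); exact: measurable_pair1.
have limI x : (\int[mu]_(y in D) G x y =
    limn (fun m => \int[mu]_(y in D) F m (x, y)))%E.
  rewrite -(monotone_convergence mu mDD (mFy ^~ x) (fun m y _ => F0 m (x, y))
    (fun y _ => ndF x y)).
  by apply: eq_integral => y _; apply/esym/cvg_lim => //; exact: cvF.
have mI m : measurable_fun D (fun x => \int[mu]_(y in D) F m (x, y))%E.
  by apply: measurable_funTS; exact: (measurable_section_integral mDD (mF m) (F0 m)).
have ndI x : nondecreasing_seq (fun m => \int[mu]_(y in D) F m (x, y))%E.
  by move=> m n mn; apply: ge0_le_integral_nomeas => // y _; exact: ndF.
have I0 m x : (0 <= \int[mu]_(y in D) F m (x, y))%E by apply: integral_ge0.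
have main : (\int[mu]_(x in D) \int[mu]_(y in D) G x y <= (8 * A)%:E)%E.
  under eq_integral do rewrite limI.
  rewrite (monotone_convergence mu mDD mI (fun m x _ => I0 m x) (fun x _ => ndI x)).
  apply: lime_le.
    apply: ereal_nondecreasing_is_cvgn => m n mn.
    by apply: ge0_le_integral_nomeas => // x _; exact: ndI.
  by apply: nearW => m; exact: regularized_seminorm.
have W0 : (0 <= (w ^+ 2)%:E)%E by rewrite lee_fin ltW.
rewrite (_ : 8 * w ^+ 2 * A = w ^+ 2 * (8 * A)); last by ring.
rewrite EFinM; apply: le_trans (lee_wpmul2l W0 main).
apply: (@le_trans _ _ (\int[mu]_(x in D) ((w ^+ 2)%:E * \int[mu]_(y in D) G x y))%E); last first.
  rewrite ge0_integralZl//.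
    apply: (emeasurable_fun_cvg (fun m x => \int[mu]_(y in D) F m (x, y))%E) => //.
    by move=> x _; rewrite limI; exact: ereal_nondecreasing_is_cvgn (ndI x).
  by move=> x _; apply: integral_ge0 => y _; rewrite lee_fin mulr_ge0 ?invr_ge0 ?(ltW w20)// divr_ge0 ?sqr_ge0.
apply: ge0_le_integral_nomeas => x _.
  by apply: integral_ge0 => y _; rewrite lee_fin divr_ge0 ?sqr_ge0.
rewrite -ge0_integralZl//.
- apply: ge0_le_integral_nomeas => y _; first by rewrite lee_fin divr_ge0 ?sqr_ge0.
  by rewrite -EFinM lee_fin mulrA divff ?mul1r// gt_eqF.
- have := emeasurable_fun_cvg (fun m y => F m (x, y)) (G x) (mFy ^~ x); apply.
  by move=> y _; exact: cvF.
- by move=> y _; rewrite lee_fin mulr_ge0 ?invr_ge0 ?(ltW w20)// divr_ge0 ?sqr_ge0.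
Qed.

(** The sum is taken in the extended reals because for a single slice in z its finiteness is not
    known beforehand; only the integral over z is bounded. *)
Lemma seminorm_le :
  (\int[mu]_(x in D) \int[mu]_(y in D) ((f x - f y) ^+ 2 / (x - y) ^+ 2)%:E <=
   (8 * w ^+ 2)%:E * \sum_(0 <= n <oo) (n.+1%:R * a n.+1 ^+ 2)%:E)%E.
Proof.
have w0 := freq_gt0 x01; have w20 : 0 < w ^+ 2 by rewrite exprn_gt0.
have t0 n : (0 <= (n.+1%:R * a n.+1 ^+ 2)%:E)%E.
  by rewrite lee_fin mulr_ge0 ?sqr_ge0.
set S := (\sum_(0 <= n <oo) _)%E.
have S0 : (0 <= S)%E by apply: nneseries_ge0 => n _ _; exact: t0.
have [Sy|Sy] := eqVneq S +oo%E.
  by rewrite Sy gt0_muley ?leey// lte_fin mulr_gt0.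
have Sfin : S \is a fin_num by rewrite ge0_fin_numE// ltey.
rewrite -(fineK Sfin) -EFinM; apply: seminorm_le_real => M.
rewrite -lee_fin fineK// -sumEFin.
rewrite -(big_mkord xpredT (fun i => (i.+1%:R * a i.+1 ^+ 2)%:E)).
by apply: nneseries_lim_ge => n _ _; exact: t0.
Qed.

End HalfSeminorm.

(** * Sections at fixed z and coefficients as functions of z *)

Section Sections.
Variable R : realType.
Notation mu := (@lebesgue_measure R).
Notation mu2 := (@lebesgue_measure R \x @lebesgue_measure R)%E.
Variables x0 x1 : R.
Hypothesis x01 : x0 < x1.
Notation D := (`]x0, x1[%classic : set R).
Notation I := (`]-1, 1[%classic : set R).
Notation Om := (Omega x0 x1).
Notation RR := (measurableTypeR R * measurableTypeR R)%type.
Implicit Types F : R * R -> R.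

Lemma OmegaE : Om = D `*` I.
Proof. by apply/seteqP; split=> -[x z] /=; rewrite !in_itv. Qed.

Lemma measurable_Omega : measurable (Om : set RR).
Proof. by rewrite OmegaE; apply: measurableX; exact: measurable_itv. Qed.

Lemma mu2_Omega_lty : (mu2 (Om : set RR) < +oo)%E.
Proof.
rewrite OmegaE product_measure1E; [|exact: measurable_itv|exact: measurable_itv].
by apply: lte_mul_pinfty; rewrite ?ge0_fin_numE ?measure_ge0//; exact: mu_itv_lty.
Qed.

(** Extension by zero is measurable on the whole plane, so the sections are measurable for every [z]
    and the product theorems apply without restriction. *)
Definition ext F : R * R -> R := F \_ Om.

Lemma ext_in F x z : D x -> I z -> ext F (x, z) = F (x, z).
Proof. by move=> Dx Iz; rewrite /ext patchE mem_set// OmegaE. Qed.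

Lemma ext_outx F x z : ~ D x -> ext F (x, z) = 0.
Proof. by move=> Dx; rewrite /ext patchE memNset// OmegaE => -[]. Qed.

Lemma ext_outz F x z : ~ I z -> ext F (x, z) = 0.
Proof. by move=> Iz; rewrite /ext patchE memNset// OmegaE => -[]. Qed.

Lemma integral_supp (A : set R) (G : R -> \bar R) :
  (forall x, ~ A x -> G x = 0%E) ->
  (\int[mu]_x G x = \int[mu]_(x in A) G x)%E.
Proof.
move=> G0; rewrite [RHS]integral_mkcond; apply: eq_integral => x _.
by rewrite patchE; case: ifPn => // /negP xA; rewrite G0// => /mem_set.
Qed.

Section OneFunction.
Variable F : R * R -> R.
Hypothesis LF : L2 mu2 (Om : set RR) F.

Lemma measurable_ext : measurable_fun setT (ext F : RR -> R).
Proof.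
apply/(measurable_restrictT _ _).1; first exact: measurable_Omega.
by case: LF.
Qed.

Lemma measurable_section z : measurable_fun setT (fun x : R => ext F (x, z)).
Proof. by apply: (measurableT_comp measurable_ext); exact: measurable_pair2. Qed.

Let mS z : measurable_fun D (fun x : R => ext F (x, z)).
Proof. by apply: measurable_funTS; exact: measurable_section. Qed.

Lemma measurable_section_sqr :
  measurable_fun setT (fun z : R => \int[mu]_(x in D) (ext F (x, z) ^+ 2)%:E)%E.
Proof.
pose G (p : RR) : \bar R := (ext F (p.2, p.1) ^+ 2)%:E.
apply: (@measurable_section_integral _ _ _ _ G); first exact: measurable_itv.
  apply/measurable_EFinP; apply: measurable_funX.
  apply: (measurableT_comp measurable_ext); exact: measurable_swap.
by move=> p; rewrite lee_fin sqr_ge0.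
Qed.

Lemma sqr_tonelli : (\int[mu]_(z in I) \int[mu]_(x in D) (ext F (x, z) ^+ 2)%:E =
  \int[mu2]_(p in Om) (F p ^+ 2)%:E)%E.
Proof.
pose G (p : RR) : \bar R := (ext F p ^+ 2)%:E.
have mG : measurable_fun setT G.
  by apply/measurable_EFinP; apply: measurable_funX; exact: measurable_ext.
have G0 p : (0 <= G p)%E by rewrite lee_fin sqr_ge0.
have -> : (\int[mu2]_(p in Om) (F p ^+ 2)%:E = \int[mu2]_p G p)%E.
  rewrite integral_mkcond; apply: eq_integral => p _.
  by rewrite /G /ext !patchE; case: ifP => // _; rewrite expr0n.
rewrite (fubini_tonelli2 G mG G0) /fubini_G.
rewrite [RHS](@integral_supp I); last first.
  move=> z Iz; rewrite integral0_eq// => x _.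
  by rewrite /G ext_outz// expr0n.
apply: eq_integral => z _; apply/esym/integral_supp => x Dx.
by rewrite /G ext_outx// expr0n.
Qed.

Lemma sqr_tonelli_lty :
  (\int[mu]_(z in I) \int[mu]_(x in D) (ext F (x, z) ^+ 2)%:E < +oo)%E.
Proof. by rewrite sqr_tonelli; exact: (L2_lty measurable_Omega LF). Qed.

Lemma ae_section_L2 : {ae mu, forall z, I z -> L2 mu D (fun x => ext F (x, z))}.
Proof.
have i : mu.-integrable I (fun z => \int[mu]_(x in D) (ext F (x, z) ^+ 2)%:E)%E.
  apply/integrableP; split.
    by apply: measurable_funTS; exact: measurable_section_sqr.
  apply: le_lt_trans sqr_tonelli_lty; rewrite le_eqVlt; apply/orP; left.
  apply/eqP; apply: eq_integral => z _; rewrite gee0_abs//.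
  by apply: integral_ge0 => x _; rewrite lee_fin sqr_ge0.
have mI : measurable (I : set (measurableTypeR R)) by exact: measurable_itv.
have := integrable_ae mI i.
apply: ae_mono => z zf Iz; apply: L2P => //; first exact: mS.
by rewrite ltey_eq zf.
Qed.

Variable q : R -> R.
Hypotheses (mq : measurable_fun setT q) (q1 : forall x, `|q x| <= 1).

(** Defined for every [z]; on the null set where the section is not square integrable it may be a
    default value of [Rintegral], which does not affect the integrals in [z]. *)
Definition coef (z : R) : R := \int[mu]_(x in D) (ext F (x, z) * q x).

Lemma coef_sqr_le z : ((coef z ^+ 2)%:E <=
  (x1 - x0)%:E * \int[mu]_(x in D) (ext F (x, z) ^+ 2)%:E)%E.
Proof.
set J := (\int[mu]_(x in D) _)%E.
have J0 : (0 <= J)%E by apply: integral_ge0 => x _; rewrite lee_fin sqr_ge0.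
have L0 : 0 < x1 - x0 by rewrite subr_gt0.
have [Jy|Jy] := eqVneq J +oo%E.
  by rewrite Jy gt0_muley ?leey// lte_fin.
have Jlty : (J < +oo)%E by rewrite ltey.
have LS : L2 mu D (fun x => ext F (x, z)) by apply: L2P => //; exact: mS.
have Lq : L2 mu D q.
  apply: (@L2_bounded _ _ _ mu _ _ _ 1) => //; first exact: mu_itv_lty.
  exact: measurable_funTS.
have mD : measurable (D : set (measurableTypeR R)) by exact: measurable_itv.
rewrite /J Rintegrable_fineK//; last by case: LS.
rewrite -EFinM lee_fin /coef; apply: le_trans (Cauchy_Schwarz mD LS Lq) _.
rewrite mulrC ler_wpM2r//; first by apply: Rintegral_ge0 => x _; exact: sqr_ge0.
rewrite -[leRHS]mul1r -(Rintegral_itv_cst 1 (ltW x01)); apply: le_Rintegral => //.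
- by case: Lq.
- exact: Rintegrable_itv_cst.
- by move=> x _; rewrite -[leRHS](expr1n _ 2) ler_norm_sqr normr1.
Qed.

Let Fq_int : mu2.-integrable setT (fun p : RR => (ext F p * q p.1)%:E).
Proof.
have mO := measurable_Omega.
have Lq : L2 mu2 (Om : set RR) (fun p => q p.1).
  apply: (@L2_bounded _ _ _ mu2 _ _ _ 1) => //; first exact: mu2_Omega_lty.
  apply: measurable_funTS; apply: measurableT_comp => //; exact: measurable_fst.
have := L2M mO LF Lq; rewrite /Rintegrable => /(integrable_mkcond _ mO).1.
apply: eq_integrable => // p _; rewrite /ext /= !patchE.
by case: ifP => // _; rewrite mul0r.
Qed.

Lemma measurable_coef : measurable_fun setT coef.
Proof.
have := measurable_fubini_G Fq_int; rewrite /fubini_G => mG.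
have -> : coef = fine \o (fun z => \int[mu]_x (ext F (x, z) * q x)%:E)%E.
  apply/funext => z; rewrite /coef /Rintegral /=; congr fine.
  by apply/esym/integral_supp => x Dx; rewrite ext_outx// mul0r.
by apply: measurableT_comp mG.
Qed.

Lemma L2_coef : L2 mu I coef.
Proof.
apply: L2P => //; first by apply: measurable_funTS; exact: measurable_coef.
apply: (@le_lt_trans _ _ (\int[mu]_(z in I)
    ((x1 - x0)%:E * \int[mu]_(x in D) (ext F (x, z) ^+ 2)%:E))%E).
  apply: ge0_le_integral_nomeas => z _; last exact: coef_sqr_le.
  by rewrite lee_fin sqr_ge0.
rewrite ge0_integralZl//; first 1 last.
- by apply: measurable_funTS; exact: measurable_section_sqr.
- by move=> z _; apply: integral_ge0 => x _; rewrite lee_fin sqr_ge0.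
- by rewrite lee_fin subr_ge0 ltW.
rewrite lte_mul_pinfty ?lee_fin ?subr_ge0 ?(ltW x01)//.
exact: sqr_tonelli_lty.
Qed.

Lemma Fubini_coef (b : R -> R) (B : R) : measurable_fun setT b ->
  (forall z, `|b z| <= B) ->
  \int[mu2]_(p in Om) (F p * (q p.1 * b p.2)) = \int[mu]_(z in I) (coef z * b z).
Proof.
move=> mb bB; have mO := measurable_Omega.
pose f (p : RR) : \bar R := (ext F p * q p.1 * b p.2)%:E.
have fi : mu2.-integrable setT f.
  have mb2 : measurable_fun setT (fun p : RR => b p.2).
    by apply: measurableT_comp => //; exact: measurable_snd.
  by apply: (RintegrableMb (D := setT) _ Fq_int mb2 (fun p _ => bB p.2)).
rewrite /Rintegral; congr fine.
have -> : (\int[mu2]_(p in Om) (F p * (q p.1 * b p.2))%:E = \int[mu2]_p f p)%E.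
  rewrite integral_mkcond; apply: eq_integral => p _.
  rewrite /f /ext !patchE; case: ifP => _; first by rewrite mulrA.
  by rewrite !mul0r.
rewrite -(integral21_prod_meas1 fi) /fubini_G.
rewrite (@integral_supp I); last first.
  by move=> z Iz; rewrite integral0_eq// => x _; rewrite /f ext_outz// !mul0r.
apply: ae_eq_integral; first exact: measurable_itv.
- by apply: measurable_funTS; exact: measurable_fubini_G fi.
- apply/measurable_EFinP; apply: measurable_funTS; apply: measurable_funM => //.
  exact: measurable_coef.
apply: ae_mono ae_section_L2 => z LS Iz.
have {}LS := LS Iz; have mD : measurable (D : set (measurableTypeR R)) by exact: measurable_itv.
have Lq : L2 mu D q.
  apply: (@L2_bounded _ _ _ mu _ _ _ 1) => //; first exact: mu_itv_lty.
  exact: measurable_funTS.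
have iS := L2M mD LS Lq.
rewrite (@integral_supp D); last by move=> x Dx; rewrite /f ext_outx// !mul0r.
rewrite /f /coef -(RintegralZr _ _ iS)// -Rintegrable_fineK//.
have iS' := RintegrableZ mD (b z) iS.
by apply: eq_Rintegrable iS' => // x _; rewrite mulrC.
Qed.

End OneFunction.
End Sections.

(** * Operations on one-variable test functions *)

Section TestFunctions.
Variable R : realType.
Implicit Types b : R -> R.

Lemma smooth_id : smooth (@id R).
Proof.
move=> [|k]; first by move=> x; exact: cvg_id.
split; first by move=> x; exact: derivable_id.
rewrite (_ : derive1 id = cst 1); first exact: Ck1_cst.
by apply/funext => x; rewrite derive1E derive_id.
Qed.

Lemma test1_derive b : test1 b -> test1 (derive1 b).
Proof.
move=> [sb [d d0 bd]]; split; first exact: smooth_deriv.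
exists d => // z zd.
have E : \forall t \near z, b t = cst 0 t.
  move: zd; rewrite negb_and -!ltNge => /orP[zd|zd].
    have : \forall t \near z, t < -1 + d by exact: lt_nbhsl.
    by apply: filterS => t td; apply: bd; rewrite negb_and -!ltNge td.
  have : \forall t \near z, 1 - d < t by exact: lt_nbhsr.
  by apply: filterS => t td; apply: bd; rewrite negb_and -!ltNge td orbT.
by rewrite derive1E (near_eq_derive _ E) derive_cst.
Qed.

Lemma test1_mulz b : test1 b -> test1 (fun z => z * b z).
Proof.
move=> [sb [d d0 bd]]; split; first by apply: smoothM => //; exact: smooth_id.
by exists d => // z /bd ->; rewrite mulr0.
Qed.

Lemma test1_bounded b : test1 b -> exists B, forall z, `|b z| <= B.
Proof.
move=> [sb [d d0 bd]].
have cb : {within `[-1, 1], continuous (fun z => `|b z|)}.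
  apply: continuous_subspaceT => z; apply: cvg_norm.
  exact: smooth_continuous.
have [|c _ cM] := EVT_max _ cb; first by lra.
exists `|b c| => z; have [zI|zI] := boolP (z \in `[-1, 1]); first exact: cM.
rewrite bd ?normr0//; apply: contra zI; rewrite in_itv /= => /andP[? ?].
by apply/andP; split; lra.
Qed.

End TestFunctions.

(** * Weak equations satisfied by the cosine and sine coefficients *)

Section WeakCoefficients.
Variable R : realType.
Notation mu := (@lebesgue_measure R).
Notation mu2 := (@lebesgue_measure R \x @lebesgue_measure R)%E.
Variables x0 x1 : R.
Hypothesis x01 : x0 < x1.
Notation L := (x1 - x0).
Notation D := (`]x0, x1[%classic : set R).
Notation I := (`]-1, 1[%classic : set R).
Notation Om := (Omega x0 x1).
Notation RR := (measurableTypeR R * measurableTypeR R)%type.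
Notation freq := (freq x0 x1).
Notation ec := (ecos x0 x1).
Notation es := (esin x0 x1).
Implicit Types (F G : R * R -> R) (a b q : R -> R).

(** The shift [m.+4] keeps 4 eps at most [L], so that the rise of [cutoff m] on
    [x0 + eps, x0 + 2 eps] ends before its fall on [x1 - 2 eps, x1 - eps] begins. *)
Definition cutoff_eps (m : nat) : R := L / m.+4%:R.

Let eps_gt0 m : 0 < cutoff_eps m.
Proof. by rewrite divr_gt0 ?subr_gt0. Qed.

Let eps_le m : 4 * cutoff_eps m <= L.
Proof.
rewrite mulrA ler_pdivrMr// mulrC ler_wpM2l ?subr_ge0 ?(ltW x01)//.
by rewrite ler_nat.
Qed.

Definition cutoff (m : nat) : R -> R :=
  plateau (x0 + cutoff_eps m) (x1 - 2 * cutoff_eps m) (cutoff_eps m).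

Let cutoff_ord m : x0 + cutoff_eps m <= x1 - 2 * cutoff_eps m.
Proof. by have := eps_le m; have := eps_gt0 m; lra. Qed.

Lemma cutoff_out m x : ~~ (x0 + cutoff_eps m <= x <= x1 - cutoff_eps m) -> cutoff m x = 0.
Proof.
move=> h; apply: plateau_out => //.
by rewrite (_ : x1 - 2 * cutoff_eps m + cutoff_eps m = x1 - cutoff_eps m)//; ring.
Qed.

Lemma near_eps x : D x ->
  \forall m \near \oo, x0 + 2 * cutoff_eps m < x < x1 - 2 * cutoff_eps m.
Proof.
rewrite /= in_itv /= => /andP[x0x xx1].
have L0 : 0 < L by rewrite subr_gt0.
pose d := Num.min (x - x0) (x1 - x) / (2 * L).
have d0 : 0 < d by rewrite divr_gt0 ?lt_min ?subr_gt0 ?x0x ?xx1// mulr_gt0.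
have := near_inv_lt d0; apply: filterS => m md.
have em : 2 * cutoff_eps m < Num.min (x - x0) (x1 - x).
  rewrite /cutoff_eps mulrA mulrC -ltr_pdivlMr; last by rewrite mulr_gt0.
  apply: le_lt_trans md; rewrite lef_pV2 ?posrE// ler_nat; lia.
by move: em; rewrite lt_min => /andP[? ?]; apply/andP; split; lra.
Qed.

Lemma cutoff_cvg x : D x -> cutoff m x @[m --> \oo] --> (1 : R).
Proof.
move=> Dx; apply: cvg_near_cst; have := near_eps Dx; apply: filterS => m /andP[h1 h2].
have e0 := eps_gt0 m; apply: plateau_in => //.
by apply/andP; split; lra.
Qed.

Lemma test_fun_cutoff m q b : smooth q -> test1 b ->
  test_fun x0 x1 (fun p => cutoff m p.1 * q p.1 * b p.2).
Proof.
move=> sq [sb [d d0 bd]].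
have [md me] : Num.min d (cutoff_eps m) <= d /\ Num.min d (cutoff_eps m) <= cutoff_eps m.
  by split; rewrite ge_min lexx ?orbT.
apply: (@test_fun_tensor _ _ _ (Num.min d (cutoff_eps m)) (fun x => cutoff m x * q x)) => //.
- by rewrite lt_min d0 eps_gt0.
- by apply: smoothM => //; exact: smooth_plateau.
- move=> x xm; rewrite cutoff_out ?mul0r//; apply: contra xm => /andP[? ?].
  by apply/andP; split; lra.
- move=> z zm; rewrite bd//; apply: contra zm => /andP[? ?].
  by apply/andP; split; lra.
Qed.

Lemma tensor_cvg F (a : nat -> R -> R) q b (A B : R) :
  L2 mu2 (Om : set RR) F -> (forall m, measurable_fun setT (a m)) ->
  (forall m x, D x -> `|a m x| <= A) ->
  (forall x, D x -> a m x @[m --> \oo] --> q x) ->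
  measurable_fun setT b -> (forall z, `|b z| <= B) ->
  \int[mu2]_(p in Om) (F p * (a m p.1 * b p.2)) @[m --> \oo] -->
  \int[mu2]_(p in Om) (F p * (q p.1 * b p.2)).
Proof.
move=> LF ma aA aq mb bB; have mO := measurable_Omega x0 x1.
have iF := L2_Rintegrable mO (mu2_Omega_lty x0 x1) LF.
have B0 : 0 <= B by apply: le_trans (bB 0).
have mFs : measurable_fun (Om : set RR) F by case: LF.
apply: (@dominated_cvg_Rintegral _ _ _ mu2 _ mO _ _ (fun p => (A * B) * `|F p|)).
- move=> m; apply: measurable_funM => //; apply: measurable_funTS.
  apply: measurable_funM.
    by apply: (measurableT_comp (ma m)); exact: measurable_fst.
  by apply: (measurableT_comp mb); exact: measurable_snd.
- apply: RintegrableZ => //; have /integrable_abse := iF.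
  by apply: eq_integrable.
- move=> -[x z]; rewrite OmegaE => -[/= Dx _].
  apply: cvgM; first exact: cvg_cst.
  by apply: cvgM; [exact: aq|exact: cvg_cst].
- move=> m [x z]; rewrite OmegaE => -[/= Dx _].
  rewrite !normrM mulrC ler_wpM2r//.
  by apply: ler_pM => //; exact: aA.
Qed.

(** The only consequence of a weak z-derivative that the passage to coefficients uses. It holds for
    the pair (phi, g) and also for (g, h), although the hypothesis on h relates it to phi
    directly. *)
Definition weak_cutoff F G := forall m q b, smooth q -> test1 b ->
  \int[mu2]_(p in Om) (F p * (cutoff m p.1 * q p.1 * derive1 b p.2)) =
  - (\int[mu2]_(p in Om) (G p * (cutoff m p.1 * q p.1 * b p.2))).

Lemma weak_dz_cutoff F G : weak_dz x0 x1 F G -> weak_cutoff F G.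
Proof.
move=> FG m q b sq tb; have := FG _ (test_fun_cutoff m sq tb).
rewrite (dz_tensor (fun x => cutoff m x * q x)); last by case: tb.
by rewrite /Rintegral => ->; rewrite fineN.
Qed.

(** Using [weak_dz] with [derive1 b] in place of [b] rewrites [F] against the second derivative of
    [b] as [G] against the first. *)
Lemma weak_dzz_cutoff F G H : weak_dz x0 x1 F G -> weak_dzz x0 x1 F H ->
  weak_cutoff G H.
Proof.
move=> FG FH m q b sq tb; apply: oppr_inj; rewrite opprK.
have tb' := test1_derive tb.
rewrite -(weak_dz_cutoff FG m sq tb').
have := FH _ (test_fun_cutoff m sq tb).
rewrite (dz_tensor (fun x => cutoff m x * q x)); last by case: tb.
rewrite (dz_tensor (fun x => cutoff m x * q x)); last by case: tb'.
by rewrite /Rintegral => ->.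
Qed.

Let cutoff_q_cvg F q b : L2 mu2 (Om : set RR) F -> smooth q ->
  (forall x, `|q x| <= 1) -> test1 b ->
  \int[mu2]_(p in Om) (F p * (cutoff m p.1 * q p.1 * b p.2)) @[m --> \oo] -->
  \int[mu]_(z in I) (coef x0 x1 F q z * b z).
Proof.
move=> LF sq q1 tb; have [B bB] := test1_bounded tb.
have mb : measurable_fun setT b by apply: measurable_fun_smooth; case: tb.
have mq : measurable_fun setT q by exact: measurable_fun_smooth.
rewrite -(Fubini_coef LF mq q1 mb bB).
apply: (@tensor_cvg F (fun m x => cutoff m x * q x) q b 1 B) => //.
- move=> m; apply: measurable_funM => //; apply: measurable_fun_smooth.
  exact: smooth_plateau.
- move=> m x _; rewrite normrM -[leRHS]mulr1; apply: ler_pM => //.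
  exact: plateau_bounded.
- move=> x Dx; rewrite -[X in _ --> X]mul1r; apply: cvgM; last exact: cvg_cst.
  exact: cutoff_cvg.
Qed.

Lemma weak_deriv_coef F G q : L2 mu2 (Om : set RR) F ->
  L2 mu2 (Om : set RR) G -> smooth q -> (forall x, `|q x| <= 1) ->
  weak_cutoff F G -> weak_deriv (coef x0 x1 F q) (coef x0 x1 G q).
Proof.
move=> LF LG sq q1 FG b tb.
have cF := cutoff_q_cvg LF sq q1 (test1_derive tb).
apply: (cvg_unique _ cF) => //; 
  apply: (cvg_trans _ (cvgN (cutoff_q_cvg LG sq q1 tb))); apply: near_eq_cvg.
by apply: nearW => m; rewrite /= (FG m q b sq tb).
Qed.

Lemma esin_le n x : `|es n x| <= n%:R * freq * `|x - x0|.
Proof.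
have f0 := ltW (freq_gt0 x01).
rewrite esinE mulrA -[X in _ <= X * _]ger0_norm; last by rewrite mulr_ge0.
by rewrite -normrM -ler_norm_sqr sqr_sin_le.
Qed.

Lemma esin_le_right n x : `|es n x| <= n%:R * freq * `|x1 - x|.
Proof.
have f0 := ltW (freq_gt0 x01); have s0 := esin_x1 x01 n.
rewrite esinE (_ : n%:R * (freq * (x - x0)) =
  n%:R * (freq * (x1 - x0)) - n%:R * freq * (x1 - x)); last by ring.
rewrite sinB -esinE s0 mul0r sub0r normrN normrM.
apply: (@le_trans _ _ `|sin (n%:R * freq * (x1 - x))|).
  by rewrite ler_piMl// ler_norml cos_geN1 cos_le1.
rewrite -[X in _ <= X * _]ger0_norm; last by rewrite mulr_ge0.
by rewrite -normrM -ler_norm_sqr sqr_sin_le.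
Qed.

Lemma derive_cutoff_esin m n x : derive1 (fun x => cutoff m x * es n x) x =
  derive1 (cutoff m) x * es n x + cutoff m x * (n%:R * freq * ec n x).
Proof.
have sc : smooth (cutoff m) by exact: smooth_plateau.
have := is_deriveM (smooth_is_derive x sc) (smooth_is_derive x (smooth_esin x0 x1 n)).
move=> h; rewrite derive1E [LHS]derive_val derive1_esin.
by rewrite /GRing.scale /= addrC [es n x * _]mulrC.
Qed.

(* The sine vanishes at both end points, which compensates the 1/eps blow-up
   of the derivative of the cutoff. *)
Lemma derive_cutoff_esin_bounded n :
  exists A, forall m x, `|derive1 (cutoff m) x * es n x| <= A.
Proof.
have [M M0 rM] := derive_ramp_bounded R.
have f0 := ltW (freq_gt0 x01).
have nf0 : 0 <= n%:R * freq by rewrite mulr_ge0.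
have Me m : M / cutoff_eps m * (n%:R * freq * (2 * cutoff_eps m)) = 2 * M * (n%:R * freq).
  by have e0 : cutoff_eps m != 0 by [rewrite gt_eqF]; field.
have [S [S0 SE]] : exists S, 0 <= S /\ S = 2 * M * (n%:R * freq).
  by eexists; split; last reflexivity; rewrite mulr_ge0// mulr_ge0// ltW.
exists (S + S) => m x; have e0 := eps_gt0 m.
have Me0 : 0 <= M / cutoff_eps m by rewrite divr_ge0 ?ltW.
rewrite /cutoff derive_plateauE mulrBl; apply: le_trans (ler_normB _ _) _.
apply: lerD; rewrite normrM.
- have [xm|xm] := boolP (x0 + cutoff_eps m <= x <= x0 + cutoff_eps m + cutoff_eps m); last first.
    by rewrite derive_ramp_out// normr0 mul0r.
  rewrite SE -(Me m); apply: ler_pM => //; first exact: rM.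
  apply: le_trans (esin_le n x) _; rewrite ler_wpM2l// ler_norml.
  by move: xm => /andP[? ?]; apply/andP; split; lra.
- have [xm|xm] := boolP (x1 - 2 * cutoff_eps m <= x <= x1 - 2 * cutoff_eps m + cutoff_eps m); last first.
    by rewrite derive_ramp_out// normr0 mul0r.
  rewrite SE -(Me m); apply: ler_pM => //; first exact: rM.
  apply: le_trans (esin_le_right n x) _; rewrite ler_wpM2l// ler_norml.
  by move: xm => /andP[? ?]; apply/andP; split; lra.
Qed.

Lemma derive_cutoff_cvg0 x (c : R) : D x ->
  derive1 (cutoff m) x * c @[m --> \oo] --> (0 : R).
Proof.
move=> Dx; apply: cvg_near_cst; have := near_eps Dx; apply: filterS => m /andP[h1 h2].
have e0 := eps_gt0 m; rewrite /cutoff derive_plateauE !derive_ramp_out ?subr0 ?mul0r//.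
- by rewrite negb_and -!ltNge; apply/orP; left; lra.
- by rewrite negb_and -!ltNge; apply/orP; right; lra.
Qed.

(** Test with cutoff times sine. The term with the derivative of the cutoff is bounded and tends to
    0 pointwise, so dominated convergence removes it and no boundary term survives. *)
Lemma weak_z_dx_coef F K n b : L2 mu2 (Om : set RR) F ->
  L2 mu2 (Om : set RR) K -> weak_z_dx x0 x1 F K -> test1 b ->
  \int[mu]_(z in I) (coef x0 x1 F (ec n) z * (n%:R * freq * (z * b z))) =
  - (\int[mu]_(z in I) (coef x0 x1 K (es n) z * b z)).
Proof.
move=> LF LK FK tb.
have sc m : smooth (fun x => cutoff m x * es n x).
  by apply: smoothM; [exact: smooth_plateau|exact: smooth_esin].
have [A hA] := derive_cutoff_esin_bounded n.
have tz := test1_mulz tb; have [B bB] := test1_bounded tz.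
have mz : measurable_fun setT (fun z : R => z * b z).
  by apply: measurable_fun_smooth; case: tz.
have f0 := ltW (freq_gt0 x01).
have nf0 : 0 <= n%:R * freq by rewrite mulr_ge0.
have cF : \int[mu2]_(p in Om) (F p *
    (derive1 (fun x => cutoff m x * es n x) p.1 * (p.2 * b p.2))) @[m --> \oo] -->
  \int[mu2]_(p in Om) (F p * (n%:R * freq * ec n p.1 * (p.2 * b p.2))).
  apply: (@tensor_cvg F (fun m => derive1 (fun x => cutoff m x * es n x))
    (fun x => n%:R * freq * ec n x) (fun z => z * b z) (A + n%:R * freq) B) => //.
  - by move=> m; apply: measurable_fun_smooth; exact: smooth_deriv.
  - move=> m x _; rewrite derive_cutoff_esin; apply: le_trans (ler_normD _ _) _.
    apply: lerD => //; rewrite mulrCA normrM ger0_norm// -[leRHS]mulr1 ler_wpM2l//.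
    rewrite normrM -[leRHS]mulr1; apply: ler_pM => //; first exact: plateau_bounded.
    exact: ecos_le1.
  - move=> x Dx; have cc : derive1 (cutoff m) x * es n x +
        cutoff m x * (n%:R * freq * ec n x) @[m --> \oo] -->
        0 + 1 * (n%:R * freq * ec n x).
      apply: cvgD; first exact: derive_cutoff_cvg0.
      by apply: cvgM; [exact: cutoff_cvg|exact: cvg_cst].
    rewrite add0r mul1r in cc; apply: (cvg_trans _ cc); apply: near_eq_cvg.
    by apply: nearW => m; rewrite /= derive_cutoff_esin.
have cK := cutoff_q_cvg LK (smooth_esin x0 x1 n) (esin_le1 x0 x1 n) tb.
transitivity (\int[mu2]_(p in Om) (F p * (n%:R * freq * ec n p.1 * (p.2 * b p.2)))).
  have me : measurable_fun setT (ec n) by exact: measurable_ecos.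
  have mb' : measurable_fun setT (fun z : R => n%:R * freq * (z * b z)).
    exact: measurable_funM.
  have bB' z : `|n%:R * freq * (z * b z)| <= n%:R * freq * B.
    by rewrite normrM ger0_norm// ler_wpM2l.
  rewrite -(Fubini_coef LF me (ecos_le1 x0 x1 n) mb' bB').
  by congr Rintegral; apply/funext => p; congr (_ * _); ring.
apply: (cvg_unique _ cF) => //; apply: (cvg_trans _ (cvgN cK)); apply: near_eq_cvg.
apply: nearW => m; have := FK _ (test_fun_cutoff m (smooth_esin x0 x1 n) tb).
rewrite (dx_tensor _ (sc m)) => e.
transitivity (fine (- \int[mu2]_(p in Om)
    (K p * (cutoff m p.1 * es n p.1 * b p.2))%:E)%E); first by rewrite fineN.
rewrite -e; congr fine.
by apply: eq_integral => p _; congr EFin; ring.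
Qed.

Lemma ae_z_coef F K n : L2 mu2 (Om : set RR) F ->
  L2 mu2 (Om : set RR) K -> weak_z_dx x0 x1 F K ->
  {ae mu, forall z, I z ->
    n%:R * freq * (z * coef x0 x1 F (ec n) z) = - coef x0 x1 K (es n) z}.
Proof.
move=> LF LK FK.
have mI : measurable (I : set (measurableTypeR R)) by exact: measurable_itv.
have Iy : (mu I < +oo)%E by exact: mu_itv_lty.
have LcF : L2 mu I (coef x0 x1 F (ec n)).
  by apply: L2_coef => //; [exact: measurable_ecos|exact: ecos_le1].
have LcK : L2 mu I (coef x0 x1 K (es n)).
  by apply: L2_coef => //; [exact: measurable_esin|exact: esin_le1].
pose f1 z := coef x0 x1 F (ec n) z * (n%:R * freq * z).
have i1 : Rintegrable mu I f1.
  apply: (@RintegrableMb _ _ _ mu _ mI `|n%:R * freq|).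
  - exact: L2_Rintegrable LcF.
  - by apply: measurable_funM => //; exact: measurable_cst.
  - move=> z; rewrite /= in_itv /= => /andP[? ?].
    by rewrite normrM ler_piMr// ler_norml; apply/andP; split; lra.
have i2 := L2_Rintegrable mI Iy LcK.
have i12 := RintegrableD mI i1 i2.
have f0 b : test1 b ->
    \int[mu]_(z in I) ((f1 z + coef x0 x1 K (es n) z) * b z) = 0.
  move=> tb; have [B bB] := test1_bounded tb.
  have mb : measurable_fun I b by apply: measurable_fun_smooth; case: tb.
  have j1 := RintegrableMb mI i1 mb (fun z _ => bB z).
  have j2 := RintegrableMb mI i2 mb (fun z _ => bB z).
  transitivity (\int[mu]_(z in I) (f1 z * b z + coef x0 x1 K (es n) z * b z)).
    by apply: eq_Rintegral => z _; rewrite mulrDl.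
  rewrite (RintegralD _ j1 j2)//; apply/eqP; rewrite addr_eq0; apply/eqP.
  rewrite -(weak_z_dx_coef n LF LK FK tb).
  by apply: eq_Rintegral => z _; rewrite /f1; ring.
have := ae_good i12; apply: ae_mono => z gz Iz.
apply/eqP; rewrite -addr_eq0; apply/eqP.
by rewrite -[RHS](weak_zero i12 (gz Iz) f0) /f1; ring.
Qed.

(** [degenerate_interpolation] for the coefficients, with n z u_n replaced by - k_n / freq almost
    everywhere; this is the origin of [freq ^- 2]. *)
Lemma coef_ineq phi g h k n : (0 < n)%N ->
  L2 mu2 (Om : set RR) phi -> L2 mu2 (Om : set RR) g ->
  L2 mu2 (Om : set RR) h -> L2 mu2 (Om : set RR) k ->
  weak_dz x0 x1 phi g -> weak_dzz x0 x1 phi h -> weak_z_dx x0 x1 phi k ->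
  n%:R * (\int[mu]_(z in I) (`|z| * coef x0 x1 g (ec n) z ^+ 2)) <=
  deg_cst R * (freq ^- 2 * (\int[mu]_(z in I) coef x0 x1 k (es n) z ^+ 2) +
               \int[mu]_(z in I) coef x0 x1 h (ec n) z ^+ 2).
Proof.
move=> n0 Lp Lg Lh Lk pg ph pk.
have mI : measurable (I : set (measurableTypeR R)) by exact: measurable_itv.
have LcE F : L2 mu2 (Om : set RR) F -> L2 mu I (coef x0 x1 F (ec n)).
  by move=> LF; apply: L2_coef => //; [exact: measurable_ecos|exact: ecos_le1].
have LcK : L2 mu I (coef x0 x1 k (es n)).
  by apply: L2_coef => //; [exact: measurable_esin|exact: esin_le1].
have w1 := weak_deriv_coef Lp Lg (smooth_ecos x0 x1 n) (ecos_le1 x0 x1 n)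
  (weak_dz_cutoff pg).
have w2 := weak_deriv_coef Lg Lh (smooth_ecos x0 x1 n) (ecos_le1 x0 x1 n)
  (weak_dzz_cutoff pg ph).
have := degenerate_interpolation (LcE _ Lp) (LcE _ Lg) (LcE _ Lh) w1 w2 n0.
move=> /le_trans; apply; rewrite ler_wpM2l ?deg_cst_ge0// lerD2r.
have iz := Rintegrable_sqr_sqr (LcE _ Lp).
have ik : Rintegrable mu I (fun z => coef x0 x1 k (es n) z ^+ 2) by case: LcK.
rewrite -(RintegralZl _ _ iz)// -(RintegralZl _ _ ik)//.
have fp := freq_gt0 x01.
apply: ae_le_Rintegral => //; [exact: RintegrableZ|exact: RintegrableZ|].
apply: ae_mono (ae_z_coef n Lp Lk pk) => z e Iz.
rewrite -[X in _ <= _ * X]sqrrN -(e Iz) le_eqVlt; apply/orP; left; apply/eqP.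
by have fn : freq != 0 by [rewrite gt_eqF]; field.
Qed.

End WeakCoefficients.

(** * Summation over frequencies and the final estimate *)

Section MainEstimate.
Variable R : realType.
Notation mu := (@lebesgue_measure R).
Notation mu2 := (@lebesgue_measure R \x @lebesgue_measure R)%E.
Variables x0 x1 : R.
Hypothesis x01 : x0 < x1.
Notation L := (x1 - x0).
Notation D := (`]x0, x1[%classic : set R).
Notation I := (`]-1, 1[%classic : set R).
Notation Om := (Omega x0 x1).
Notation RR := (measurableTypeR R * measurableTypeR R)%type.
Notation freq := (freq x0 x1).
Notation ec := (ecos x0 x1).
Notation es := (esin x0 x1).
Notation sqrI F := (\int[mu2]_(p in Om) F p ^+ 2).
Implicit Types (F G : R * R -> R).

Let mD : measurable (D : set (measurableTypeR R)).
Proof. exact: measurable_itv. Qed.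

Let mI : measurable (I : set (measurableTypeR R)).
Proof. exact: measurable_itv. Qed.

Let mO := measurable_Omega x0 x1.

Lemma L2_on_L2 F : L2_on Om F -> L2 mu2 (Om : set RR) F.
Proof. by move=> [mF Fy]; exact: L2P. Qed.

Lemma L2normE F : L2 mu2 (Om : set RR) F ->
  L2norm Om F = (Num.sqrt (sqrI F))%:E.
Proof.
move=> LF; rewrite /L2norm unlock.
have -> : (\int[leb2 (R:=R)]_x `|(EFin \o F \_ Om) x| `^ 2 =
    \int[mu2]_(p in Om) (F p ^+ 2)%:E)%E.
  rewrite [RHS]integral_mkcond; apply: eq_integral => p _ /=.
  rewrite powR_mulrn// real_normK ?num_real// !patchE.
  by case: ifP => // _; rewrite expr0n.
rewrite Rintegrable_fineK//; last by case: LF.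
rewrite poweR_EFin powR12_sqrt//.
by apply: Rintegral_ge0 => p _; exact: sqr_ge0.
Qed.

Lemma Bessel_coef F (e : nat -> R -> R) :
  L2 mu2 (Om : set RR) F ->
  (forall n, measurable_fun setT (e n)) -> (forall n x, `|e n x| <= 1) ->
  (forall m n, \int[mu]_(x in D) (e m x * e n x) = (L / 2) *+ (m == n)) ->
  forall M, \sum_(n < M) (\int[mu]_(z in I) coef x0 x1 F (e n) z ^+ 2) <=
    L / 2 * sqrI F.
Proof.
move=> LF me e1 eo M.
have L0 : 0 < L / 2 by rewrite divr_gt0// subr_gt0.
have Le n : L2 mu D (e n).
  apply: (@L2_bounded _ _ _ mu _ mD _ 1) => //; first exact: mu_itv_lty.
  by apply: measurable_funTS; exact: me.
have ic n : Rintegrable mu I (fun z => coef x0 x1 F (e n) z ^+ 2).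
  by case: (L2_coef x01 LF (me n) (e1 n)).
rewrite -(Rintegral_sum mI _ (fun n : 'I_M => ic n)) -lee_fin.
rewrite -Rintegrable_fineK//; last by apply: Rintegrable_sum.
rewrite EFinM -Rintegrable_fineK//; last by case: LF.
rewrite -(sqr_tonelli LF) -ge0_integralZl//; first last.
- by rewrite lee_fin ltW.
- by move=> z _; apply: integral_ge0 => x _; rewrite lee_fin sqr_ge0.
- by apply: measurable_funTS; exact: measurable_section_sqr.
apply: ge0_le_integral_nomeas => z _.
  by rewrite lee_fin sumr_ge0// => n _; exact: sqr_ge0.
set J := (\int[mu]_(x in D) _)%E.
have J0 : (0 <= J)%E by apply: integral_ge0 => x _; rewrite lee_fin sqr_ge0.
have [Jy|Jy] := eqVneq J +oo%E.
  by rewrite Jy gt0_muley ?leey// lte_fin.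
have Jlty : (J < +oo)%E by rewrite ltey.
have LS : L2 mu D (fun x => ext x0 x1 F (x, z)).
  by apply: L2P => //; apply: measurable_funTS; exact: measurable_section.
rewrite /J Rintegrable_fineK//; last by case: LS.
by rewrite -EFinM lee_fin; exact: Bessel.
Qed.

Section Slices.
Variable g : R * R -> R.
Hypothesis Lg : L2 mu2 (Om : set RR) g.
Notation eg := (ext x0 x1 g).

(** The variables are ordered ((z, x), y), so that two uses of [measurable_section_integral]
    integrate out y and then x, leaving a function of z. *)
Let quot (p : RR * measurableTypeR R) : \bar R :=
  ((eg (p.1.2, p.1.1) - eg (p.2, p.1.1)) ^+ 2 / (p.1.2 - p.2) ^+ 2)%:E.

Let quot_ge0 p : (0 <= quot p)%E.
Proof. by rewrite lee_fin divr_ge0// sqr_ge0. Qed.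

Let mquot : measurable_fun setT quot.
Proof.
have m11 : measurable_fun setT (fun p : RR * measurableTypeR R => p.1.1).
  by apply: (measurableT_comp (f := fst)); exact: measurable_fst.
have m12 : measurable_fun setT (fun p : RR * measurableTypeR R => p.1.2).
  by apply: (measurableT_comp (f := snd)); [exact: measurable_snd|exact: measurable_fst].
have m2 : measurable_fun setT (fun p : RR * measurableTypeR R => p.2).
  exact: measurable_snd.
have mg := measurable_ext Lg.
apply/measurable_EFinP; apply: measurable_funM.
  apply: measurable_funX; apply: measurable_funB.
    by apply: (measurableT_comp mg); exact: measurable_fun_pair.
  by apply: (measurableT_comp mg); exact: measurable_fun_pair.
apply: (measurableT_comp (@measurable_inv R)).
by apply: measurable_funX; exact: measurable_funB.
Qed.

Let slob1 (p : RR) : \bar R := (\int[mu]_(y in D) quot (p, y))%E.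

Let slob1_ge0 p : (0 <= slob1 p)%E.
Proof. by apply: integral_ge0 => y _; exact: quot_ge0. Qed.

Let mslob1 : measurable_fun setT slob1.
Proof. exact: measurable_section_integral. Qed.

Definition slob (z : R) : \bar R := (\int[mu]_(x in D) \int[mu]_(y in D)
  ((eg (x, z) - eg (y, z)) ^+ 2 / (x - y) ^+ 2)%:E)%E.

Lemma slob_ge0 z : (0 <= slob z)%E.
Proof. by apply: integral_ge0 => x _; exact: (slob1_ge0 (z, x)). Qed.

Lemma measurable_slob : measurable_fun setT slob.
Proof. exact: (@measurable_section_integral _ _ _ _ slob1). Qed.

Definition sect2 (z : R) : \bar R := (\int[mu]_(x in D) (eg (x, z) ^+ 2)%:E)%E.

Lemma sect2_ge0 z : (0 <= sect2 z)%E.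
Proof. by apply: integral_ge0 => x _; rewrite lee_fin sqr_ge0. Qed.

Lemma H12norm2E z : I z ->
  H12norm2 x0 x1 (fun x => (Num.sqrt `|z| * g (x, z))%R) =
  (`|z|%:E * sect2 z + `|z|%:E * slob z)%E.
Proof.
move=> Iz; rewrite /H12norm2 /leb; congr (_ + _)%E.
  rewrite -ge0_integralZl_EFin//.
  - apply: eq_integral => x /set_mem Dx.
    by rewrite ext_in// exprMn sqr_sqrtr// EFinM.
  - by move=> x _; rewrite lee_fin sqr_ge0.
  - apply/measurable_EFinP; apply: measurable_funX; apply: measurable_funTS.
    exact: measurable_section.
rewrite -ge0_integralZl_EFin//.
- apply: eq_integral => x /set_mem Dx; rewrite -ge0_integralZl_EFin//.
  + apply: eq_integral => y /set_mem Dy.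
    by rewrite !ext_in// -mulrBr exprMn sqr_sqrtr// -mulrA EFinM.
  + by move=> y _; exact: (quot_ge0 ((z, x), y)).
  + have mq : measurable_fun setT (fun y => quot ((z, x), y)).
      by apply: (measurableT_comp mquot); exact: measurable_pair1.
    exact: measurable_funTS mq.
- by move=> x _; exact: (slob1_ge0 (z, x)).
- have ms : measurable_fun setT (fun x => slob1 (z, x)).
    by apply: (measurableT_comp mslob1); exact: measurable_pair1.
  exact: measurable_funTS ms.
Qed.

Let mabs : measurable_fun setT (fun z : R => `|z|%:E).
Proof. by apply/measurable_EFinP; 
  apply: measurable_fun_continuous => z; exact: norm_continuous. Qed.

Let m1 : measurable_fun I (fun z => `|z|%:E * sect2 z)%E.
Proof.
apply: measurable_funTS; apply: emeasurable_funM; first exact: mabs.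
exact: measurable_section_sqr.
Qed.

Let m2 : measurable_fun I (fun z => `|z|%:E * slob z)%E.
Proof.
apply: measurable_funTS; apply: emeasurable_funM; [exact: mabs|]; exact: measurable_slob.
Qed.

Lemma measurable_H12norm2 : measurable_fun I
  (fun z => H12norm2 x0 x1 (fun x => (Num.sqrt `|z| * g (x, z))%R)).
Proof.
have h : {in I, (fun z : R => `|z|%:E * sect2 z + `|z|%:E * slob z)%E =1
    (fun z => H12norm2 x0 x1 (fun x => (Num.sqrt `|z| * g (x, z))%R))}.
  by move=> z /set_mem Iz; rewrite H12norm2E.
apply: (@eq_measurable_fun _ _ _ _ _ _ _ h).
exact: (emeasurable_funD m1 m2).
Qed.

Lemma integral_H12norm2_le :
  (\int[mu]_(z in I) H12norm2 x0 x1 (fun x => (Num.sqrt `|z| * g (x, z))%R) <=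
   (sqrI g)%:E + \int[mu]_(z in I) (`|z|%:E * slob z))%E.
Proof.
have -> : (\int[mu]_(z in I) H12norm2 x0 x1 (fun x => (Num.sqrt `|z| * g (x, z))%R) =
    \int[mu]_(z in I) (`|z|%:E * sect2 z + `|z|%:E * slob z))%E.
  by apply: eq_integral => z /set_mem Iz; rewrite H12norm2E.
rewrite ge0_integralD//; first last.
- by move=> z _; rewrite mule_ge0 ?slob_ge0.
- by move=> z _; rewrite mule_ge0 ?sect2_ge0.
apply: leeD => //.
rewrite -Rintegrable_fineK//; last by case: Lg.
rewrite -(sqr_tonelli Lg); apply: ge0_le_integral_nomeas => z.
  by move=> _; rewrite mule_ge0 ?sect2_ge0.
rewrite /= in_itv /= => /andP[? ?].
rewrite -[leRHS]mul1e lee_wpmul2r ?sect2_ge0// lee_fin ler_norml.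
by apply/andP; split; lra.
Qed.

(** Apply [seminorm_le] to almost every slice and exchange the sum with the integral over z by
    nonnegativity; bounds on the partial sums are then enough. *)
Lemma integral_slob_le (B : R) : (forall M, \sum_(n < M)
    n.+1%:R * (\int[mu]_(z in I) (`|z| * coef x0 x1 g (ec n.+1) z ^+ 2)) <= B) ->
  (\int[mu]_(z in I) (`|z|%:E * slob z) <= (8 * freq ^+ 2 * B)%:E)%E.
Proof.
move=> hB.
pose t n (z : R) : \bar R := (n.+1%:R * (`|z| * coef x0 x1 g (ec n.+1) z ^+ 2))%:E.
have t0 n z : (0 <= t n z)%E.
  by rewrite lee_fin mulr_ge0// mulr_ge0// sqr_ge0.
have Lc n : L2 mu I (coef x0 x1 g (ec n.+1)).
  by apply: L2_coef => //; [exact: measurable_ecos|exact: ecos_le1].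
have it n := Rintegrable_norm_sqr (Lc n).
have mt n : measurable_fun I (t n).
  apply/measurable_EFinP.
  exact: measurable_Rintegrable (RintegrableZ mI n.+1%:R (it n)).
have mts : measurable_fun I (fun z : R => \sum_(0 <= n <oo) t n z)%E.
  exact: (@ge0_emeasurable_sum _ _ _ _ t xpredT (fun n z _ _ => t0 n z) (fun n _ => mt n)).
have f0 : 0 <= 8 * freq ^+ 2 by rewrite mulr_ge0// sqr_ge0.
apply: (@le_trans _ _ (\int[mu]_(z in I)
    ((8 * freq ^+ 2)%:E * \sum_(0 <= n <oo) t n z))%E).
  apply: ae_ge0_le_integral => //.
  - by move=> z _; rewrite mule_ge0 ?slob_ge0.
  - by move=> z _; rewrite mule_ge0 ?lee_fin// nneseries_ge0.
  - apply: emeasurable_funM; first exact: measurable_cst.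
    exact: mts.
  apply: ae_mono (ae_section_L2 Lg) => z LS Iz.
  have := seminorm_le x01 (measurable_section Lg z) (LS Iz).
  move=> /(lee_wpmul2l _) => /(_ `|z|%:E) h.
  apply: le_trans (h _) _; first by rewrite lee_fin.
  rewrite muleCA lee_wpmul2l ?lee_fin// -nneseriesZl; last first.
    by move=> n _; rewrite lee_fin mulr_ge0// sqr_ge0.
  apply: lee_nneseries => [n _ _|n _].
    by rewrite mule_ge0 ?lee_fin// mulr_ge0// sqr_ge0.
  by rewrite -EFinM lee_fin /cos_coef mulrCA.
rewrite ge0_integralZl_EFin//; first last.
- by move=> z _; rewrite nneseries_ge0.
rewrite [leRHS]EFinM lee_wpmul2l ?lee_fin// integral_nneseries//.
apply: lime_le; first by apply: is_cvg_nneseries => n _ _; exact: integral_ge0.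
apply: nearW => M; rewrite big_mkord.
rewrite (eq_bigr (fun n : 'I_M => (n.+1%:R *
    (\int[mu]_(z in I) (`|z| * coef x0 x1 g (ec n.+1) z ^+ 2)))%:E)).
  rewrite sumEFin lee_fin; exact: hB.
move=> n _; rewrite /t Rintegrable_fineK//; last exact: RintegrableZ.
by rewrite (RintegralZl _ _ (it n)).
Qed.

End Slices.

(** The 1 pays for the L^2 part, since |z| <= 1. The factor 8 freq^2 comes from [seminorm_le],
    [deg_cst] from the interpolation, [freq ^- 2] and 1 from the terms of k and h, and L/2 from
    Bessel's inequality. *)
Definition main_cst : R :=
  1 + 8 * freq ^+ 2 * (deg_cst R * ((freq ^- 2 + 1) * (L / 2))).

Lemma main_cst_ge1 : 1 <= main_cst.
Proof.
rewrite /main_cst lerDl; apply: mulr_ge0; first by rewrite mulr_ge0// sqr_ge0.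
apply: mulr_ge0; first exact: deg_cst_ge0.
apply: mulr_ge0; last by rewrite divr_ge0// subr_ge0 ltW.
by rewrite addr_ge0// invr_ge0 sqr_ge0.
Qed.

Lemma sqrI_ge0 F : 0 <= sqrI F.
Proof. by apply: Rintegral_ge0 => p _; exact: sqr_ge0. Qed.

Lemma integral_H12norm2_main phi g h k : inZ0 x0 x1 phi g h k ->
  (\int[mu]_(z in I) H12norm2 x0 x1 (fun x => (Num.sqrt `|z| * g (x, z))%R) <=
   (main_cst * (sqrI g + sqrI h + sqrI k))%:E)%E.
Proof.
move=> [/L2_on_L2 Lp /L2_on_L2 Lg /L2_on_L2 Lh /L2_on_L2 Lk [pg ph pk]].
apply: le_trans (integral_H12norm2_le Lg) _.
have f0 : 0 <= 8 * freq ^+ 2 by rewrite mulr_ge0// sqr_ge0.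
have i0 : 0 <= freq ^- 2 by rewrite invr_ge0 sqr_ge0.
have d0 := deg_cst_ge0 R.
have L0 : 0 <= L / 2 by rewrite divr_ge0// subr_ge0 ltW.
have g0 := sqrI_ge0 g; have h0 := sqrI_ge0 h; have k0 := sqrI_ge0 k.
pose B := deg_cst R * (freq ^- 2 * (L / 2 * sqrI k) + L / 2 * sqrI h).
have hB M : \sum_(n < M) n.+1%:R *
    (\int[mu]_(z in I) (`|z| * coef x0 x1 g (ec n.+1) z ^+ 2)) <= B.
  apply: (@le_trans _ _ (\sum_(n < M) deg_cst R *
      (freq ^- 2 * (\int[mu]_(z in I) coef x0 x1 k (es n.+1) z ^+ 2) +
       \int[mu]_(z in I) coef x0 x1 h (ec n.+1) z ^+ 2))).
    by apply: ler_sum => n _; exact: (coef_ineq x01 (ltn0Sn n) Lp).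
  rewrite -mulr_sumr big_split -mulr_sumr /=.
  apply: ler_wpM2l => //; apply: lerD; first apply: ler_wpM2l => //.
    (* The index starts at 1 in both systems: [es 0] vanishes, and [ec 0] has squared norm [L]
       instead of [L / 2]. *)
    apply: (Bessel_coef (e := fun n => es n.+1)) => //.
    - by move=> n; exact: measurable_esin.
    - by move=> n x; exact: esin_le1.
    - by move=> m n; rewrite esin_orthogonal.
  apply: (Bessel_coef (e := fun n => ec n.+1)) => //.
  - by move=> n; exact: measurable_ecos.
  - by move=> n x; exact: ecos_le1.
  - by move=> m n; rewrite ecos_orthogonal.
apply: (@le_trans _ _ ((sqrI g)%:E + (8 * freq ^+ 2 * B)%:E)%E).
  by apply: leeD => //; exact: integral_slob_le.
rewrite -EFinD lee_fin /main_cst.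
set c := 8 * freq ^+ 2 in f0 *.
have -> : c * B = c * (deg_cst R * ((freq ^- 2 * sqrI k + sqrI h) * (L / 2))).
  by rewrite /B; ring.
rewrite [leRHS]mulrDl mul1r; apply: lerD; first by rewrite -addrA lerDl addr_ge0.
rewrite -[leRHS]mulrA; apply: ler_wpM2l => //.
rewrite -[leRHS]mulrA; apply: ler_wpM2l => //.
rewrite mulrAC; apply: ler_wpM2r => //.
have := mulr_ge0 i0 g0; have := mulr_ge0 i0 h0; rewrite !mulrDl !mulrDr; lra.
Qed.


Lemma sqrt_addr_le (a b : R) : 0 <= a -> 0 <= b ->
  Num.sqrt (a + b) <= Num.sqrt a + Num.sqrt b.
Proof.
move=> a0 b0; rewrite -(@ler_pXn2r _ 2%N) ?nnegrE ?addr_ge0 ?sqrtr_ge0//.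
rewrite sqrrD !sqr_sqrtr ?addr_ge0//.
by rewrite -addrA lerD2l lerDr mulrn_wge0// mulr_ge0 ?sqrtr_ge0.
Qed.

Lemma H12norm2_ge0 f : (0 <= H12norm2 x0 x1 f)%E.
Proof.
rewrite /H12norm2 adde_ge0//; apply: integral_ge0 => x _.
  by rewrite lee_fin sqr_ge0.
by apply: integral_ge0 => y _; rewrite lee_fin divr_ge0// sqr_ge0.
Qed.

Lemma main_estimate phi g h k : inZ0 x0 x1 phi g h k ->
  ((\int[mu]_(z in I) H12norm2 x0 x1 (fun x => (Num.sqrt `|z| * g (x, z))%R))
     `^ 2^-1 <= (Num.sqrt main_cst)%:E * Z0norm x0 x1 phi g h k)%E.
Proof.
move=> Z; have := integral_H12norm2_main Z.
case: Z => [/L2_on_L2 Lp /L2_on_L2 Lg /L2_on_L2 Lh /L2_on_L2 Lk _].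
set N := (\int[mu]_(z in I) _)%E.
have N0 : (0 <= N)%E by apply: integral_ge0 => z _; exact: H12norm2_ge0.
have g0 := sqrI_ge0 g; have h0 := sqrI_ge0 h; have k0 := sqrI_ge0 k.
have c0 : 0 <= main_cst by apply: le_trans main_cst_ge1.
rewrite /Z0norm !L2normE// -!EFinD -EFinM.
case: N N0 => [r| |]// r0; rewrite !lee_fin in r0 * => rle.
rewrite powR12_sqrt//.
apply: (@le_trans _ _ (Num.sqrt (main_cst * (sqrI g + sqrI h + sqrI k)))).
  exact: ler_wsqrtr.
rewrite sqrtrM//; apply: ler_wpM2l; first exact: sqrtr_ge0.
apply: le_trans (sqrt_addr_le (addr_ge0 g0 h0) k0) _.
have := sqrt_addr_le g0 h0; have := sqrtr_ge0 (sqrI phi); lra.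
Qed.

End MainEstimate.

Unset Implicit Arguments.

Theorem lemmaB12 (R : realType) (x0 x1 : R) (hx : x0 < x1) :
  exists C : R, 0 < C /\
  forall phi g h k : R * R -> R,
    inZ0 x0 x1 phi g h k ->
    let w : R * R -> R := fun p => Num.sqrt `|p.2| * g p in
    [/\ {ae leb R, forall z : R, (@zI R) z ->
                     inH12 x0 x1 (fun x => w (x, z))},
        measurable_fun ((@zI R)) (fun z : R => H12norm2 x0 x1 (fun x => w (x, z))),
        (\int[leb R]_(z in (@zI R)) H12norm2 x0 x1 (fun x => w (x, z)) < +oo)%E
      & ((\int[leb R]_(z in (@zI R)) H12norm2 x0 x1 (fun x => w (x, z)))
            `^ (2^-1) <= C%:E * Z0norm x0 x1 phi g h k)%E].
Proof.
exists (Num.sqrt (main_cst x0 x1)); split.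
  by rewrite sqrtr_gt0; apply: lt_le_trans (main_cst_ge1 hx).
move=> phi g h k Z w; have Lg : L2 (leb2 (R:=R)) (Omega x0 x1) g.
  by case: Z => _ /L2_on_L2.
have mH := measurable_H12norm2 Lg.
have Hy := le_lt_trans (integral_H12norm2_main hx Z) (ltry _).
split; [| exact: mH | exact: Hy | exact: (main_estimate hx Z)].
have mI : measurable (@zI R : set (measurableTypeR R)) by exact: measurable_itv.
have iH : (leb R).-integrable (@zI R)
    (fun z => H12norm2 x0 x1 (fun x => w (x, z))).
  apply/integrableP; split; first exact: mH.
  under eq_integral do rewrite gee0_abs ?H12norm2_ge0//.
  exact: Hy.
have := integrable_ae mI iH.
apply: ae_mono => z zf Iz; split; last by rewrite ltey_eq (zf Iz).
(* Slices of the zero extension are measurable for every [z], and they agree with those of [g] on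
   the interval. *)
have ms : measurable_fun `]x0, x1[ (fun x => Num.sqrt `|z| * ext x0 x1 g (x, z)).
  apply: measurable_funTS; apply: measurable_funM; first exact: measurable_cst.
  exact: measurable_section.
apply: eq_measurable_fun ms => x /set_mem Dx; by rewrite ext_in.
Qed.
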